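(* Let $f:T^2\to S^3$ be either a constrained Willmore torus of revolution or a constrained Willmore Hopf torus whose profile curve is the closed, arclength parametrized curve $\gamma=\gamma_E$ in the space form of curvature $G$ given by the formulas in the context, for fixed parameters $g_2,g_3,E\in\mathbb{R}$; suppose $\gamma$ closes after $n$ periods $2\omega_1$ of $\wp$. Let $L=2n\omega_1$, which is the length of $\gamma$ in the respective space form. (1) If $f$ is a constrained Willmore torus of revolution (so $G<0$), then its conformal class is given by the lattice generated by $z_1=2\pi$ and $z_2=i\sqrt{-G}\,L$, and its Willmore energy is $$\mathcal{W}(f)=8n\eta_1\pi-4n\omega_1\wp(\omega_3)\pi.$$ (2) If $f$ is a constrained Willmore Hopf torus (so $G>0$), then its conformal class is given by the lattice generated by $z_1=2\pi$ and $z_2=\frac12GA+\frac12i\sqrt{G}\,L$, and its Willmore energy is $$\mathcal{W}(f)=\frac{1}{\sqrt G}\bigl(16n\eta_1\pi-8n\omega_1E\pi\bigr).$$ Here $A$ is the oriented enclosed area of $\gamma$, given by $$\tfrac12GA\equiv m\pi-4in\eta_1x_0-2n\omega_1\bigl(\tfrac12\kappa(0)-2i\zeta(x_0)\bigr)\pmod{2\pi},$$ where $m$ is the winding number of $\gamma$.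
   Context: Willmore energy: $\mathcal{W}(f)=\int(H^2+1)\,dA$ for an immersion $f$ into the round $S^3$, $H$ the mean curvature. Constrained Willmore: critical for $\mathcal W$ under conformal variations. A torus of revolution is obtained by rotating a closed curve in the upper half plane, viewed as the hyperbolic plane (curvature $G<0$), about the $x$-axis. A Hopf torus is the preimage under the Hopf fibration of a closed curve in the round 2-sphere (curvature $G>0$). Such a torus is constrained Willmore when the geodesic curvature $\kappa$ of its arclength parametrized profile curve satisfies, with real constants $\mu,\lambda,\nu$, $$\kappa''+\tfrac12\kappa^3+(\mu+G)\kappa+\lambda=0,\qquad(\kappa')^2=-\tfrac14\kappa^4-(\mu+G)\kappa^2-2\lambda\kappa-\nu,$$ where $\lambda=0$ for tori of revolution. Put $g_2=\frac{(\mu+G)^2}{12}+\frac\nu4$, $g_3=\frac{(\mu+G)^3}{216}+\frac{\lambda^2}{16}-\frac{\nu(\mu+G)}{24}$, $E=\frac16(\mu-\frac G2)$, assume $g_2^3-27g_3^2\ne0$, and let $\wp,\zeta,\sigma$ be the Weierstrass functions with invariants $g_2,g_3$ and period lattice $\Gamma$; $\omega_1$ is the half period on the real axis, $\omega_3$ the half period on the imaginary axis, and $\eta_1=\zeta(\omega_1)$. For tori of revolution $\frac16(\mu+G)=\wp(\omega_3)$. The profile curve is $\gamma_E=[\hat\gamma^1_E,\hat\gamma^2_E]$ in $\mathbb{CP}^1$ (which contains the space form), where, with $\wp(\rho)=E$ and $E$ not a branch value of $\wp$, $$\hat\gamma^1_E=\frac{\sigma(x+x_0-\rho)}{\sigma(x+x_0)}e^{\zeta(\rho)(x+x_0)},\qquad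 \hat\gamma^2_E=\frac{\sigma(x+x_0+\rho)}{\sigma(x+x_0)}e^{-\zeta(\rho)(x+x_0)}.$$ The parameter $x_0\in i\mathbb{R}$ is such that, with the orientation convention used here for the sign of $\kappa$, $$\wp(x+x_0)=\tfrac14i\kappa'(x)-\tfrac18\kappa(x)^2-\tfrac1{12}(\mu+G).$$ The oriented enclosed area $A$ is well defined only modulo $4\pi/G$, and by Gauss–Bonnet $GA\equiv2\pi m-\int_\gamma\kappa\,ds\pmod{4\pi}$. The conformal class given by a lattice means that of $\mathbb{C}/(\mathbb{Z}z_1+\mathbb{Z}z_2)$.
   Formalization: In (1) the Willmore energy is proved as (8nη₁π − 4nω₁℘(ω₃)π)/√(−G); the printed formula lacks the factor 1/√(−G), is not invariant under rescaling the hyperbolic metric, and holds only for G = −1. *)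

(* Defs.v *)
From Stdlib Require Export Reals ZArith List.
From Coquelicot Require Export Coquelicot.
Export ListNotations.
Open Scope R_scope.

Definition Cexp (z : C) : C :=
  (exp (Re z) * cos (Im z), exp (Re z) * sin (Im z)).

Definition Clim_seq (u : nat -> C) : C :=
  (real (Lim_seq (fun N => Re (u N))), real (Lim_seq (fun N => Im (u N)))).

Definition Csum (l : list C) : C := fold_right Cplus (RtoC 0) l.
Definition Cprod (l : list C) : C := fold_right Cmult (RtoC 1) l.

Definition latpt (a b : C) (k : Z * Z) : C :=
  (RtoC (IZR (fst k)) * a + RtoC (IZR (snd k)) * b)%C.

Definition in_lattice (a b z : C) : Prop := exists k : Z * Z, z = latpt a b k.

(* The nonzero lattice points ka + lb with |k|, |l| <= N.  All sums and
   products below converge absolutely, so the exhaustion by squares is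
   immaterial. *)
Definition latbox (a b : C) (N : nat) : list C :=
  let r := map (fun i => (Z.of_nat i - Z.of_nat N)%Z) (seq 0 (2 * N + 1)) in
  map (latpt a b)
    (filter (fun k => negb (Z.eqb (fst k) 0 && Z.eqb (snd k) 0))
            (list_prod r r)).

Definition lattice_sum (a b : C) (h : C -> C) : C :=
  Clim_seq (fun N => Csum (map h (latbox a b N))).

Definition inv_g2 (a b : C) : C :=
  (RtoC 60 * lattice_sum a b (fun w => / w ^ 4))%C.
Definition inv_g3 (a b : C) : C :=
  (RtoC 140 * lattice_sum a b (fun w => / w ^ 6))%C.

(* The values of wp and wzeta at points of the lattice are junk. *)
Definition wp (a b z : C) : C :=
  (/ z ^ 2 + lattice_sum a b (fun w => / (z - w) ^ 2 - / w ^ 2))%C.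
Definition wzeta (a b z : C) : C :=
  (/ z + lattice_sum a b (fun w => / (z - w) + / w + z / w ^ 2))%C.
Definition wsigma (a b z : C) : C :=
  (z * Clim_seq (fun N => Cprod (map (fun w =>
     (RtoC 1 - z / w) * Cexp (z / w + z ^ 2 / (RtoC 2 * w ^ 2))) (latbox a b N))))%C.

Definition branch_value (a b e : C) : Prop :=
  exists z, ~ in_lattice a b z /\ wp a b z = e /\
    is_derive (K := C_AbsRing) (V := C_NormedModule) (wp a b) z (RtoC 0).

(* 2 t u is the first period of the lattice on the half line R_{>0} u. *)
Definition half_period_along (a b u : C) (t : R) : Prop :=
  0 < t /\ in_lattice a b (RtoC (2 * t) * u)%C /\
  forall r, 0 < r < 2 * t -> ~ in_lattice a b (RtoC r * u)%C.

Definition R2 : NormedModule R_AbsRing :=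
  prod_NormedModule R_AbsRing R_NormedModule R_NormedModule.
Definition R3 : Type := (R * R * R)%type.
(* S^3 is the unit sphere of R^4 = C^2. *)
Definition R4 : Type := (C * C)%type.

Definition dirD {V : NormedModule R_AbsRing} (v : V) (f : V -> R) (p : V) : R :=
  Derive (fun h : R => f (plus p (scal h v))) 0.

Definition smooth {V : NormedModule R_AbsRing} (f : V -> R) : Prop :=
  forall vs : list V, let g := fold_right dirD f vs in
  forall p : V, continuous g p /\
    forall v : V, ex_derive (fun h : R => g (plus p (scal h v))) 0.

Definition smooth_curve (f : R -> R) : Prop := smooth (V := R_NormedModule) f.

Definition smoothR2 (f : R2 -> R2) : Prop :=
  smooth (fun p => fst (f p)) /\ smooth (fun p => snd (f p)).

Definition smoothR3 {V : NormedModule R_AbsRing} (f : V -> R3) : Prop :=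
  smooth (fun p => fst (fst (f p))) /\ smooth (fun p => snd (fst (f p))) /\
  smooth (fun p => snd (f p)).

Definition smoothR4 {V : NormedModule R_AbsRing} (f : V -> R4) : Prop :=
  smooth (fun p => Re (fst (f p))) /\ smooth (fun p => Im (fst (f p))) /\
  smooth (fun p => Re (snd (f p))) /\ smooth (fun p => Im (snd (f p))).

Definition D3 {V : NormedModule R_AbsRing} (v : V) (f : V -> R3) (p : V) : R3 :=
  (dirD v (fun q => fst (fst (f q))) p, dirD v (fun q => snd (fst (f q))) p,
   dirD v (fun q => snd (f q)) p).

Definition D4 {V : NormedModule R_AbsRing} (v : V) (f : V -> R4) (p : V) : R4 :=
  ((dirD v (fun q => Re (fst (f q))) p, dirD v (fun q => Im (fst (f q))) p),
   (dirD v (fun q => Re (snd (f q))) p, dirD v (fun q => Im (snd (f q))) p)).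

Definition velocity (c : R -> R3) : R -> R3 := D3 (V := R_NormedModule) 1 c.

Definition dot3 (a b : R3) : R :=
  let '(a1, a2, a3) := a in let '(b1, b2, b3) := b in
  a1 * b1 + a2 * b2 + a3 * b3.

Definition cross3 (a b : R3) : R3 :=
  let '(a1, a2, a3) := a in let '(b1, b2, b3) := b in
  (a2 * b3 - a3 * b2, a3 * b1 - a1 * b3, a1 * b2 - a2 * b1).

Definition det3 (a b c : R3) : R := dot3 a (cross3 b c).

Definition scal3 (k : R) (a : R3) : R3 :=
  let '(a1, a2, a3) := a in (k * a1, k * a2, k * a3).

Definition dot4 (a b : R4) : R :=
  Re (fst a) * Re (fst b) + Im (fst a) * Im (fst b) +
  Re (snd a) * Re (snd b) + Im (snd a) * Im (snd b).

(* Laplace expansion along the first two rows. *)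
Definition det4 (a b c d : R4) : R :=
  let '((a0, a1), (a2, a3)) := a in let '((b0, b1), (b2, b3)) := b in
  let '((c0, c1), (c2, c3)) := c in let '((d0, d1), (d2, d3)) := d in
  (a0 * b1 - a1 * b0) * (c2 * d3 - c3 * d2)
  - (a0 * b2 - a2 * b0) * (c1 * d3 - c3 * d1)
  + (a0 * b3 - a3 * b0) * (c1 * d2 - c2 * d1)
  + (a1 * b2 - a2 * b1) * (c0 * d3 - c3 * d0)
  - (a1 * b3 - a3 * b1) * (c0 * d2 - c2 * d0)
  + (a2 * b3 - a3 * b2) * (c0 * d1 - c1 * d0).

(* A torus is given by a map f : R^2 -> R^4 which is doubly periodic, so that
   its domain is T^2 = R^2 / (P1 Z x P2 Z). *)

Definition e1 : R2 := (1, 0).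
Definition e2 : R2 := (0, 1).

Definition fund1 (f : R2 -> R4) (v w p : R2) : R := dot4 (D4 v f p) (D4 w f p).

Definition area_density (f : R2 -> R4) (p : R2) : R :=
  sqrt (fund1 f e1 e1 p * fund1 f e2 e2 p - fund1 f e1 e2 p ^ 2).

(* The unit normal N of f in S^3 is given by
   <N, v> = det (f, f_1, f_2, v) / area_density f. *)
Definition fund2 (f : R2 -> R4) (v w p : R2) : R :=
  det4 (f p) (D4 e1 f p) (D4 e2 f p) (D4 v (D4 w f) p) / area_density f p.

Definition mean_curvature (f : R2 -> R4) (p : R2) : R :=
  (fund1 f e2 e2 p * fund2 f e1 e1 p - 2 * fund1 f e1 e2 p * fund2 f e1 e2 p
   + fund1 f e1 e1 p * fund2 f e2 e2 p) / (2 * area_density f p ^ 2).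

Definition willmore (P1 P2 : R) (f : R2 -> R4) : R :=
  RInt (fun s => RInt (fun t =>
    (mean_curvature f (s, t) ^ 2 + 1) * area_density f (s, t)) 0 P2) 0 P1.

Definition immersed_torus (P1 P2 : R) (f : R2 -> R4) : Prop :=
  smoothR4 f /\
  (forall p, dot4 (f p) (f p) = 1) /\
  (forall s t, f (s + P1, t) = f (s, t) /\ f (s, t + P2) = f (s, t)) /\
  (forall p, 0 < area_density f p).

Definition same_conformal_structure (f g : R2 -> R4) : Prop :=
  forall p, exists r, 0 < r /\ forall v w, fund1 g v w p = r * fund1 f v w p.

(* Every variation of f through tori of the same conformal class is, up to
   reparametrization of its members, of the kind considered here. *)
Definition constrained_willmore (P1 P2 : R) (f : R2 -> R4) : Prop :=
  immersed_torus P1 P2 f /\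
  forall F : R -> R2 -> R4,
    smoothR4 (V := prod_NormedModule R_AbsRing R_NormedModule R2)
      (fun q => F (fst q) (snd q)) ->
    (forall p, F 0 p = f p) ->
    (forall tau, immersed_torus P1 P2 (F tau)) ->
    (forall tau, same_conformal_structure f (F tau)) ->
    is_derive (fun tau => willmore P1 P2 (F tau)) 0 0.

(* The torus f is conformally equivalent to C / (Z z1 + Z z2): phi is the lift
   to universal covers of a diffeomorphism C / (Z z1 + Z z2) -> T^2 such that
   f o phi is a conformal map. *)
Definition conformal_class (P1 P2 : R) (f : R2 -> R4) (z1 z2 : C) : Prop :=
  Im (Cconj z1 * z2)%C <> 0 /\
  exists phi psi : R2 -> R2,
    smoothR2 phi /\ smoothR2 psi /\
    (forall p, psi (phi p) = p) /\ (forall p, phi (psi p) = p) /\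
    (forall p q, in_lattice z1 z2 (minus p q) <->
       in_lattice (P1, 0) (0, P2) (minus (phi p) (phi q))) /\
    forall p, exists r, 0 < r /\ forall v w : R2,
      fund1 (fun q => f (phi q)) v w p = r * (fst v * fst w + snd v * snd w).

(* The hyperbolic plane of curvature G < 0 is the upper half plane y > 0 with
   the metric (dx^2 + dy^2) / (- G y^2). *)

Definition hyp_speed (G : R) (x y : R -> R) (s : R) : R :=
  sqrt ((Derive x s ^ 2 + Derive y s ^ 2) / (- G * y s ^ 2)).

Definition hyp_arclength (G : R) (x y : R -> R) : Prop :=
  smooth_curve x /\ smooth_curve y /\
  forall s, 0 < y s /\ hyp_speed G x y s = 1.

(* The product of the covariant acceleration with the unit normal (y', -x'),
   i.e. the geodesic curvature for the orientation opposite to the complex one.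
   This is the sign for which wp (s + x0) = i k' / 4 - k^2 / 8 - (mu + G) / 12
   along gammaE: by Lame's equation the Schwarzian derivative of the affine
   coordinate of gammaE is - 4 wp (s + x0) - 2 E, and for an arclength
   parametrized curve it equals k^2 / 2 + G / 2 - i k' with this sign of k. *)
Definition hyp_curvature (G : R) (x y : R -> R) (s : R) : R :=
  let x1 := Derive x s in let y1 := Derive y s in
  let ax := Derive_n x 2 s - 2 * x1 * y1 / y s in
  let ay := Derive_n y 2 s + (x1 ^ 2 - y1 ^ 2) / y s in
  (y1 * ax - x1 * ay) / (- G * y s ^ 2).

Definition inv_stereo (X Y Z : R) : R4 :=
  let q := X ^ 2 + Y ^ 2 + Z ^ 2 in
  ((2 * X / (q + 1), (q - 1) / (q + 1)), (2 * Y / (q + 1), 2 * Z / (q + 1))).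

Definition revolution_torus (x y : R -> R) (p : R2) : R4 :=
  inv_stereo (x (fst p)) (y (fst p) * cos (snd p)) (y (fst p) * sin (snd p)).

(* The sphere of curvature G > 0 is the sphere of radius 1 / sqrt G in R^3,
   oriented by its outer normal. *)

Definition sph_speed (c : R -> R3) (s : R) : R :=
  sqrt (dot3 (velocity c s) (velocity c s)).

Definition sph_arclength (G : R) (c : R -> R3) : Prop :=
  smoothR3 (V := R_NormedModule) c /\
  forall s, dot3 (c s) (c s) = / G /\ sph_speed c s = 1.

(* hopf identifies CP^1 with the unit sphere (in the affine coordinate v1 / v2
   it is the inverse of the stereographic projection from the north pole) and
   reverses orientation, so that the sign of the geodesic curvature below agrees
   with that of hyp_curvature. *)
Definition hopf (v : C * C) : R3 :=
  let q := Cmod (fst v) ^ 2 + Cmod (snd v) ^ 2 in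
  let z := (fst v * Cconj (snd v))%C in
  (2 * Re z / q, 2 * Im z / q, (Cmod (fst v) ^ 2 - Cmod (snd v) ^ 2) / q).

Definition sph_curvature (G : R) (c : R -> R3) (s : R) : R :=
  det3 (scal3 (sqrt G) (c s)) (velocity c s) (velocity (velocity c) s).

Definition hopf_lift (G : R) (c : R -> R3) (l : R -> R4) : Prop :=
  smoothR4 (V := R_NormedModule) l /\
  forall s, dot4 (l s) (l s) = 1 /\ hopf (l s) = scal3 (sqrt G) (c s).

(* The preimage of the curve under the Hopf fibration, as the map from the
   pull-back circle bundle to S^3, trivialized by a closed lift l. *)
Definition hopf_torus (l : R -> R4) (p : R2) : R4 :=
  let u : C := (cos (snd p), sin (snd p)) in
  ((u * fst (l (fst p)))%C, (u * snd (l (fst p)))%C).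

(* The total rotation of the tangent, over one period, in the plane obtained by
   stereographic projection from a point p off the curve.  Since
   det (u1, u2, p) = -1 the projection is orientation preserving.  Another
   choice of p changes m by an even number. *)
Definition winding_number (G L : R) (c : R -> R3) (m : Z) : Prop :=
  exists (u1 u2 : R3) (theta : R -> R),
    let p := cross3 u2 u1 in
    let h u s := dot3 (scal3 (sqrt G) (c s)) u
                 / (1 - dot3 (scal3 (sqrt G) (c s)) p) in
    dot3 u1 u1 = 1 /\ dot3 u2 u2 = 1 /\ dot3 u1 u2 = 0 /\
    (forall s, scal3 (sqrt G) (c s) <> p) /\
    (forall s, continuous theta s) /\
    (forall s, exists r, 0 < r /\
       Derive (h u1) s = r * cos (theta s) /\
       Derive (h u2) s = r * sin (theta s)) /\
    theta L - theta 0 = 2 * PI * IZR m.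

(* A is the signed area of a disc bounded by the curve: F (t, s), 0 <= t <= 1,
   contracts the curve F (1, .) = c to a point in the complement of a point p
   of the sphere.  Another choice of F and p changes A by a multiple of
   4 PI / G. *)
Definition enclosed_area (G L : R) (c : R -> R3) (A : R) : Prop :=
  exists (p : R3) (F : R2 -> R3),
    smoothR3 F /\ dot3 p p = / G /\
    (forall t s, 0 <= t <= 1 ->
       dot3 (F (t, s)) (F (t, s)) = / G /\ F (t, s) <> p /\
       F (t, s + L) = F (t, s) /\
       F (0, s) = F (0, 0) /\ F (1, s) = c s) /\
    A = RInt (fun t => RInt (fun s =>
          det3 (scal3 (sqrt G) (F (t, s))) (D3 e1 F (t, s)) (D3 e2 F (t, s)))
          0 L) 0 1.

Definition parE (G mu : R) : R := (mu - G / 2) / 6.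
Definition par_g2 (G mu nu : R) : R := (mu + G) ^ 2 / 12 + nu / 4.
Definition par_g3 (G mu lam nu : R) : R :=
  (mu + G) ^ 3 / 216 + lam ^ 2 / 16 - nu * (mu + G) / 24.

Record elastic_data (G mu lam nu : R) (a b : C) (w1 w3 : R) (rho x0 : C)
    (kappa : R -> R) : Prop := {
  ed_curvature2 : forall s,
    Derive_n kappa 2 s + kappa s ^ 3 / 2 + (mu + G) * kappa s + lam = 0;
  ed_curvature1 : forall s,
    Derive kappa s ^ 2 =
      - (kappa s ^ 4 / 4) - (mu + G) * kappa s ^ 2 - 2 * lam * kappa s - nu;
  ed_discriminant : par_g2 G mu nu ^ 3 - 27 * par_g3 G mu lam nu ^ 2 <> 0;
  ed_lattice : Im (Cconj a * b)%C <> 0;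
  ed_g2 : inv_g2 a b = RtoC (par_g2 G mu nu);
  ed_g3 : inv_g3 a b = RtoC (par_g3 G mu lam nu);
  (* The symmetry of a lattice with real invariants. *)
  ed_real : forall z, in_lattice a b z -> in_lattice a b (Cconj z);
  ed_omega1 : half_period_along a b (RtoC 1) w1;
  ed_omega3 : half_period_along a b Ci w3;
  ed_rho : ~ in_lattice a b rho /\ wp a b rho = RtoC (parE G mu);
  ed_no_branch : ~ branch_value a b (RtoC (parE G mu));
  ed_x0_imaginary : Re x0 = 0;
  ed_x0_regular : forall s, ~ in_lattice a b (RtoC s + x0)%C;
  ed_x0 : forall s,
    wp a b (RtoC s + x0)%C =
      (Ci * RtoC (Derive kappa s / 4) - RtoC (kappa s ^ 2 / 8 + (mu + G) / 12))%C
}.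

Definition gammaE (a b rho x0 : C) (s : R) : C * C :=
  let u := (RtoC s + x0)%C in
  ((wsigma a b (u - rho) / wsigma a b u * Cexp (wzeta a b rho * u))%C,
   (wsigma a b (u + rho) / wsigma a b u * Cexp (- (wzeta a b rho * u)))%C).

Definition moebius (m11 m12 m21 m22 : C) (v : C * C) : C * C :=
  ((m11 * fst v + m12 * snd v)%C, (m21 * fst v + m22 * snd v)%C).

(* The formula for gammaE fixes the curve in CP^1 only up to the choice of the
   space form inside CP^1, i.e. up to a projective transformation. *)
Definition hyp_profile (x y : R -> R) (g : R -> C * C) : Prop :=
  exists m11 m12 m21 m22 : C, (m11 * m22 - m12 * m21)%C <> RtoC 0 /\
  forall s, let v := moebius m11 m12 m21 m22 (g s) in
    snd v <> RtoC 0 /\ (x s, y s) = (fst v / snd v)%C.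

Definition sph_profile (G : R) (c : R -> R3) (g : R -> C * C) : Prop :=
  exists m11 m12 m21 m22 : C, (m11 * m22 - m12 * m21)%C <> RtoC 0 /\
  forall s, scal3 (sqrt G) (c s) = hopf (moebius m11 m12 m21 m22 (g s)).

(* Main.v *)
(* Since wp = - zeta', the equation wp (s + x0) = i k' / 4 - k^2 / 8 - (mu + G) / 12
   turns integrals of k^2 and k along the curve into values of zeta and of the
   logarithm of sigma, and only the quasi-periodicity of zeta and sigma is needed.
   The energy of a torus of revolution is pi / 2 times the total squared hyperbolic
   curvature, since the remaining part of the integrand is a derivative; for a Hopf
   torus the mean curvature is k / sqrt G.  The conformal class of a Hopf torus is
   given by the holonomy of its closed lift.  The holonomy, the enclosed area and
   the winding number are all compared with the integral of a primitive of the area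
   form on the sphere punctured at a point p: Stokes' theorem gives the area, and
   the change of the geodesic curvature under stereographic projection from p gives
   the total curvature.  Two such integrals for different p differ by a multiple of
   4 pi, because a closed curve in C minus 0 has an integral winding number. *)
From Stdlib Require Import Psatz Permutation FunctionalExtensionality.
Require Import Defs.

(** * Sums over boxes of lattice points *)

(** No theory of holomorphic functions is used, neither Liouville's theorem nor complex logarithms.
    Quasi-periodicity is read off finite sums instead: shifting a square box of lattice points by a
    generator telescopes and leaves two boundary columns of 2N+1 terms of size 1/N each. Comparing
    two arguments gains one power of N, so that the boundary disappears in the limit. The same
    telescoping of products, where Weierstrass factors supply the gain, gives the law for quotients
    of sigma. The logarithm of sigma is replaced by an antiderivative of zeta(s + x0) - zeta(s - x0)
    on the real line. The finite products determine only its exponential, hence its increment modulo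
    2 pi i, and this is the ambiguity of the total curvature. The difference is purely imaginary
    because x0 is imaginary and the lattice is real, and it equals kappa up to a factor and an
    additive constant. Angles are treated in the same way: a closed curve in C minus 0 is the
    exponential of an antiderivative of its logarithmic derivative. *)

Ltac components :=
  unfold Cdiv, Cminus, Cplus, Cmult, Copp, RtoC, Ci, Cconj, Re, Im; cbn [fst snd].

Definition zrange (N : nat) : list Z :=
  map (fun i => (Z.of_nat i - Z.of_nat N)%Z) (seq 0 (2 * N + 1)).

Definition box (N : nat) : list (Z * Z) := list_prod (zrange N) (zrange N).

Definition supn (k : Z * Z) : nat := Nat.max (Z.abs_nat (fst k)) (Z.abs_nat (snd k)).

Definition rsum {T} (f : T -> R) (l : list T) : R := fold_right Rplus 0 (map f l).

Lemma in_zrange N i : In i (zrange N) <-> (Z.abs_nat i <= N)%nat.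
Proof.
unfold zrange; rewrite in_map_iff; split.
- intros [j [E Hj]]; apply in_seq in Hj; lia.
- intros Hi; exists (Z.to_nat (i + Z.of_nat N)); rewrite in_seq; lia.
Qed.

Lemma NoDup_zrange N : NoDup (zrange N).
Proof. apply FinFun.Injective_map_NoDup; [intros i j E; lia | apply seq_NoDup]. Qed.

Lemma in_box N k : In k (box N) <-> (supn k <= N)%nat.
Proof.
destruct k as [i j]; unfold box, supn; rewrite in_prod_iff, !in_zrange; simpl; lia.
Qed.

Lemma NoDup_list_prod {S T} (l : list S) (l' : list T) :
  NoDup l -> NoDup l' -> NoDup (list_prod l l').
Proof.
intros H H'; induction H as [|x l Hx Hl IH]; simpl; [constructor|].
apply NoDup_app; trivial.
- apply FinFun.Injective_map_NoDup; trivial; intros u v E; congruence.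
- intros [u v] Hu Hv; apply in_map_iff in Hu; destruct Hu as [w [E _]].
  apply in_prod_iff in Hv; inversion E; subst; tauto.
Qed.

Lemma NoDup_box N : NoDup (box N).
Proof. apply NoDup_list_prod; apply NoDup_zrange. Qed.

Lemma length_box N : length (box N) = ((2 * N + 1) * (2 * N + 1))%nat.
Proof. unfold box, zrange; now rewrite length_prod, length_map, length_seq. Qed.

Lemma rsum_perm {T} (f : T -> R) l l' : Permutation l l' -> rsum f l = rsum f l'.
Proof. unfold rsum; induction 1; simpl; try lra; congruence. Qed.

Lemma rsum_app {T} (f : T -> R) l l' : rsum f (l ++ l') = rsum f l + rsum f l'.
Proof. unfold rsum; induction l; simpl; lra. Qed.

Lemma rsum_le {T} (f g : T -> R) l :
  (forall k, In k l -> f k <= g k) -> rsum f l <= rsum g l.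
Proof.
unfold rsum; induction l as [|x l IH]; simpl; intros H; [lra|].
pose proof (H x (or_introl eq_refl)); pose proof (IH (fun k h => H k (or_intror h))); lra.
Qed.

Lemma rsum_const {T} (c : R) (l : list T) : rsum (fun _ => c) l = INR (length l) * c.
Proof.
unfold rsum; induction l as [|x l IH]; [simpl; ring|].
cbn [map fold_right length]; rewrite IH, S_INR; ring.
Qed.

Lemma rsum_scal {T} (c : R) f (l : list T) : rsum (fun k => c * f k) l = c * rsum f l.
Proof. unfold rsum; induction l as [|x l IH]; simpl; [|rewrite IH]; ring. Qed.

Lemma rsum_incl {T} (f : T -> R) l l' :
  (forall k, 0 <= f k) -> NoDup l -> incl l l' -> rsum f l <= rsum f l'.
Proof.
intros Hf H; revert l'; induction H as [|x l Hx Hl IH]; intros l' Hi.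
- unfold rsum at 1; simpl; induction l' as [|y l' IH']; unfold rsum in *; simpl; [lra|].
  assert (incl [] l') by (intros ? []); specialize (IH' H); pose proof (Hf y); lra.
- destruct (in_split x l' (Hi x (or_introl eq_refl))) as [l1 [l2 ->]].
  rewrite (rsum_perm f (l1 ++ x :: l2) (x :: l1 ++ l2))
    by (symmetry; apply Permutation_middle).
  assert (Hl2 : incl l (l1 ++ l2)).
  { intros y Hy; pose proof (Hi y (or_intror Hy)) as Hy2.
    apply in_app_iff in Hy2; apply in_app_iff.
    destruct Hy2 as [|[->|]]; tauto. }
  pose proof (IH _ Hl2); unfold rsum in *; simpl; lra.
Qed.

Lemma filter_split_perm {T} (p : T -> bool) l :
  Permutation l (filter p l ++ filter (fun x => negb (p x)) l).
Proof.
induction l as [|x l IH]; simpl; [constructor|].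
destruct (p x); simpl; [now constructor|].
now apply Permutation_cons_app.
Qed.

Lemma filter_box l M :
  NoDup l -> incl (box M) l ->
  Permutation (filter (fun k => Nat.leb (supn k) M) l) (box M).
Proof.
intros Hl Hi; apply NoDup_Permutation; [now apply NoDup_filter | apply NoDup_box |].
intros k; rewrite filter_In, in_box, Nat.leb_le; split; [tauto|].
intros Hk; split; trivial; apply Hi; now apply in_box.
Qed.

(** The common majorant of all lattice series below. The exponent is three because the Weierstrass
    corrections make the terms of zeta and wp of order |w|^-3, which is summable over a planar
    lattice. *)
Definition decay (k : Z * Z) : R := / (1 + INR (supn k)) ^ 3.

Lemma decay_pos k : 0 < decay k.
Proof. apply Rinv_0_lt_compat, pow_lt; pose proof (pos_INR (supn k)); lra. Qed.

Lemma incl_box M N : (M <= N)%nat -> incl (box M) (box N).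
Proof. intros H k; rewrite !in_box; lia. Qed.

(** The shell of sup norm N + 1 has 8 (N + 1) points, each of weight 1 / (N + 2)^3. The right-hand
    side is a telescoping majorant: 8 / (N + 1) - 8 / (N + 2) = 8 / ((N + 1) (N + 2)). *)
Lemma decay_box_step N :
  rsum decay (box (S N)) <=
  rsum decay (box N) + 8 / (INR N + 1) - 8 / (INR (S N) + 1).
Proof.
set (p := fun k => Nat.leb (supn k) N).
assert (Hp : Permutation (filter p (box (S N))) (box N))
  by (apply filter_box; [apply NoDup_box | apply incl_box; lia]).
pose proof (filter_split_perm p (box (S N))) as Hs.
rewrite (rsum_perm _ _ _ Hs), rsum_app, (rsum_perm _ _ _ Hp).
assert (Hlen : length (filter (fun x => negb (p x)) (box (S N))) = (8 * N + 8)%nat).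
{ apply Permutation_length in Hs; rewrite length_app, (Permutation_length Hp), !length_box in Hs; lia. }
assert (Hb : rsum decay (filter (fun x => negb (p x)) (box (S N)))
  <= INR (8 * N + 8) * / (2 + INR N) ^ 3).
{ rewrite <- Hlen, <- rsum_const; apply rsum_le; intros k Hk.
  apply filter_In in Hk; destruct Hk as [Hk Hk'].
  apply in_box in Hk; unfold p in Hk'; destruct (Nat.leb_spec (supn k) N); [easy|].
  unfold decay; replace (supn k) with (S N) by lia; rewrite S_INR.
  replace (1 + (INR N + 1)) with (2 + INR N) by ring; lra. }
enough (INR (8 * N + 8) * / (2 + INR N) ^ 3 <= 8 / (INR N + 1) - 8 / (INR (S N) + 1)) by lra.
rewrite S_INR, plus_INR, mult_INR; pose proof (pos_INR N) as HN.
replace (INR 8) with 8 by (simpl; ring).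
replace (8 / (INR N + 1) - 8 / (INR N + 1 + 1)) with (8 / ((INR N + 1) * (INR N + 2)))
  by (field; lra).
replace ((8 * INR N + 8) * / (2 + INR N) ^ 3)
  with (8 * (INR N + 1) ^ 2 * / ((INR N + 1) * (INR N + 2) ^ 3)) by (field; lra).
replace (8 / ((INR N + 1) * (INR N + 2)))
  with (8 * (INR N + 2) ^ 2 * / ((INR N + 1) * (INR N + 2) ^ 3)) by (field; lra).
apply Rmult_le_compat_r; [|nra].
left; apply Rinv_0_lt_compat, Rmult_lt_0_compat; [lra|apply pow_lt; lra].
Qed.

Lemma decay_tail M K : (M <= K)%nat ->
  rsum decay (box K) - rsum decay (box M) <= 8 / (INR M + 1).
Proof.
intros H.
enough (rsum decay (box K) - rsum decay (box M) <= 8 / (INR M + 1) - 8 / (INR K + 1)).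
{ enough (0 < 8 / (INR K + 1)) by lra.
  apply Rdiv_lt_0_compat; pose proof (pos_INR K); lra. }
induction H as [|K H IH]; [lra|]; pose proof (decay_box_step K); lra.
Qed.

Lemma Csum_perm {T} (f : T -> C) l l' :
  Permutation l l' -> Csum (map f l) = Csum (map f l').
Proof.
unfold Csum; induction 1; simpl; [easy|congruence| |congruence].
now rewrite !Cplus_assoc, (Cplus_comm (f y)).
Qed.

Lemma Csum_app {T} (f : T -> C) l l' :
  Csum (map f (l ++ l')) = (Csum (map f l) + Csum (map f l'))%C.
Proof. unfold Csum; induction l as [|x l IH]; simpl; [|rewrite IH]; ring. Qed.

Lemma Csum_plus {T} (f g : T -> C) l :
  Csum (map (fun k => f k + g k)%C l) = (Csum (map f l) + Csum (map g l))%C.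
Proof. unfold Csum; induction l as [|x l IH]; simpl; [|rewrite IH]; ring. Qed.

Lemma Csum_scal {T} (c : C) (f : T -> C) l :
  Csum (map (fun k => c * f k)%C l) = (c * Csum (map f l))%C.
Proof. unfold Csum; induction l as [|x l IH]; simpl; [|rewrite IH]; ring. Qed.

Lemma Csum_ext {T} (f g : T -> C) l :
  (forall k, In k l -> f k = g k) -> Csum (map f l) = Csum (map g l).
Proof. intros H; f_equal; now apply map_ext_in. Qed.

Lemma Cmod_Csum {T} (f : T -> C) l :
  Cmod (Csum (map f l)) <= rsum (fun k => Cmod (f k)) l.
Proof.
unfold Csum, rsum; induction l as [|x l IH]; simpl; [rewrite Cmod_0; lra|].
eapply Rle_trans; [apply Cmod_triangle|lra].
Qed.

Lemma incl_some_box (l : list (Z * Z)) : exists K, incl l (box K).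
Proof.
induction l as [|x l [K IH]]; [exists 0%nat; intros ? []|].
exists (Nat.max K (supn x)); intros k [->|Hk].
- apply in_box; lia.
- apply IH, in_box in Hk; apply in_box; lia.
Qed.

(** Formulated for every finite set [l] that contains a box, not only for larger boxes: complex
    conjugation of the lattice maps boxes to sets of another shape. *)
Lemma box_tail (f : Z * Z -> C) (A : R) M l :
  NoDup l -> incl (box M) l ->
  (forall k, (M < supn k)%nat -> Cmod (f k) <= A * decay k) ->
  Cmod (Csum (map f l) - Csum (map f (box M)))%C <= 8 * A / (INR M + 1).
Proof.
intros Hl Hi Hf.
(* The bound at the single index (M + 1, 0) already forces [A] to be nonnegative. *)
assert (HA : 0 <= A).
{ pose proof (Hf (Z.of_nat (S M), 0%Z)) as H; unfold supn at 1 in H; simpl fst in H; simpl snd in H.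
  assert (Hm : (M < Nat.max (Z.abs_nat (Z.of_nat (S M))) (Z.abs_nat 0))%nat) by lia.
  specialize (H Hm); pose proof (Cmod_ge_0 (f (Z.of_nat (S M), 0%Z))).
  pose proof (decay_pos (Z.of_nat (S M), 0%Z)); nra. }
set (p := fun k => Nat.leb (supn k) M).
pose proof (filter_split_perm p l) as Hs.
pose proof (filter_box l M Hl Hi) as Hp; fold p in Hp.
rewrite (Csum_perm f _ _ Hs), Csum_app, (Csum_perm f _ _ Hp).
match goal with |- Cmod (?x + ?y - ?x)%C <= _ => replace (x + y - x)%C with y by ring end.
destruct (incl_some_box l) as [K HK].
set (q := fun k => negb (p k)) in *.
assert (HMK : (M <= K)%nat).
{ assert (H : In (Z.of_nat M, 0%Z) (box K)) by (apply HK, Hi, in_box; unfold supn; simpl; lia).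
  apply in_box in H; unfold supn in H; simpl in H; lia. }
eapply Rle_trans; [apply Cmod_Csum|].
apply Rle_trans with (rsum (fun k => A * decay k) (filter q l)).
{ apply rsum_le; intros k Hk; apply Hf.
  apply filter_In in Hk; destruct Hk as [_ Hk]; unfold q, p in Hk.
  destruct (Nat.leb_spec (supn k) M); [easy|trivial]. }
rewrite rsum_scal.
apply Rle_trans with (A * rsum decay (filter q (box K))).
{ apply Rmult_le_compat_l; trivial; apply rsum_incl.
  - intros k; left; apply decay_pos.
  - now apply NoDup_filter.
  - intros k; rewrite !filter_In; intros [? ?]; split; auto. }
pose proof (filter_split_perm p (box K)) as Hs2.
pose proof (rsum_perm decay _ _ Hs2) as E.
pose proof (filter_box (box K) M (NoDup_box K) (incl_box _ _ HMK)) as HpK; fold p in HpK.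
rewrite rsum_app, (rsum_perm _ _ _ HpK) in E.
pose proof (decay_tail M K HMK) as Ht; fold q in E.
replace (8 * A / (INR M + 1)) with (A * (8 / (INR M + 1))) by (unfold Rdiv; ring).
apply Rmult_le_compat_l; lra.
Qed.

(** * Limits of complex sequences *)

Definition is_clim (u : nat -> C) (z : C) : Prop :=
  is_lim_seq (fun N => Re (u N)) (Re z) /\ is_lim_seq (fun N => Im (u N)) (Im z).

Lemma Clim_seq_unique u z : is_clim u z -> Clim_seq u = z.
Proof.
intros [H1 H2]; unfold Clim_seq.
rewrite (is_lim_seq_unique _ _ H1), (is_lim_seq_unique _ _ H2); now destruct z.
Qed.

Lemma is_clim_ext u v z : (forall N, u N = v N) -> is_clim u z -> is_clim v z.
Proof.
intros E [H1 H2]; split; (eapply is_lim_seq_ext; [|eassumption]); intros N; simpl; now rewrite E.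
Qed.

Lemma is_clim_const z : is_clim (fun _ => z) z.
Proof. split; apply is_lim_seq_const. Qed.

Lemma is_clim_plus u v z w :
  is_clim u z -> is_clim v w -> is_clim (fun N => u N + v N)%C (z + w)%C.
Proof.
intros [H1 H2] [H3 H4]; split; simpl; now apply is_lim_seq_plus'.
Qed.

Lemma is_clim_mult u v z w :
  is_clim u z -> is_clim v w -> is_clim (fun N => u N * v N)%C (z * w)%C.
Proof.
intros [H1 H2] [H3 H4]; split; simpl.
- apply is_lim_seq_minus'; now apply is_lim_seq_mult'.
- apply is_lim_seq_plus'; now apply is_lim_seq_mult'.
Qed.

Lemma is_clim_scal c u z : is_clim u z -> is_clim (fun N => c * u N)%C (c * z)%C.
Proof. intros H; apply is_clim_mult; trivial; apply is_clim_const. Qed.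

Lemma is_clim_opp u z : is_clim u z -> is_clim (fun N => - u N)%C (- z)%C.
Proof. intros [H1 H2]; split; simpl; [exact (proj1 (is_lim_seq_opp _ _) H1)|exact (proj1 (is_lim_seq_opp _ _) H2)]. Qed.

Lemma is_clim_minus u v z w :
  is_clim u z -> is_clim v w -> is_clim (fun N => u N - v N)%C (z - w)%C.
Proof. intros H1 H2; apply is_clim_plus; trivial; now apply is_clim_opp. Qed.

Lemma is_clim_inv u z : z <> RtoC 0 -> is_clim u z -> is_clim (fun N => / u N)%C (/ z)%C.
Proof.
intros Hz [H1 H2].
assert (Hn : fst z ^ 2 + snd z ^ 2 <> 0).
{ intros E; apply Hz; destruct z as [x y]; simpl in E.
  unfold RtoC; f_equal; nra. }
assert (Hd : is_lim_seq (fun N => fst (u N) ^ 2 + snd (u N) ^ 2) (fst z ^ 2 + snd z ^ 2)).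
{ apply is_lim_seq_plus'; simpl; repeat apply is_lim_seq_mult'; trivial; apply is_lim_seq_const. }
split; simpl Re; simpl Im; unfold Re, Im, Cinv; cbn [fst snd].
- now apply is_lim_seq_div'.
- apply is_lim_seq_div'; trivial; exact (proj1 (is_lim_seq_opp _ _) H2).
Qed.

Lemma is_clim_unique u z w : is_clim u z -> is_clim u w -> z = w.
Proof. intros H1 H2; now rewrite <- (Clim_seq_unique _ _ H1), <- (Clim_seq_unique _ _ H2). Qed.

Lemma Rabs_Re_le z : Rabs (Re z) <= Cmod z.
Proof. eapply Rle_trans; [apply Rmax_l|apply Rmax_Cmod]. Qed.

Lemma Rabs_Im_le z : Rabs (Im z) <= Cmod z.
Proof. eapply Rle_trans; [apply Rmax_r|apply Rmax_Cmod]. Qed.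

Lemma Cmod_le_abs z : Cmod z <= Rabs (Re z) + Rabs (Im z).
Proof.
destruct z as [x y]; unfold Cmod, Re, Im; cbn [fst snd].
pose proof (Rabs_pos x); pose proof (Rabs_pos y).
rewrite <- (sqrt_Rsqr (Rabs x + Rabs y)) by lra; apply sqrt_le_1_alt.
rewrite <- (pow2_abs x), <- (pow2_abs y); unfold Rsqr; nra.
Qed.

Lemma is_clim_Cmod u z :
  is_lim_seq (fun N => Cmod (u N - z)%C) 0 -> is_clim u z.
Proof.
intros H; split.
- apply is_lim_seq_ext with (fun N => Re (u N - z)%C + Re z).
  { intros N; components; ring. }
  replace (Finite (Re z)) with (Finite (0 + Re z)) by (f_equal; ring).
  apply is_lim_seq_plus'; [|apply is_lim_seq_const].
  apply is_lim_seq_abs_0.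
  apply is_lim_seq_le_le with (fun _ => 0) (fun N => Cmod (u N - z)%C);
   [|apply is_lim_seq_const|trivial].
  intros N; split; [apply Rabs_pos|apply Rabs_Re_le].
- apply is_lim_seq_ext with (fun N => Im (u N - z)%C + Im z).
  { intros N; components; ring. }
  replace (Finite (Im z)) with (Finite (0 + Im z)) by (f_equal; ring).
  apply is_lim_seq_plus'; [|apply is_lim_seq_const].
  apply is_lim_seq_abs_0.
  apply is_lim_seq_le_le with (fun _ => 0) (fun N => Cmod (u N - z)%C);
   [|apply is_lim_seq_const|trivial].
  intros N; split; [apply Rabs_pos|apply Rabs_Im_le].
Qed.

Lemma Cmod_is_clim u z :
  is_clim u z -> is_lim_seq (fun N => Cmod (u N - z)%C) 0.
Proof.
intros H.
assert (H0 : is_clim (fun N => u N - z)%C (RtoC 0)).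
{ replace (RtoC 0) with (z - z)%C by ring; apply is_clim_minus; trivial; apply is_clim_const. }
destruct H0 as [H1 H2]; simpl Re in H1; simpl Im in H2.
apply is_lim_seq_le_le with (fun _ => 0)
  (fun N => Rabs (Re (u N - z)%C) + Rabs (Im (u N - z)%C)); [|apply is_lim_seq_const|].
- intros N; split; [apply Cmod_ge_0|apply Cmod_le_abs].
- replace (Finite 0) with (Finite (0 + 0)) by (f_equal; ring).
  apply is_lim_seq_plus'; [apply (is_lim_seq_abs_0 (fun N => Re (u N - z)%C))|
    apply (is_lim_seq_abs_0 (fun N => Im (u N - z)%C))]; trivial.
Qed.

Lemma is_lim_seq_inv_INR K : is_lim_seq (fun N => K / (INR N + 1)) 0.
Proof.
replace (Finite 0) with (Rbar_mult K 0) by (simpl; f_equal; ring).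
apply (is_lim_seq_scal_l (fun N => / (INR N + 1))).
change (Finite 0) with (Rbar_inv p_infty); apply is_lim_seq_inv; [|easy].
eapply is_lim_seq_plus; [apply is_lim_seq_INR|apply is_lim_seq_const|easy].
Qed.

Lemma is_clim_rate u z K N0 :
  (forall N, (N0 <= N)%nat -> Cmod (u N - z)%C <= K / (INR N + 1)) -> is_clim u z.
Proof.
intros H; apply is_clim_Cmod.
apply is_lim_seq_le_le_loc with (fun _ => 0) (fun N => K / (INR N + 1));
 [|apply is_lim_seq_const|apply is_lim_seq_inv_INR].
exists N0; intros N HN; split; [apply Cmod_ge_0|auto].
Qed.

Lemma is_clim_le_r u z w K :
  is_clim u z -> eventually (fun N => Cmod (u N - w)%C <= K) -> Cmod (z - w)%C <= K.
Proof.
intros Hu H; apply Cmod_is_clim in Hu.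
apply Rnot_lt_le; intros Hlt.
apply is_lim_seq_spec in Hu.
assert (He : 0 < Cmod (z - w)%C - K) by lra.
destruct (Hu (mkposreal _ He)) as [N1 H1]; destruct H as [N2 H2].
specialize (H1 (Nat.max N1 N2) ltac:(lia)); specialize (H2 (Nat.max N1 N2) ltac:(lia)).
simpl in H1; rewrite Rminus_0_r, Rabs_pos_eq in H1 by apply Cmod_ge_0.
set (v := u (Nat.max N1 N2)) in *.
assert (Cmod (z - w) <= Cmod (v - z) + Cmod (v - w))%C.
{ replace (z - w)%C with (- (v - z) + (v - w))%C by ring.
  eapply Rle_trans; [apply Cmod_triangle|rewrite Cmod_opp; lra]. }
lra.
Qed.

Lemma cauchy_is_clim u K N0 :
  (forall M N, (N0 <= M)%nat -> (M <= N)%nat -> Cmod (u N - u M)%C <= K / (INR M + 1)) ->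
  exists z, is_clim u z.
Proof.
intros H.
assert (Hc : forall p : C -> R, (forall z, Rabs (p z) <= Cmod z) ->
  (forall z w, p (z - w)%C = p z - p w) ->
  ex_finite_lim_seq (fun N => p (u N))).
{ intros p Hp Hm; apply ex_lim_seq_cauchy_corr; intros eps.
  pose proof (is_lim_seq_inv_INR K) as Hl; apply is_lim_seq_spec in Hl.
  destruct (Hl (pos_div_2 eps)) as [N1 H1]; simpl in H1.
  set (M := Nat.max N0 N1).
  assert (HM : forall N, (M <= N)%nat -> Rabs (p (u N) - p (u M)) < eps / 2).
  { intros N HN; rewrite <- Hm; eapply Rle_lt_trans; [apply Hp|].
    eapply Rle_lt_trans; [apply H; lia|].
    eapply Rle_lt_trans; [|apply (H1 M); lia].
    rewrite Rminus_0_r; apply Rle_abs. }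
  exists M; intros n m Hn Hm'.
  replace (p (u n) - p (u m)) with ((p (u n) - p (u M)) - (p (u m) - p (u M))) by ring.
  eapply Rle_lt_trans; [apply Rabs_triang|]; rewrite Rabs_Ropp.
  pose proof (HM n Hn); pose proof (HM m Hm'); lra. }
destruct (Hc Re Rabs_Re_le) as [x Hx]; [intros; components; ring|].
destruct (Hc Im Rabs_Im_le) as [y Hy]; [intros; components; ring|].
exists (x, y); now split.
Qed.

(** Both the sum over [l] and the limit lie within 8 A / (M + 1) of the sum over the box of radius
    M; the two errors add up to 16. *)
Lemma box_limit (f : Z * Z -> C) (A : R) M0 :
  (forall k, (M0 < supn k)%nat -> Cmod (f k) <= A * decay k) ->
  is_clim (fun N => Csum (map f (box N))) (Clim_seq (fun N => Csum (map f (box N)))) /\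
  forall M l, (M0 <= M)%nat -> NoDup l -> incl (box M) l ->
    Cmod (Csum (map f l) - Clim_seq (fun N => Csum (map f (box N))))%C
      <= 16 * A / (INR M + 1).
Proof.
intros H.
destruct (cauchy_is_clim (fun N => Csum (map f (box N))) (8 * A) M0) as [z Hz].
{ intros M N HM HN; apply box_tail; [apply NoDup_box|now apply incl_box|].
  intros k Hk; apply H; lia. }
rewrite (Clim_seq_unique _ _ Hz); split; trivial.
intros M l HM Hl Hi.
assert (H1 : Cmod (Csum (map f l) - Csum (map f (box M)))%C <= 8 * A / (INR M + 1)).
{ apply box_tail; trivial; intros k Hk; apply H; lia. }
assert (H2 : Cmod (z - Csum (map f (box M)))%C <= 8 * A / (INR M + 1)).
{ eapply is_clim_le_r; [exact Hz|]; exists M; intros N HN.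
  apply box_tail; [apply NoDup_box|now apply incl_box|]; intros k Hk; apply H; lia. }
replace (Csum (map f l) - z)%C with
  ((Csum (map f l) - Csum (map f (box M))) + - (z - Csum (map f (box M))))%C by ring.
eapply Rle_trans; [apply Cmod_triangle|rewrite Cmod_opp].
replace (16 * A / (INR M + 1)) with (8 * A / (INR M + 1) + 8 * A / (INR M + 1)) by (unfold Rdiv; ring).
lra.
Qed.

(** * The Weierstrass zeta function *)

Lemma Cinv_0 : (/ RtoC 0)%C = RtoC 0.
Proof. unfold Cinv, RtoC; cbn [fst snd]; f_equal; unfold Rdiv; ring. Qed.

Lemma latpt_0 a b : latpt a b (0%Z, 0%Z) = RtoC 0.
Proof. unfold latpt; cbn [fst snd]; ring. Qed.

Lemma Csum_latbox a b (h : C -> C) N :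
  Csum (map (fun k => h (latpt a b k)) (box N)) =
  (h (RtoC 0) + Csum (map h (latbox a b N)))%C.
Proof.
set (p := fun k : Z * Z => negb (Z.eqb (fst k) 0 && Z.eqb (snd k) 0)).
assert (E : latbox a b N = map (latpt a b) (filter p (box N))) by reflexivity.
rewrite E, map_map, (Csum_perm _ _ _ (filter_split_perm p (box N))), Csum_app.
assert (Hp : Permutation (filter (fun k => negb (p k)) (box N)) [(0%Z, 0%Z)]).
{ apply NoDup_Permutation.
  - apply NoDup_filter, NoDup_box.
  - repeat constructor; intros [].
  - intros [i j]; rewrite filter_In, in_box; unfold p, supn; cbn [fst snd In].
    rewrite Bool.negb_involutive, Bool.andb_true_iff, !Z.eqb_eq; split.
    + intros [_ [-> ->]]; now left.
    + intros [H|[]]; inversion H; subst; simpl; split; [lia|easy]. }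
rewrite (Csum_perm _ _ _ Hp); unfold Csum at 2; simpl; rewrite latpt_0; ring.
Qed.

Lemma lattice_sum_box a b (h : C -> C) z :
  is_clim (fun N => Csum (map (fun k => h (latpt a b k)) (box N))) z ->
  lattice_sum a b h = (z - h (RtoC 0))%C.
Proof.
intros H; unfold lattice_sum; apply Clim_seq_unique.
apply is_clim_ext with
  (fun N => Csum (map (fun k => h (latpt a b k)) (box N)) - h (RtoC 0))%C.
- intros N; rewrite Csum_latbox; ring.
- apply is_clim_minus; trivial; apply is_clim_const.
Qed.

Lemma INR_abs_nat i : INR (Z.abs_nat i) = Rabs (IZR i).
Proof. now rewrite INR_IZR_INZ, Zabs2Nat.id_abs, abs_IZR. Qed.

Lemma INR_supn_le k r :
  Rabs (IZR (fst k)) <= r -> Rabs (IZR (snd k)) <= r -> INR (supn k) <= r.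
Proof.
intros H1 H2; unfold supn.
destruct (Nat.max_spec (Z.abs_nat (fst k)) (Z.abs_nat (snd k))) as [[_ ->]|[_ ->]];
 rewrite INR_abs_nat; trivial.
Qed.

(** For w = i a + j b the imaginary parts of conj(a) w and conj(b) w are j D and - i D, where D is
    the signed area of the period parallelogram. Each coordinate is therefore bounded by a multiple
    of |w|. *)
Lemma latpt_lower a b : Im (Cconj a * b)%C <> 0 ->
  exists c, 0 < c /\ forall k, c * INR (supn k) <= Cmod (latpt a b k).
Proof.
intros HD; set (D := Rabs (Im (Cconj a * b)%C)) in *.
assert (HDp : 0 < D) by now apply Rabs_pos_lt.
set (m := Cmod a + Cmod b + 1).
pose proof (Cmod_ge_0 a); pose proof (Cmod_ge_0 b).
exists (D / m); split; [apply Rdiv_lt_0_compat; unfold m; lra|]; intros k.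
set (w := latpt a b k).
assert (Ha : Rabs (IZR (snd k)) * D <= Cmod a * Cmod w).
{ unfold D; rewrite <- Rabs_mult, <- (Cmod_conj a), <- Cmod_mult.
  eapply Rle_trans; [|apply Rabs_Im_le]; right; f_equal.
  unfold w, latpt; components; ring. }
assert (Hb : Rabs (IZR (fst k)) * D <= Cmod b * Cmod w).
{ unfold D; rewrite <- Rabs_mult, <- (Cmod_conj b), <- Cmod_mult.
  eapply Rle_trans; [|apply Rabs_Im_le]; right; rewrite <- Rabs_Ropp; f_equal.
  unfold w, latpt; components; ring. }
pose proof (Cmod_ge_0 w).
apply (Rmult_le_reg_r (m / D)); [apply Rdiv_lt_0_compat; unfold m; lra|].
replace (D / m * INR (supn k) * (m / D)) with (INR (supn k)) by (field; unfold m; lra).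
assert (Hr : forall x y, 0 <= y -> y <= m -> x * D <= y * Cmod w -> x <= Cmod w * (m / D)).
{ intros x y Hy Hym Hx; apply (Rmult_le_reg_r D); trivial.
  replace (Cmod w * (m / D) * D) with (m * Cmod w) by (field; lra).
  eapply Rle_trans; [exact Hx|]; now apply Rmult_le_compat_r. }
apply INR_supn_le; [apply (Hr _ (Cmod b))|apply (Hr _ (Cmod a))]; unfold m; trivial; lra.
Qed.

Lemma finite_gap (l : list (Z * Z)) (g : Z * Z -> R) :
  (forall k, 0 < g k) -> exists e, 0 < e /\ forall k, In k l -> e <= g k.
Proof.
intros Hg; induction l as [|x l [e [He IH]]]; [exists 1; split; [lra|intros ? []]|].
exists (Rmin e (g x)); split; [apply Rmin_glb_lt; auto|].
intros k [<-|Hk]; [apply Rmin_r|eapply Rle_trans; [apply Rmin_l|auto]].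
Qed.

Lemma Cmod_sub_lower z w : Cmod w - Cmod z <= Cmod (z - w)%C.
Proof.
pose proof (Cmod_triangle z (- (z - w))%C) as H; rewrite Cmod_opp in H.
replace (z + - (z - w))%C with w in H by ring; lra.
Qed.

Lemma Cmod_pos z : z <> RtoC 0 -> 0 < Cmod z.
Proof. apply Cmod_gt_0. Qed.

Lemma not_in_lattice_sub a b z k : ~ in_lattice a b z -> (z - latpt a b k)%C <> RtoC 0.
Proof.
intros Hz E; apply Hz; exists k.
replace z with ((z - latpt a b k) + latpt a b k)%C by ring; rewrite E; ring.
Qed.

Lemma nat_above r : exists M : nat, r <= INR M.
Proof.
destruct (archimed (Rabs r)) as [H _]; pose proof (Rle_abs r).
exists (Z.abs_nat (up (Rabs r))); rewrite INR_abs_nat.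
pose proof (Rle_abs (IZR (up (Rabs r)))); lra.
Qed.

(** Far from z the growth of |w| gives the bound, and on the remaining finite box a positive minimum
    exists. Since the bound grows with the index, one constant [d] serves the Taylor estimate and
    all boundary estimates. *)
Lemma lattice_gap a b z : Im (Cconj a * b)%C <> 0 -> ~ in_lattice a b z ->
  exists d, 0 < d /\ forall k, d * (1 + INR (supn k)) <= Cmod (z - latpt a b k)%C.
Proof.
intros HD Hz; destruct (latpt_lower a b HD) as [c [Hc Hk]].
destruct (nat_above (2 * Cmod z / c)) as [M HM].
destruct (finite_gap (box M) (fun k => Cmod (z - latpt a b k)%C / (1 + INR (supn k))))
  as [e [He Hfin]].
{ intros k; apply Rdiv_lt_0_compat; [|pose proof (pos_INR (supn k)); lra].
  now apply Cmod_pos, not_in_lattice_sub. }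
exists (Rmin e (c / 4)); split; [apply Rmin_glb_lt; lra|]; intros k.
pose proof (pos_INR (supn k)) as Hp.
destruct (Nat.le_gt_cases (supn k) M) as [Hle|Hgt].
- apply (proj2 (in_box M k)), Hfin in Hle.
  apply Rle_trans with (e * (1 + INR (supn k))).
  { apply Rmult_le_compat_r; [lra|apply Rmin_l]. }
  apply (Rmult_le_compat_r (1 + INR (supn k))) in Hle; [|lra].
  eapply Rle_trans; [exact Hle|]; right; field; lra.
- apply Rle_trans with (c / 4 * (1 + INR (supn k))).
  { apply Rmult_le_compat_r; [lra|apply Rmin_r]. }
  eapply Rle_trans; [|apply Cmod_sub_lower].
  assert (H1 : 1 <= INR (supn k)) by (apply (le_INR 1); lia).
  assert (H2 : INR M <= INR (supn k)) by (apply le_INR; lia).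
  assert (H3 : 2 * Cmod z <= c * INR (supn k)).
  { apply (Rmult_le_compat_l c) in HM; [|lra].
    replace (c * (2 * Cmod z / c)) with (2 * Cmod z) in HM by (field; lra); nra. }
  specialize (Hk k); nra.
Qed.

Definition zeta_term (z w : C) : C := (/ (z - w) + / w + z / w ^ 2)%C.
Definition wp_term (z w : C) : C := (/ (z - w) ^ 2 - / w ^ 2)%C.

(** As the inverse of 0 is 0, the origin contributes exactly the isolated pole. Thus zeta becomes a
    sum over full boxes, without a hole that would disturb telescoping. *)
Lemma zeta_term_0 z : zeta_term z (RtoC 0) = (/ z)%C.
Proof.
unfold zeta_term; simpl; rewrite Cmult_0_l, Cinv_0; unfold Cdiv.
replace (z - 0)%C with z by ring; rewrite Cinv_0; ring.
Qed.

Lemma wp_term_0 z : wp_term z (RtoC 0) = (/ z ^ 2)%C.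
Proof.
unfold wp_term; replace (z - 0)%C with z by ring.
replace (RtoC 0 ^ 2)%C with (RtoC 0) by (simpl; ring); rewrite Cinv_0; ring.
Qed.

Lemma Cmod_inv_le z r : 0 < r -> r <= Cmod z -> Cmod (/ z)%C <= / r.
Proof.
intros Hr H; assert (z <> RtoC 0) by (intros ->; rewrite Cmod_0 in H; lra).
rewrite Cmod_inv by trivial; apply Rinv_le_contravar; trivial.
Qed.

Lemma inv_cube_decay c k : 0 < c -> (0 < supn k)%nat ->
  / (c * INR (supn k)) ^ 3 <= 8 / c ^ 3 * decay k.
Proof.
intros Hc Hk; unfold decay; assert (H1 : 1 <= INR (supn k)) by (apply (le_INR 1); lia).
set (K := INR (supn k)) in *.
replace (8 / c ^ 3 * / (1 + K) ^ 3) with (/ (c * ((1 + K) / 2)) ^ 3) by (field; lra).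
apply Rinv_le_contravar; [apply pow_lt; nra|apply pow_incr; nra].
Qed.

Lemma far_terms c z w K : 0 < c -> 0 < K -> 2 * Cmod z <= c * K -> c * K <= Cmod w ->
  w <> RtoC 0 /\ (z - w)%C <> RtoC 0 /\
  Cmod (/ w)%C <= / (c * K) /\ Cmod (/ (z - w))%C <= 2 / (c * K).
Proof.
intros Hc HK Hz Hw.
assert (Hp : 0 < c * K) by now apply Rmult_lt_0_compat.
assert (H2 : c * K / 2 <= Cmod (z - w)%C) by (pose proof (Cmod_sub_lower z w); lra).
repeat split.
- intros ->; rewrite Cmod_0 in Hw; lra.
- intros E; rewrite E, Cmod_0 in H2; lra.
- now apply Cmod_inv_le.
- replace (2 / (c * K)) with (/ (c * K / 2)) by (field; lra); apply Cmod_inv_le; lra.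
Qed.

(** The corrections cancel the expansion of 1 / (z - w) in 1 / w up to second order and leave z^2 /
    (w^2 (z - w)). Of the constant 16, a factor 2 comes from |z - w| >= c K / 2, where K is the sup
    norm of the index, and a factor 8 from replacing K by (1 + K) / 2. *)
Lemma zeta_term_bound a b c z k : 0 < c ->
  (forall k, c * INR (supn k) <= Cmod (latpt a b k)) ->
  2 * Cmod z <= c * INR (supn k) -> (0 < supn k)%nat ->
  Cmod (zeta_term z (latpt a b k)) <= 16 * Cmod z ^ 2 / c ^ 3 * decay k.
Proof.
intros Hc Hl Hz Hk; specialize (Hl k).
assert (HK : 0 < INR (supn k)) by (apply lt_0_INR; lia).
destruct (far_terms c z _ _ Hc HK Hz Hl) as [Hw [Hzw [H1 H2]]].
pose proof (inv_cube_decay c k Hc Hk) as H3.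
set (w := latpt a b k) in *; set (r := c * INR (supn k)) in *.
replace (zeta_term z w) with (z * z * (/ w * / w * / (z - w)))%C
  by (unfold zeta_term; field; auto).
rewrite !Cmod_mult.
assert (Hr : 0 < r) by now apply Rmult_lt_0_compat.
pose proof (Cmod_ge_0 (/ w)%C); pose proof (Cmod_ge_0 (/ (z - w))%C).
pose proof (Cmod_ge_0 z).
assert (H6 : Cmod (/ w) * Cmod (/ w) * Cmod (/ (z - w)) <= / r * / r * (2 / r)).
{ apply Rmult_le_compat; trivial; [now apply Rmult_le_pos|].
  now apply Rmult_le_compat. }
replace (16 * Cmod z ^ 2 / c ^ 3 * decay k) with (Cmod z * Cmod z * (2 * (8 / c ^ 3 * decay k)))
  by (unfold Rdiv; ring).
apply Rmult_le_compat_l; [nra|].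
eapply Rle_trans; [exact H6|].
replace (/ r * / r * (2 / r)) with (2 * / r ^ 3) by (field; lra); lra.
Qed.

Lemma wp_term_bound a b c z k : 0 < c ->
  (forall k, c * INR (supn k) <= Cmod (latpt a b k)) ->
  2 * Cmod z <= c * INR (supn k) -> (0 < supn k)%nat ->
  Cmod (wp_term z (latpt a b k)) <= 48 * Cmod z / c ^ 3 * decay k.
Proof.
intros Hc Hl Hz Hk; specialize (Hl k).
assert (HK : 0 < INR (supn k)) by (apply lt_0_INR; lia).
destruct (far_terms c z _ _ Hc HK Hz Hl) as [Hw [Hzw [H1 H2]]].
pose proof (inv_cube_decay c k Hc Hk) as H3.
set (w := latpt a b k) in *; set (r := c * INR (supn k)) in *.
replace (wp_term z w) with
  (z * (/ w * / (z - w) * / (z - w)) + - (z * (/ w * / w * / (z - w))))%C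
  by (unfold wp_term; field; auto).
eapply Rle_trans; [apply Cmod_triangle|]; rewrite Cmod_opp, !Cmod_mult.
assert (Hr : 0 < r) by now apply Rmult_lt_0_compat.
pose proof (Cmod_ge_0 (/ w)%C); pose proof (Cmod_ge_0 (/ (z - w))%C).
pose proof (Cmod_ge_0 z).
assert (H6 : Cmod (/ w) * Cmod (/ w) * Cmod (/ (z - w)) <= / r * / r * (2 / r)).
{ apply Rmult_le_compat; trivial; [now apply Rmult_le_pos|].
  now apply Rmult_le_compat. }
assert (H7 : Cmod (/ w) * Cmod (/ (z - w)) * Cmod (/ (z - w)) <= / r * (2 / r) * (2 / r)).
{ apply Rmult_le_compat; trivial; [now apply Rmult_le_pos|].
  now apply Rmult_le_compat. }
replace (48 * Cmod z / c ^ 3 * decay k) with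
  (Cmod z * (4 * (8 / c ^ 3 * decay k)) + Cmod z * (2 * (8 / c ^ 3 * decay k)))
  by (unfold Rdiv; ring).
apply Rplus_le_compat; (apply Rmult_le_compat_l; [trivial|]).
- eapply Rle_trans; [exact H7|].
  replace (/ r * (2 / r) * (2 / r)) with (4 * / r ^ 3) by (field; lra); lra.
- eapply Rle_trans; [exact H6|].
  replace (/ r * / r * (2 / r)) with (2 * / r ^ 3) by (field; lra); lra.
Qed.

Definition zeta_box a b (z : C) (N : nat) : C :=
  Csum (map (fun k => zeta_term z (latpt a b k)) (box N)).
Definition wp_box a b (z : C) (N : nat) : C :=
  Csum (map (fun k => wp_term z (latpt a b k)) (box N)).

Lemma far_index c M R0 k :
  0 < c -> 2 * R0 / c <= INR M -> (M < supn k)%nat -> 2 * R0 <= c * INR (supn k).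
Proof.
intros Hc HM Hk; assert (H : INR M <= INR (supn k)) by (apply le_INR; lia).
apply (Rmult_le_reg_r (/ c)); [now apply Rinv_0_lt_compat|].
replace (c * INR (supn k) * / c) with (INR (supn k)) by (field; lra).
unfold Rdiv in HM; lra.
Qed.

(** Uniformity on discs permits integration of the partial sums along a segment; arbitrary sets [l]
    permit the conjugated boxes. *)
Lemma wzeta_box a b R0 : Im (Cconj a * b)%C <> 0 -> 0 <= R0 ->
  exists A M0, forall z, Cmod z <= R0 ->
    is_clim (zeta_box a b z) (wzeta a b z) /\
    forall M l, (M0 <= M)%nat -> NoDup l -> incl (box M) l ->
      Cmod (Csum (map (fun k => zeta_term z (latpt a b k)) l) - wzeta a b z)%C
        <= A / (INR M + 1).
Proof.
intros HD HR; destruct (latpt_lower a b HD) as [c [Hc Hl]].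
destruct (nat_above (2 * R0 / c)) as [M0 HM0].
exists (16 * (16 * R0 ^ 2 / c ^ 3)), M0; intros z Hz.
assert (Hb : forall k, (M0 < supn k)%nat ->
  Cmod (zeta_term z (latpt a b k)) <= 16 * R0 ^ 2 / c ^ 3 * decay k).
{ intros k Hk; pose proof (far_index c M0 R0 k Hc HM0 Hk).
  eapply Rle_trans; [apply (zeta_term_bound a b c z k); trivial; [lra|lia]|].
  apply Rmult_le_compat_r; [left; apply decay_pos|].
  unfold Rdiv; apply Rmult_le_compat_r; [left; apply Rinv_0_lt_compat, pow_lt; lra|].
  apply Rmult_le_compat_l; [lra|]; apply pow_incr; split; trivial; apply Cmod_ge_0. }
destruct (box_limit _ _ _ Hb) as [H1 H2].
assert (E : wzeta a b z = Clim_seq (fun N => Csum (map (fun k => zeta_term z (latpt a b k)) (box N)))).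
{ unfold wzeta.
  change (fun w => (/ (z - w) + / w + z / w ^ 2)%C) with (zeta_term z).
  rewrite (lattice_sum_box a b (zeta_term z) _ H1), zeta_term_0; ring. }
rewrite E; split; trivial.
Qed.

Lemma wzeta_lim a b z : Im (Cconj a * b)%C <> 0 ->
  is_clim (zeta_box a b z) (wzeta a b z).
Proof.
intros HD; destruct (wzeta_box a b (Cmod z) HD (Cmod_ge_0 z)) as [A [M0 H]].
now apply H, Rle_refl.
Qed.

Lemma wp_lim a b z : Im (Cconj a * b)%C <> 0 ->
  is_clim (wp_box a b z) (wp a b z).
Proof.
intros HD; destruct (latpt_lower a b HD) as [c [Hc Hl]].
destruct (nat_above (2 * Cmod z / c)) as [M0 HM0].
assert (Hb : forall k, (M0 < supn k)%nat ->
  Cmod (wp_term z (latpt a b k)) <= 48 * Cmod z / c ^ 3 * decay k).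
{ intros k Hk; pose proof (far_index c M0 _ k Hc HM0 Hk).
  apply (wp_term_bound a b c z k); trivial; lia. }
destruct (box_limit _ _ _ Hb) as [H1 _].
assert (E : wp a b z = Clim_seq (fun N => Csum (map (fun k => wp_term z (latpt a b k)) (box N)))).
{ unfold wp.
  change (fun w => (/ (z - w) ^ 2 - / w ^ 2)%C) with (wp_term z).
  rewrite (lattice_sum_box a b (wp_term z) _ H1), wp_term_0; ring. }
now rewrite E.
Qed.

(** A termwise second-order remainder replaces differentiation of the series: each term contributes
    h^2 / ((z + h - w) (z - w)^2). For |h| < d / 2 the first factor stays above half of the gap, so
    the remainders are dominated by [decay]. *)
Lemma wzeta_taylor a b z : Im (Cconj a * b)%C <> 0 -> ~ in_lattice a b z ->
  exists d K, 0 < d /\ forall h, Cmod h < d ->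
    Cmod (wzeta a b (z + h) - wzeta a b z + h * wp a b z)%C <= K * Cmod h ^ 2.
Proof.
intros HD Hz; destruct (lattice_gap a b z HD Hz) as [d [Hd Hg]].
exists (d / 2), (2 / d ^ 3 * 9); split; [lra|]; intros h Hh.
replace (wzeta a b (z + h) - wzeta a b z + h * wp a b z)%C
  with (wzeta a b (z + h) - wzeta a b z + h * wp a b z - RtoC 0)%C by ring.
apply is_clim_le_r with (fun N => zeta_box a b (z + h) N - zeta_box a b z N + h * wp_box a b z N)%C.
{ apply is_clim_plus; [apply is_clim_minus; now apply wzeta_lim|].
  apply is_clim_scal; now apply wp_lim. }
exists 0%nat; intros N _.
set (t := fun k => (h ^ 2 * (/ (z + h - latpt a b k) * / (z - latpt a b k) * / (z - latpt a b k)))%C).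
assert (Hk : forall k, d * (1 + INR (supn k)) / 2 <= Cmod (z + h - latpt a b k)%C).
{ intros k; specialize (Hg k); pose proof (pos_INR (supn k)).
  pose proof (Cmod_sub_lower (- h)%C (z - latpt a b k)%C) as H1.
  rewrite Cmod_opp in H1; replace (- h - (z - latpt a b k))%C with (- (z + h - latpt a b k))%C in H1 by ring.
  rewrite Cmod_opp in H1; nra. }
replace (zeta_box a b (z + h) N - zeta_box a b z N + h * wp_box a b z N - 0)%C
  with (Csum (map t (box N))).
2:{ unfold zeta_box, wp_box, Cminus;
    replace (- Csum (map (fun k => zeta_term z (latpt a b k)) (box N)))%C
      with (- (1) * Csum (map (fun k => zeta_term z (latpt a b k)) (box N)))%C by ring.
    rewrite <- !Csum_scal, <- !Csum_plus.
    rewrite (Csum_ext t (fun k => zeta_term (z + h) (latpt a b k) +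
      - (1) * zeta_term z (latpt a b k) + h * wp_term z (latpt a b k))%C); [ring|].
    intros k _; unfold t, zeta_term, wp_term, Cdiv.
    assert (z - latpt a b k <> 0)%C by now apply not_in_lattice_sub.
    assert (z + h - latpt a b k <> 0)%C.
    { intros E; specialize (Hk k); rewrite E, Cmod_0 in Hk; pose proof (pos_INR (supn k)); nra. }
    (* The corrections cancel whatever values they have. Abstracting them includes the origin, where
       they are inverses of 0. *)
    generalize (/ latpt a b k)%C (/ (latpt a b k) ^ 2)%C; intros u v.
    field; auto. }
eapply Rle_trans; [apply Cmod_Csum|].
apply Rle_trans with (rsum (fun k => 2 / d ^ 3 * Cmod h ^ 2 * decay k) (box N)).
{ apply rsum_le; intros k _; unfold t; rewrite !Cmod_mult.
  specialize (Hg k); specialize (Hk k); pose proof (pos_INR (supn k)).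
  set (r := d * (1 + INR (supn k))) in *.
  assert (Hr : 0 < r) by (unfold r; nra).
  pose proof (Cmod_inv_le _ _ Hr Hg) as H1.
  assert (H2 : Cmod (/ (z + h - latpt a b k))%C <= / (r / 2)) by (apply Cmod_inv_le; lra).
  replace (2 / d ^ 3 * Cmod h ^ 2 * decay k) with (Cmod h ^ 2 * (/ (r / 2) * / r * / r))
    by (unfold decay, r; field; split; lra).
  replace (Cmod (h ^ 2)) with (Cmod h ^ 2).
  2:{ simpl; rewrite !Cmod_mult, Cmod_1; ring. }
  apply Rmult_le_compat_l; [apply pow2_ge_0|].
  apply Rmult_le_compat; try apply Cmod_ge_0; trivial.
  - apply Rmult_le_pos; apply Cmod_ge_0.
  - apply Rmult_le_compat; try apply Cmod_ge_0; trivial. }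
rewrite rsum_scal.
(* The origin has weight 1, and everything beyond it has total weight at most 8. *)
assert (H9 : rsum decay (box N) <= 9).
{ pose proof (decay_tail 0 N ltac:(lia)) as H.
  replace (rsum decay (box 0)) with 1 in H.
  - simpl in H; lra.
  - unfold rsum, box, zrange, decay, supn; simpl; field. }
replace (2 / d ^ 3 * 9 * Cmod h ^ 2) with (2 / d ^ 3 * Cmod h ^ 2 * 9) by ring.
apply Rmult_le_compat_l; trivial.
apply Rmult_le_pos; [|apply pow2_ge_0].
left; apply Rdiv_lt_0_compat; [lra|now apply pow_lt].
Qed.

(** * Quasi-periods of zeta *)

Lemma Cinv_opp z : (/ - z)%C = (- / z)%C.
Proof.
destruct z as [x y]; unfold Cinv, Copp; cbn [fst snd]; f_equal; unfold Rdiv;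
 replace ((- x) ^ 2 + (- y) ^ 2) with (x ^ 2 + y ^ 2) by ring; ring.
Qed.

Lemma Cconj_inv z : Cconj (/ z)%C = (/ Cconj z)%C.
Proof.
destruct z as [x y]; unfold Cinv, Cconj; cbn [fst snd]; f_equal; unfold Rdiv;
 replace (x ^ 2 + (- y) ^ 2) with (x ^ 2 + y ^ 2) by ring; ring.
Qed.

(** Sums serve zeta and products serve sigma; with a common fold, reindexing and telescoping are
    proved once for both. *)
Definition bigop {T} (op : C -> C -> C) (e : C) (f : T -> C) (l : list T) : C :=
  fold_right op e (map f l).

Record comm_monoid (op : C -> C -> C) (e : C) : Prop := {
  cm_assoc : forall x y z, op x (op y z) = op (op x y) z;
  cm_comm : forall x y, op x y = op y x;
  cm_unit : forall x, op e x = x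
}.

Lemma Cplus_monoid : comm_monoid Cplus (RtoC 0).
Proof. constructor; intros; ring. Qed.

Lemma Cmult_monoid : comm_monoid Cmult (RtoC 1).
Proof. constructor; intros; ring. Qed.

Lemma bigop_perm {T} op e (f : T -> C) l l' : comm_monoid op e ->
  Permutation l l' -> bigop op e f l = bigop op e f l'.
Proof.
intros [Ha Hc _]; unfold bigop; induction 1; simpl; try congruence.
Qed.

Lemma bigop_app {T} op e (f : T -> C) l l' : comm_monoid op e ->
  bigop op e f (l ++ l') = op (bigop op e f l) (bigop op e f l').
Proof.
intros [Ha Hc Hu]; unfold bigop; induction l as [|x l IH]; simpl; [now rewrite Hu|].
now rewrite IH, Ha.
Qed.

Lemma bigop_ext {T} op e (f g : T -> C) l :
  (forall k, In k l -> f k = g k) -> bigop op e f l = bigop op e g l.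
Proof. intros H; unfold bigop; f_equal; now apply map_ext_in. Qed.

Lemma bigop_list_prod {S T} op e (f : S * T -> C) l l' : comm_monoid op e ->
  bigop op e f (list_prod l l') =
  bigop op e (fun x => bigop op e (fun y => f (x, y)) l') l.
Proof.
intros M; induction l as [|x l IH]; [easy|].
cbn [list_prod]; rewrite (bigop_app _ _ _ _ _ M), IH.
unfold bigop at 1; rewrite map_map; reflexivity.
Qed.

Lemma bigop_box_reindex op e (f : Z * Z -> C) (s : Z * Z -> Z * Z) N : comm_monoid op e ->
  (forall k, s (s k) = k) -> (forall k, supn (s k) = supn k) ->
  bigop op e f (box N) = bigop op e (fun k => f (s k)) (box N).
Proof.
intros M Hs Hn; transitivity (bigop op e f (map s (box N))).
- apply bigop_perm; trivial; apply NoDup_Permutation; [apply NoDup_box| |].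
  + apply FinFun.Injective_map_NoDup; [|apply NoDup_box].
    intros x y E; now rewrite <- (Hs x), <- (Hs y), E.
  + intros k; rewrite in_map_iff, in_box; split.
    * intros Hk; exists (s k); now rewrite Hs, in_box, Hn.
    * intros [k' [<- Hk']]; apply in_box in Hk'; now rewrite Hn.
- unfold bigop; now rewrite map_map.
Qed.

Definition swap (k : Z * Z) : Z * Z := (snd k, fst k).
Definition negk (k : Z * Z) : Z * Z := ((- fst k)%Z, (- snd k)%Z).

Lemma bigop_box_swap op e (f : Z * Z -> C) N : comm_monoid op e ->
  bigop op e f (box N) = bigop op e (fun k => f (swap k)) (box N).
Proof.
intros M; apply bigop_box_reindex; trivial.
- now intros [i j].
- intros [i j]; unfold supn; simpl; lia.
Qed.

Lemma bigop_box_neg op e (f : Z * Z -> C) N : comm_monoid op e ->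
  bigop op e f (box N) = bigop op e (fun k => f (negk k)) (box N).
Proof.
intros M; apply bigop_box_reindex; trivial.
- intros [i j]; unfold negk; simpl; f_equal; lia.
- intros [i j]; unfold supn; simpl; lia.
Qed.

(* D plays the role of a difference or of a quotient of boundary values. *)
Lemma box_telescope op e (D : Z -> Z -> Z -> C) N : comm_monoid op e ->
  (forall j p q r, op (D j p q) (D j q r) = D j p r) ->
  bigop op e (fun k => D (snd k) (fst k - 1) (fst k))%Z (box N) =
  bigop op e (fun j => D j (- Z.of_nat N - 1) (Z.of_nat N))%Z (zrange N).
Proof.
intros M HD; rewrite (bigop_box_swap _ _ _ _ M).
unfold box at 1; rewrite (bigop_list_prod _ _ _ _ _ M).
apply bigop_ext; intros j _; unfold swap; cbn [fst snd].
unfold zrange; unfold bigop; rewrite map_map.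
set (g := fun t : nat => D j (Z.of_nat t - Z.of_nat N - 1)%Z (Z.of_nat t - Z.of_nat N)%Z).
assert (H : forall n, bigop op e g (seq 0 (S n)) =
  D j (- Z.of_nat N - 1)%Z (Z.of_nat n - Z.of_nat N)%Z).
{ induction n as [|n IH].
  - unfold bigop; simpl; rewrite (cm_comm _ _ M), (cm_unit _ _ M); unfold g; f_equal; lia.
  - rewrite (seq_S (S n) 0), (bigop_app _ _ _ _ _ M), IH.
    unfold bigop; simpl map; simpl fold_right.
    rewrite (cm_comm _ _ M (g (S n))), (cm_unit _ _ M); unfold g.
    replace (Z.of_nat (S n) - Z.of_nat N - 1)%Z with (Z.of_nat n - Z.of_nat N)%Z by lia.
    apply HD. }
replace (2 * N + 1)%nat with (S (2 * N)) by lia.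
change (bigop op e g (seq 0 (S (2 * N))) = D j (- Z.of_nat N - 1)%Z (Z.of_nat N)).
rewrite H; f_equal; lia.
Qed.

Lemma in_lattice_plus a b z w : in_lattice a b z -> in_lattice a b w -> in_lattice a b (z + w)%C.
Proof.
intros [k ->] [k' ->]; exists (fst k + fst k', snd k + snd k')%Z.
unfold latpt; cbn [fst snd]; rewrite !plus_IZR, !RtoC_plus; ring.
Qed.

Lemma in_lattice_opp a b z : in_lattice a b z -> in_lattice a b (- z)%C.
Proof.
intros [k ->]; exists (negk k); unfold latpt, negk; cbn [fst snd].
rewrite !opp_IZR, !RtoC_opp; ring.
Qed.

Lemma not_in_lattice_shift a b z w :
  in_lattice a b w -> ~ in_lattice a b z -> ~ in_lattice a b (z + w)%C.
Proof.
intros Hw Hz H; apply Hz.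
replace z with (z + w + - w)%C by ring; apply in_lattice_plus; trivial; now apply in_lattice_opp.
Qed.

(** Telescoping handles only the first generator. The second follows by exchanging the generators,
    and all other periods by additivity. *)
Lemma lattice_ind a b (P : C -> Prop) :
  P a -> P b ->
  (forall w w', in_lattice a b w -> in_lattice a b w' -> P w -> P w' -> P (w + w')%C) ->
  (forall w, in_lattice a b w -> P w -> P (- w)%C) ->
  forall w, in_lattice a b w -> P w.
Proof.
intros Ha Hb Hp Ho.
assert (Ia : in_lattice a b a).
{ exists (1%Z, 0%Z); unfold latpt; cbn [fst snd]; ring. }
assert (Ib : in_lattice a b b).
{ exists (0%Z, 1%Z); unfold latpt; cbn [fst snd]; ring. }
assert (P0 : P (RtoC 0)).
{ replace (RtoC 0) with (a + - a)%C by ring; apply Hp; auto; now apply in_lattice_opp. }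
assert (I0 : in_lattice a b (RtoC 0)).
{ exists (0%Z, 0%Z); now rewrite latpt_0. }
assert (Hn : forall c, in_lattice a b c -> P c -> forall n : nat,
  in_lattice a b (RtoC (INR n) * c)%C /\ P (RtoC (INR n) * c)%C).
{ intros c Ic Pc; induction n as [|n [I1 I2]].
  - simpl INR; rewrite Cmult_0_l; auto.
  - rewrite S_INR, RtoC_plus.
    replace ((RtoC (INR n) + RtoC 1) * c)%C with (RtoC (INR n) * c + c)%C by ring.
    split; [now apply in_lattice_plus|now apply Hp]. }
assert (Hz : forall c, in_lattice a b c -> P c -> forall i : Z,
  in_lattice a b (RtoC (IZR i) * c)%C /\ P (RtoC (IZR i) * c)%C).
{ intros c Ic Pc i; destruct (Z.abs_eq_or_opp i) as [E|E]; rewrite <- Zabs2Nat.id_abs in E.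
  - rewrite <- E, <- INR_IZR_INZ; auto.
  - replace i with (- Z.of_nat (Z.abs_nat i))%Z by lia.
    rewrite opp_IZR, <- INR_IZR_INZ, RtoC_opp.
    replace (- RtoC (INR (Z.abs_nat i)) * c)%C with (- (RtoC (INR (Z.abs_nat i)) * c))%C by ring.
    destruct (Hn c Ic Pc (Z.abs_nat i)); split; [now apply in_lattice_opp|auto]. }
intros w [k ->]; unfold latpt; apply Hp; now apply Hz.
Qed.

Lemma latpt_swap a b k : latpt b a (swap k) = latpt a b k.
Proof. unfold latpt, swap; cbn [fst snd]; ring. Qed.

Lemma in_lattice_swap a b z : in_lattice b a z <-> in_lattice a b z.
Proof.
split; intros [k ->]; exists (swap k); now rewrite latpt_swap.
Qed.

Lemma lattice_swap_nondegenerate a b :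
  Im (Cconj a * b)%C <> 0 -> Im (Cconj b * a)%C <> 0.
Proof.
intros H E; apply H; revert E; components; intros E; lra.
Qed.

Lemma wzeta_swap a b z : Im (Cconj a * b)%C <> 0 -> wzeta b a z = wzeta a b z.
Proof.
intros HD; apply (is_clim_unique (zeta_box a b z)); [|now apply wzeta_lim].
eapply is_clim_ext; [|now apply wzeta_lim, lattice_swap_nondegenerate].
intros N; unfold zeta_box.
change (bigop Cplus (RtoC 0) (fun k => zeta_term z (latpt b a k)) (box N) =
  bigop Cplus (RtoC 0) (fun k => zeta_term z (latpt a b k)) (box N)).
rewrite (bigop_box_swap _ _ _ _ Cplus_monoid).
apply bigop_ext; intros k _; now rewrite latpt_swap.
Qed.

Lemma wzeta_odd a b z : Im (Cconj a * b)%C <> 0 -> wzeta a b (- z)%C = (- wzeta a b z)%C.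
Proof.
intros HD; apply (is_clim_unique (zeta_box a b (- z)%C)); [now apply wzeta_lim|].
eapply is_clim_ext; [|apply is_clim_opp; now apply wzeta_lim].
intros N; unfold zeta_box.
change (- bigop Cplus (RtoC 0) (fun k => zeta_term z (latpt a b k)) (box N) =
  bigop Cplus (RtoC 0) (fun k => zeta_term (- z) (latpt a b k)) (box N))%C.
rewrite (bigop_box_neg _ _ (fun k => zeta_term (- z) (latpt a b k)) _ Cplus_monoid).
replace (- bigop Cplus (RtoC 0) (fun k => zeta_term z (latpt a b k)) (box N))%C
  with (- (1) * Csum (map (fun k => zeta_term z (latpt a b k)) (box N)))%C
  by (unfold bigop, Csum; ring).
rewrite <- Csum_scal; apply Csum_ext; intros k _.
assert (E : latpt a b (negk k) = (- latpt a b k)%C).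
{ unfold latpt, negk; cbn [fst snd]; rewrite !opp_IZR, !RtoC_opp; ring. }
rewrite E; unfold zeta_term, Cdiv; generalize (latpt a b k); intros w.
replace (- z - - w)%C with (- (z - w))%C by ring.
replace ((- w) ^ 2)%C with (w ^ 2)%C by ring.
rewrite !Cinv_opp; ring.
Qed.

Lemma latpt_inj a b k k' : Im (Cconj a * b)%C <> 0 -> latpt a b k = latpt a b k' -> k = k'.
Proof.
intros HD E; destruct (latpt_lower a b HD) as [c [Hc Hl]].
set (m := (fst k - fst k', snd k - snd k')%Z).
assert (Hm : latpt a b m = RtoC 0).
{ transitivity (latpt a b k - latpt a b k')%C; [|rewrite E; ring].
  unfold latpt, m; cbn [fst snd]; rewrite !minus_IZR, !RtoC_minus; ring. }
specialize (Hl m); rewrite Hm, Cmod_0 in Hl.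
assert (H0 : INR (supn m) <= 0) by nra.
assert (H1 : supn m = 0%nat) by (change 0 with (INR 0) in H0; apply INR_le in H0; lia).
unfold supn, m in H1; cbn [fst snd] in H1; destruct k, k'; cbn [fst snd] in *; f_equal; lia.
Qed.

(* The conjugated boxes exhaust the lattice as well, so that absolute
   convergence identifies the two limits. *)
Lemma wzeta_conj a b z : Im (Cconj a * b)%C <> 0 ->
  (forall z, in_lattice a b z -> in_lattice a b (Cconj z)) ->
  wzeta a b (Cconj z) = Cconj (wzeta a b z).
Proof.
intros HD Hreal.
destruct (Hreal a) as [ka Ea]; [exists (1%Z, 0%Z); unfold latpt; cbn [fst snd]; ring|].
destruct (Hreal b) as [kb Eb]; [exists (0%Z, 1%Z); unfold latpt; cbn [fst snd]; ring|].
set (t := fun k : Z * Z => (fst k * fst ka + snd k * fst kb, fst k * snd ka + snd k * snd kb)%Z).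
assert (Et : forall k, latpt a b (t k) = Cconj (latpt a b k)).
{ intros k; transitivity (RtoC (IZR (fst k)) * Cconj a + RtoC (IZR (snd k)) * Cconj b)%C.
  - rewrite Ea, Eb; unfold latpt, t; cbn [fst snd].
    rewrite !plus_IZR, !mult_IZR, !RtoC_plus, !RtoC_mult; ring.
  - unfold latpt; components; f_equal; ring. }
assert (tt : forall k, t (t k) = k).
{ intros k; apply (latpt_inj a b); trivial; rewrite !Et.
  generalize (latpt a b k); intros [x y]; components; f_equal; ring. }
(* [K] bounds the growth of the sup norm under [t]. Since [t] is an involution, the image of the box
   of radius K M contains the box of radius M, and the tail estimate for general sets applies to
   it. *)
set (K := (supn ka + supn kb + 1)%nat).
assert (Hsup : forall k, (supn (t k) <= K * supn k)%nat).
{ intros [i j]; unfold K, supn, t; cbn [fst snd].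
  generalize (fst ka) (snd ka) (fst kb) (snd kb); intros p q r s.
  assert (H : forall p r, (Z.abs_nat (i * p + j * r) <=
    Z.abs_nat i * Z.abs_nat p + Z.abs_nat j * Z.abs_nat r)%nat).
  { intros p' r'; rewrite <- !Zabs2Nat.inj_mul; lia. }
  pose proof (H p r) as H1; pose proof (H q s) as H2; clear H.
  revert H1 H2; generalize (Z.abs_nat (i * p + j * r)) (Z.abs_nat (i * q + j * s)).
  generalize (Z.abs_nat i) (Z.abs_nat j) (Z.abs_nat p) (Z.abs_nat q) (Z.abs_nat r) (Z.abs_nat s).
  intros i' j' p' q' r' s' u v H1 H2.
  assert (i' * p' <= Nat.max i' j' * Nat.max p' q')%nat by (apply Nat.mul_le_mono; lia).
  assert (i' * q' <= Nat.max i' j' * Nat.max p' q')%nat by (apply Nat.mul_le_mono; lia).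
  assert (j' * r' <= Nat.max i' j' * Nat.max r' s')%nat by (apply Nat.mul_le_mono; lia).
  assert (j' * s' <= Nat.max i' j' * Nat.max r' s')%nat by (apply Nat.mul_le_mono; lia).
  nia. }
destruct (wzeta_box a b (Cmod (Cconj z)) HD (Cmod_ge_0 _)) as [A [M0 HA]].
destruct (HA (Cconj z) (Rle_refl _)) as [_ Htail].
set (u := fun N => Cconj (zeta_box a b z N)).
assert (Hu : is_clim u (Cconj (wzeta a b z))).
{ destruct (wzeta_lim a b z HD) as [H1 H2]; split; unfold u, Cconj, Re, Im in *; cbn [fst snd].
  - exact H1.
  - exact (proj1 (is_lim_seq_opp _ _) H2). }
assert (Hsub : is_clim (fun M => u (K * M)%nat) (Cconj (wzeta a b z))).
{ assert (Hf : filterlim (fun M : nat => (K * M)%nat) eventually eventually).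
  { apply eventually_subseq; intros n; unfold K; lia. }
  destruct Hu as [H1 H2]; split.
  - apply (is_lim_seq_subseq (fun N => Re (u N)) _ (fun M => (K * M)%nat)); trivial.
  - apply (is_lim_seq_subseq (fun N => Im (u N)) _ (fun M => (K * M)%nat)); trivial. }
apply (is_clim_unique (fun M => u (K * M)%nat)); trivial.
apply is_clim_rate with A M0; intros M HM.
assert (E : u (K * M)%nat =
  Csum (map (fun k => zeta_term (Cconj z) (latpt a b k)) (map t (box (K * M))))).
{ unfold u, zeta_box; rewrite map_map; generalize (box (K * M)); intros l.
  induction l as [|k l IH].
  - unfold Csum; simpl; components; f_equal; ring.
  - unfold Csum in *; cbn [map fold_right]; rewrite Cplus_conj, IH; f_equal.
    rewrite Et; unfold zeta_term, Cdiv.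
    now rewrite !Cplus_conj, Cmult_conj, !Cconj_inv, Cminus_conj, Cpow_conj. }
rewrite E; apply Htail; trivial.
- apply FinFun.Injective_map_NoDup; [|apply NoDup_box].
  intros x y H; now rewrite <- (tt x), <- (tt y), H.
- intros k Hk; apply in_map_iff; exists (t k); split; [apply tt|].
  apply in_box in Hk; apply in_box; specialize (Hsup k); nia.
Qed.

Lemma length_zrange N : length (zrange N) = (2 * N + 1)%nat.
Proof. unfold zrange; now rewrite length_map, length_seq. Qed.

Lemma supn_boundary N j : (N <= supn (Z.of_nat N, j))%nat /\ (N <= supn (- Z.of_nat N - 1, j)%Z)%nat.
Proof. unfold supn; cbn [fst snd]; lia. Qed.

Lemma Cinv_boundary a b z d N k : 0 < d ->
  (forall k, d * (1 + INR (supn k)) <= Cmod (z - latpt a b k)%C) ->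
  (N <= supn k)%nat -> Cmod (/ (z - latpt a b k))%C <= / (d * (INR N + 1)).
Proof.
intros Hd H HN; pose proof (pos_INR N); apply le_INR in HN.
apply Cmod_inv_le; [apply Rmult_lt_0_compat; lra|].
eapply Rle_trans; [|apply H]; apply Rmult_le_compat_l; lra.
Qed.

Lemma latpt_pred a b i j : latpt a b ((i - 1)%Z, j) = (latpt a b (i, j) - a)%C.
Proof. unfold latpt; cbn [fst snd]; rewrite minus_IZR, RtoC_minus; ring. Qed.

Lemma Cminus_eq_0 x y : (x - y)%C = RtoC 0 -> x = y.
Proof. intros H; replace x with (x - y + y)%C by ring; rewrite H; ring. Qed.

(** The shift by [a] moves every row of the box by one step, so the difference of partial sums is
    carried by the two end columns. There 1 / (z - w) is only of order 1/N, but the difference of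
    its values at z and z' is of order 1/N^2, against 2N + 1 indices. For this reason two base
    points are compared and no value of the quasi-period is computed. *)
Lemma quasi_period_generator a b z z' : Im (Cconj a * b)%C <> 0 ->
  ~ in_lattice a b z -> ~ in_lattice a b z' ->
  (wzeta a b (z + a) - wzeta a b z)%C = (wzeta a b (z' + a) - wzeta a b z')%C.
Proof.
intros HD Hz Hz'; apply Cminus_eq_0.
apply (is_clim_unique (fun N => (zeta_box a b (z + a) N - zeta_box a b z N)
  - (zeta_box a b (z' + a) N - zeta_box a b z' N))%C).
{ apply is_clim_minus; apply is_clim_minus; now apply wzeta_lim. }
destruct (lattice_gap a b z HD Hz) as [d [Hd Hg]].
destruct (lattice_gap a b z' HD Hz') as [d' [Hd' Hg']].
set (v := fun k => (/ (z - latpt a b k) - / (z' - latpt a b k))%C).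
apply is_clim_rate with (4 * (Cmod (z' - z)%C / (d * d'))) 0%nat; intros N _.
match goal with |- Cmod (?x - RtoC 0)%C <= _ => replace (x - RtoC 0)%C with x by ring end.
replace (zeta_box a b (z + a) N - zeta_box a b z N - (zeta_box a b (z' + a) N - zeta_box a b z' N))%C
  with (Csum (map (fun j => v ((- Z.of_nat N - 1)%Z, j) - v (Z.of_nat N, j))%C (zrange N))).
2:{ transitivity (Csum (map (fun k => v ((fst k - 1)%Z, snd k) - v k)%C (box N))).
  - pose proof (box_telescope Cplus (RtoC 0) (fun j p q => v (p, j) - v (q, j))%C N Cplus_monoid) as H.
    unfold bigop in H; unfold Csum; cbv beta in H; rewrite <- H; [|intros; ring].
    f_equal; apply map_ext; now intros [i j].
  - unfold zeta_box;
    assert (Hm : forall f g : Z * Z -> C, (Csum (map f (box N)) - Csum (map g (box N)))%C =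
      Csum (map (fun k => f k - g k)%C (box N))).
    { intros f g; transitivity (Csum (map f (box N)) + - (1) * Csum (map g (box N)))%C; [ring|].
      rewrite <- Csum_scal, <- Csum_plus; apply Csum_ext; intros; ring. }
    rewrite !Hm; apply Csum_ext; intros [i j] _; unfold v, zeta_term, Cdiv; cbn [fst snd].
    rewrite latpt_pred.
    replace (z - (latpt a b (i, j) - a))%C with (z + a - latpt a b (i, j))%C by ring.
    replace (z' - (latpt a b (i, j) - a))%C with (z' + a - latpt a b (i, j))%C by ring.
    ring. }
assert (Hv : forall k, (N <= supn k)%nat ->
  Cmod (v k) <= Cmod (z' - z)%C * (/ (d * (INR N + 1)) * / (d' * (INR N + 1)))).
{ intros k Hk.
  replace (v k) with ((z' - z) * (/ (z - latpt a b k) * / (z' - latpt a b k)))%C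
    by (unfold v; field; split; now apply not_in_lattice_sub).
  rewrite !Cmod_mult; apply Rmult_le_compat_l; [apply Cmod_ge_0|].
  apply Rmult_le_compat; try apply Cmod_ge_0; eapply Cinv_boundary; eauto. }
eapply Rle_trans; [apply Cmod_Csum|].
set (B := Cmod (z' - z)%C * (/ (d * (INR N + 1)) * / (d' * (INR N + 1)))) in *.
apply Rle_trans with (rsum (fun _ : Z => 2 * B) (zrange N)).
{ apply rsum_le; intros j _; destruct (supn_boundary N j) as [H1 H2].
  eapply Rle_trans; [apply Cmod_triangle|rewrite Cmod_opp].
  pose proof (Hv _ H1); pose proof (Hv _ H2); lra. }
rewrite rsum_const, length_zrange, plus_INR, mult_INR; simpl (INR 2); simpl (INR 1).
pose proof (pos_INR N) as HN; pose proof (Cmod_ge_0 (z' - z)%C).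
replace (4 * (Cmod (z' - z) / (d * d')) / (INR N + 1))
  with ((2 * (INR N + 1)) * (2 * B)) by (unfold B; field; repeat split; lra).
apply Rmult_le_compat_r; [|lra].
assert (0 <= B); [|lra]; unfold B; apply Rmult_le_pos; trivial.
left; apply Rmult_lt_0_compat; apply Rinv_0_lt_compat, Rmult_lt_0_compat; lra.
Qed.

Lemma quasi_period a b w : Im (Cconj a * b)%C <> 0 -> in_lattice a b w ->
  forall z z', ~ in_lattice a b z -> ~ in_lattice a b z' ->
  (wzeta a b (z + w) - wzeta a b z)%C = (wzeta a b (z' + w) - wzeta a b z')%C.
Proof.
intros HD Hw; pattern w; revert w Hw; apply lattice_ind.
- intros; now apply quasi_period_generator.
- intros z z' Hz Hz'; rewrite <- !(wzeta_swap a b) by trivial.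
  apply quasi_period_generator; [now apply lattice_swap_nondegenerate| |];
   now rewrite in_lattice_swap.
- intros w w' Hw Hw' H H' z z' Hz Hz'.
  pose proof (H z z' Hz Hz') as H1.
  pose proof (H' (z + w)%C (z' + w)%C (not_in_lattice_shift _ _ _ _ Hw Hz)
    (not_in_lattice_shift _ _ _ _ Hw Hz')) as H2.
  rewrite !Cplus_assoc.
  replace (wzeta a b (z + w + w') - wzeta a b z)%C with
    ((wzeta a b (z + w + w') - wzeta a b (z + w)) + (wzeta a b (z + w) - wzeta a b z))%C by ring.
  rewrite H1, H2; ring.
- intros w Hw H z z' Hz Hz'; pose proof (in_lattice_opp _ _ _ Hw) as Ho.
  pose proof (H (z + - w)%C (z' + - w)%C (not_in_lattice_shift _ _ _ _ Ho Hz)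
    (not_in_lattice_shift _ _ _ _ Ho Hz')) as H1.
  replace (z + - w + w)%C with z in H1 by ring; replace (z' + - w + w)%C with z' in H1 by ring.
  transitivity (- (wzeta a b z - wzeta a b (z + - w)))%C; [ring|rewrite H1; ring].
Qed.

Lemma wzeta_real_period a b w1 z n : Im (Cconj a * b)%C <> 0 ->
  in_lattice a b (RtoC (2 * w1)) -> ~ in_lattice a b (RtoC w1) -> ~ in_lattice a b z ->
  (wzeta a b (z + RtoC (2 * INR n * w1)) - wzeta a b z)%C =
  (RtoC (2 * INR n) * wzeta a b (RtoC w1))%C.
Proof.
intros HD H2 H1 Hz; induction n as [|n IH].
- simpl INR; rewrite Rmult_0_r, Rmult_0_l, Cplus_0_r; ring.
- assert (Hn : in_lattice a b (RtoC (2 * INR n * w1))).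
  { destruct H2 as [k Hk]; exists (Z.of_nat n * fst k, Z.of_nat n * snd k)%Z.
    transitivity (RtoC (INR n) * RtoC (2 * w1))%C; [rewrite <- RtoC_mult; f_equal; ring|].
    rewrite Hk; unfold latpt; cbn [fst snd].
    rewrite !mult_IZR, <- !INR_IZR_INZ, !RtoC_mult; ring. }
  set (y := (z + RtoC (2 * INR n * w1))%C) in *.
  assert (Hy : ~ in_lattice a b y) by now apply not_in_lattice_shift.
  assert (Hm : ~ in_lattice a b (- RtoC w1)%C).
  { intros H; apply H1; replace (RtoC w1) with (- - RtoC w1)%C by ring; now apply in_lattice_opp. }
  (* At the base point - w1 the increment is zeta(w1) - zeta(- w1), which oddness turns into 2
     eta1. *)
  pose proof (quasi_period a b _ HD H2 y (- RtoC w1)%C Hy Hm) as Hq.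
  replace (- RtoC w1 + RtoC (2 * w1))%C with (RtoC w1) in Hq by (rewrite RtoC_mult; ring).
  rewrite (wzeta_odd a b _ HD) in Hq.
  replace (z + RtoC (2 * INR (S n) * w1))%C with (y + RtoC (2 * w1))%C
    by (unfold y; rewrite S_INR, <- Cplus_assoc, <- RtoC_plus; do 2 f_equal; ring).
  replace (wzeta a b (y + RtoC (2 * w1)) - wzeta a b z)%C with
    ((wzeta a b (y + RtoC (2 * w1)) - wzeta a b y) + (wzeta a b y - wzeta a b z))%C by ring.
  rewrite Hq, IH, S_INR, !RtoC_mult, RtoC_plus; ring.
Qed.

(** * Quasi-periods of sigma *)

Lemma Cexp_plus z w : Cexp (z + w)%C = (Cexp z * Cexp w)%C.
Proof.
unfold Cexp; components; rewrite exp_plus, cos_plus, sin_plus; f_equal; ring.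
Qed.

Lemma Cexp_0 : Cexp (RtoC 0) = RtoC 1.
Proof. unfold Cexp; components; rewrite exp_0, cos_0, sin_0; f_equal; ring. Qed.

Lemma Cexp_opp z : (Cexp z * Cexp (- z))%C = RtoC 1.
Proof. rewrite <- Cexp_plus, <- Cexp_0; f_equal; ring. Qed.

Lemma Cexp_neq_0 z : Cexp z <> RtoC 0.
Proof.
intros E; pose proof (Cexp_opp z) as H; rewrite E, Cmult_0_l in H.
now apply (RtoC_inj 0 1) in H; apply R1_neq_R0.
Qed.

Lemma Cexp_opp_inv z : Cexp (- z)%C = (/ Cexp z)%C.
Proof.
pose proof (Cexp_neq_0 z); replace (Cexp (- z)) with (/ Cexp z * (Cexp z * Cexp (- z)))%C
  by (field; trivial).
rewrite Cexp_opp; ring.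
Qed.

Lemma Cexp_eq_1 z : Cexp z = RtoC 1 -> exists k : Z, z = (Ci * RtoC (2 * PI * IZR k))%C.
Proof.
destruct z as [x y]; unfold Cexp, RtoC; components; intros E; injection E as E1 E2.
pose proof (sin2_cos2 y) as H; unfold Rsqr in H.
pose proof (exp_pos x) as Hx.
assert (Ex : exp x = 1).
{ assert (H1 : exp x * exp x = 1).
  { transitivity ((exp x * cos y) ^ 2 + (exp x * sin y) ^ 2); [|rewrite E1, E2; ring].
    transitivity (exp x * exp x * (sin y * sin y + cos y * cos y)); [rewrite H|]; ring. }
  nra. }
assert (x = 0) by (rewrite <- exp_0 in Ex; now apply exp_inv in Ex); subst x.
rewrite exp_0, Rmult_1_l in E1.
assert (Hs : sin (y / 2) = 0).
{ replace y with (2 * (y / 2)) in E1 by field; rewrite cos_2a_sin in E1; nra. }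
apply sin_eq_0_0 in Hs; destruct Hs as [k Hk]; exists k; f_equal; lra.
Qed.

Lemma is_clim_Cexp u z : is_clim u z -> is_clim (fun N => Cexp (u N)) (Cexp z).
Proof.
intros [H1 H2].
assert (He : is_lim_seq (fun N => exp (Re (u N))) (exp (Re z))).
{ apply is_lim_seq_continuous; trivial.
  apply derivable_continuous_pt, derivable_pt_exp. }
assert (Hc : is_lim_seq (fun N => cos (Im (u N))) (cos (Im z))).
{ apply is_lim_seq_continuous; trivial; apply continuity_cos. }
assert (Hs : is_lim_seq (fun N => sin (Im (u N))) (sin (Im z))).
{ apply is_lim_seq_continuous; trivial; apply continuity_sin. }
split; unfold Cexp, Re at 1, Im at 1; cbn [fst snd]; now apply is_lim_seq_mult'.
Qed.

(** Only the tangent inequality is used, once at u and once at - u; the latter bounds exp u above by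
    1 / (1 - u). *)
Lemma exp_quadratic u : Rabs u <= 1 / 2 -> Rabs (exp u - 1 - u) <= 2 * u ^ 2.
Proof.
intros H; apply Rabs_le_between in H.
pose proof (exp_ineq1_le u); pose proof (exp_ineq1_le (- u)) as H1.
assert (H2 : exp u * exp (- u) = 1) by (rewrite <- exp_plus, <- exp_0; f_equal; ring).
pose proof (exp_pos u).
assert (exp u * (1 + - u) <= 1) by (rewrite <- H2; apply Rmult_le_compat_l; lra).
apply Rabs_le; split; nra.
Qed.

Lemma Rabs_sin_le v : Rabs (sin v) <= Rabs v.
Proof.
assert (H : forall t, 0 <= t -> Rabs (sin t) <= t).
{ intros t Ht; destruct (Rle_lt_dec 1 t) as [H1|H1].
  - pose proof (SIN_bound t); apply Rabs_le; lra.
  - destruct (Rle_lt_or_eq_dec 0 t Ht) as [H0|<-].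
    + pose proof (sin_lt_x t H0); pose proof PI2_1; assert (0 < sin t).
      { apply sin_gt_0; lra. }
      rewrite Rabs_pos_eq; lra.
    + rewrite sin_0, Rabs_R0; lra. }
destruct (Rle_lt_dec 0 v) as [Hv|Hv].
- rewrite (Rabs_pos_eq v) by trivial; auto.
- rewrite (Rabs_left v) by trivial; rewrite <- (Ropp_involutive v) at 1; rewrite sin_neg, Rabs_Ropp.
  apply H; lra.
Qed.

Lemma cos_quadratic v : 1 - v ^ 2 / 2 <= cos v <= 1.
Proof.
split; [|apply COS_bound].
replace v with (2 * (v / 2)) at 2 by field; rewrite cos_2a_sin.
pose proof (Rabs_sin_le (v / 2)) as H.
assert (sin (v / 2) ^ 2 <= (v / 2) ^ 2); [|nra].
rewrite <- (pow2_abs (sin _)), <- (pow2_abs (v / 2)); apply pow_incr; split; trivial.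
apply Rabs_pos.
Qed.

Lemma sin_cubic v : Rabs (sin v - v) <= Rabs v * v ^ 2 / 2.
Proof.
destruct (MVT_gen sin 0 v cos) as [c [Hc E]].
- intros x _; auto_derive; trivial; ring.
- intros x _; apply continuity_sin.
- rewrite sin_0 in E; replace (sin v - v) with ((cos c - 1) * v) by lra.
  rewrite Rabs_mult, Rmult_comm; unfold Rdiv; rewrite Rmult_assoc.
  apply Rmult_le_compat_l; [apply Rabs_pos|].
  pose proof (cos_quadratic c).
  assert (c ^ 2 <= v ^ 2).
  { rewrite <- (pow2_abs c), <- (pow2_abs v); apply pow_incr; split; [apply Rabs_pos|].
    unfold Rmin, Rmax in Hc; destruct (Rle_dec 0 v); apply Rabs_le; unfold Rabs; destruct Rcase_abs; lra. }
  apply Rabs_le; lra.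
Qed.

Lemma Cexp_quadratic z : Cmod z <= 1 / 2 -> Cmod (Cexp z - 1 - z)%C <= 6 * Cmod z ^ 2.
Proof.
intros Hz; eapply Rle_trans; [apply Cmod_le_abs|].
pose proof (Rabs_Re_le z); pose proof (Rabs_Im_le z).
assert (E : Cmod z ^ 2 = Re z ^ 2 + Im z ^ 2).
{ unfold Cmod; rewrite pow2_sqrt; [easy|]; apply Rplus_le_le_0_compat; apply pow2_ge_0. }
rewrite E; clear E; destruct z as [u v]; unfold Cexp; components; cbn [Re Im fst snd] in *.
pose proof (exp_quadratic u ltac:(lra)) as H1.
pose proof (cos_quadratic v) as H2; pose proof (sin_cubic v) as H3.
pose proof (Rabs_sin_le v) as H4.
apply Rabs_le_between in H1.
assert (Hu : - (1 / 2) <= u <= 1 / 2) by (apply Rabs_le_between; lra).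
assert (Ha : Rabs (exp u * cos v + - (1) + - u) <= 2 * u ^ 2 + v ^ 2).
{ replace (exp u * cos v + - (1) + - u) with
    ((exp u - 1 - u) * cos v + (1 + u) * (cos v - 1)) by ring.
  eapply Rle_trans; [apply Rabs_triang|]; apply Rplus_le_compat.
  - rewrite Rabs_mult; rewrite <- (Rmult_1_r (2 * u ^ 2)); apply Rmult_le_compat; try apply Rabs_pos.
    + apply Rabs_le; lra.
    + pose proof (COS_bound v); apply Rabs_le; lra.
  - apply Rabs_le; nra. }
assert (Hv : Rabs v <= 1 / 2) by lra.
assert (Hb : Rabs (exp u * sin v + - 0 + - v) <= u ^ 2 * 2 + 3 * v ^ 2).
{ replace (exp u * sin v + - 0 + - v) with ((exp u - 1) * sin v + (sin v - v)) by ring.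
  eapply Rle_trans; [apply Rabs_triang|]; rewrite Rabs_mult.
  assert (He : Rabs (exp u - 1) <= 2 * Rabs u).
  { replace (exp u - 1) with ((exp u - 1 - u) + u) by ring.
    eapply Rle_trans; [apply Rabs_triang|].
    pose proof (exp_quadratic u ltac:(lra)) as H5; rewrite <- (pow2_abs u) in H5.
    pose proof (Rabs_pos u); nra. }
  pose proof (Rabs_pos u); pose proof (Rabs_pos v); pose proof (Rabs_pos (sin v)).
  pose proof (Rabs_pos (exp u - 1)).
  rewrite <- (pow2_abs u); rewrite <- (pow2_abs v) in H3 |- *.
  assert (Rabs (exp u - 1) * Rabs (sin v) <= (2 * Rabs u) * Rabs v) by (apply Rmult_le_compat; trivial).
  assert (Rabs v * Rabs v ^ 2 <= 1 / 2 * Rabs v ^ 2) by (apply Rmult_le_compat_r; [apply pow2_ge_0|lra]).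
  pose proof (pow2_ge_0 (Rabs u - Rabs v)); pose proof (pow2_ge_0 (Rabs v)); pose proof (pow2_ge_0 (Rabs u)).
  lra. }
cbn [fst snd] in *.
eapply Rle_trans; [apply Rplus_le_compat; [exact Ha|exact Hb]|]; nra.
Qed.

Lemma exp_le_linear t : 0 <= t -> t <= 1 / 2 -> exp t - 1 <= 2 * t.
Proof.
intros H0 H; pose proof (exp_quadratic t) as H1; rewrite Rabs_pos_eq in H1 by trivial.
specialize (H1 H); apply Rabs_le_between in H1; nra.
Qed.

(** The deviation of a product from 1 is at most that of the product of the numbers 1 + |f x - 1|,
    and each of these is at most exp e. *)
Lemma bigop_mult_close {T} (f : T -> C) l e : 0 <= e ->
  (forall x, In x l -> Cmod (f x - 1)%C <= e) ->
  Cmod (bigop Cmult (RtoC 1) f l - 1)%C <= exp (INR (length l) * e) - 1.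
Proof.
intros He; induction l as [|x l IH]; intros H.
- unfold bigop; simpl; replace (RtoC 1 - 1)%C with (RtoC 0) by ring.
  rewrite Cmod_0, Rmult_0_l, exp_0; lra.
- assert (E : bigop Cmult (RtoC 1) f (x :: l) = (f x * bigop Cmult (RtoC 1) f l)%C) by reflexivity.
  rewrite E; clear E; set (p := bigop Cmult (RtoC 1) f l) in *.
  specialize (IH (fun y h => H y (or_intror h))); specialize (H x (or_introl eq_refl)).
  replace (f x * p - 1)%C with ((f x - 1) * (p - 1) + ((f x - 1) + (p - 1)))%C by ring.
  eapply Rle_trans; [apply Cmod_triangle|]; rewrite Cmod_mult.
  assert (Cmod (f x - 1 + (p - 1))%C <= Cmod (f x - 1)%C + Cmod (p - 1)%C) by apply Cmod_triangle.
  cbn [length]; rewrite S_INR, Rmult_plus_distr_r, Rmult_1_l, exp_plus.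
  pose proof (Cmod_ge_0 (f x - 1)%C); pose proof (Cmod_ge_0 (p - 1)%C).
  set (X := Cmod (f x - 1)%C) in *; set (Y := Cmod (p - 1)%C) in *.
  set (Z := exp (INR (length l) * e)) in *.
  pose proof (exp_ineq1_le e).
  assert ((1 + Y) * (1 + X) <= Z * exp e); [|lra].
  apply Rmult_le_compat; lra.
Qed.

Lemma Cmod_inv_half z : 1 / 2 <= Cmod z -> Cmod (/ z)%C <= 2.
Proof.
intros H; replace 2 with (/ (1 / 2)) by field; apply Cmod_inv_le; lra.
Qed.

(** The exponential removes the linear term. On the boundary of the box x is of order 1/N, so each
    factor is 1 + O(1/N^2), and a product of 2N + 1 of them still tends to 1. *)
Lemma weierstrass_factor x : Cmod x <= 1 / 8 ->
  Cmod ((1 + x) * Cexp (- x) - 1)%C <= 8 * Cmod x ^ 2.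
Proof.
intros Hx; pose proof (Cexp_quadratic (- x)%C) as H; rewrite Cmod_opp in H.
specialize (H ltac:(lra)).
set (r := (Cexp (- x) - 1 - - x)%C) in *.
replace ((1 + x) * Cexp (- x) - 1)%C with (r + x * r - x * x)%C by (unfold r; ring).
eapply Rle_trans; [apply Cmod_triangle|]; rewrite Cmod_opp.
assert (Cmod (r + x * r)%C <= Cmod r + Cmod x * Cmod r).
{ rewrite <- Cmod_mult; apply Cmod_triangle. }
rewrite Cmod_mult; pose proof (Cmod_ge_0 x); pose proof (Cmod_ge_0 r); nra.
Qed.

(** Numerator and denominator deviate from 1 by at most 8 e^2 each, and the denominator has modulus
    at least 1/2. *)
Lemma weierstrass_quotient x y e : 0 <= e -> e <= 1 / 8 -> Cmod x <= e -> Cmod y <= e ->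
  Cmod ((1 + x) * Cexp (- x) / ((1 + y) * Cexp (- y)) - 1)%C <= 32 * e ^ 2.
Proof.
intros He0 He Hx Hy.
pose proof (weierstrass_factor x ltac:(lra)) as HA.
pose proof (weierstrass_factor y ltac:(lra)) as HB.
set (A := ((1 + x) * Cexp (- x))%C) in *; set (B := ((1 + y) * Cexp (- y))%C) in *.
assert (Hxe : Cmod x ^ 2 <= e ^ 2) by (apply pow_incr; split; trivial; apply Cmod_ge_0).
assert (Hye : Cmod y ^ 2 <= e ^ 2) by (apply pow_incr; split; trivial; apply Cmod_ge_0).
assert (HB2 : 1 / 2 <= Cmod B).
{ pose proof (Cmod_sub_lower (B - 1)%C (- (1))%C) as H.
  rewrite Cmod_opp, Cmod_1 in H; replace (B - 1 - - (1))%C with B in H by ring; nra. }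
assert (B <> RtoC 0) by (intros E; rewrite E, Cmod_0 in HB2; lra).
replace (A / B - 1)%C with (((A - 1) - (B - 1)) * / B)%C by (field; trivial).
rewrite Cmod_mult; pose proof (Cmod_inv_half B HB2).
assert (Cmod (A - 1 - (B - 1))%C <= Cmod (A - 1)%C + Cmod (B - 1)%C).
{ eapply Rle_trans; [apply Cmod_triangle|rewrite Cmod_opp; lra]. }
pose proof (Cmod_ge_0 (A - 1 - (B - 1))%C); pose proof (Cmod_ge_0 (/ B)%C).
nra.
Qed.

Lemma bigop_mult_mult {T} (f g : T -> C) l :
  bigop Cmult (RtoC 1) (fun k => f k * g k)%C l =
  (bigop Cmult (RtoC 1) f l * bigop Cmult (RtoC 1) g l)%C.
Proof. unfold bigop; induction l as [|x l IH]; simpl; [|rewrite IH]; ring. Qed.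

Lemma bigop_mult_Cexp {T} (f : T -> C) l :
  bigop Cmult (RtoC 1) (fun k => Cexp (f k)) l = Cexp (Csum (map f l)).
Proof.
unfold bigop, Csum; induction l as [|x l IH]; simpl; [now rewrite Cexp_0|].
now rewrite IH, Cexp_plus.
Qed.

Lemma bigop_mult_inv {T} (f : T -> C) l : (forall k, f k <> RtoC 0) ->
  bigop Cmult (RtoC 1) (fun k => / f k)%C l = (/ bigop Cmult (RtoC 1) f l)%C /\
  bigop Cmult (RtoC 1) f l <> RtoC 0.
Proof.
intros H; unfold bigop; induction l as [|x l [IH1 IH2]]; simpl.
- split; [field|]; intros E; apply RtoC_inj in E; lra.
- rewrite IH1; split; [field; auto|]; now apply Cmult_neq_0.
Qed.

(** Partial sums of the Eisenstein series of weight two, which does not converge absolutely. They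
    occur in the increments of zeta and in the ratios of sigma alike and are matched at each N, so
    their limit is never taken. *)
Definition inv_square_box a b N : C := Csum (map (fun k => / latpt a b k ^ 2)%C (box N)).

(* Partial products of sigma (z + w) sigma z' / (sigma z sigma (z' + w)); in this
   ratio the factors exp (z / k) of the product for sigma cancel. *)
Definition sigma_ratio a b (z z' w : C) (N : nat) : C :=
  (bigop Cmult (RtoC 1) (fun k =>
     (z + w - latpt a b k) * (z' - latpt a b k)
       / ((z - latpt a b k) * (z' + w - latpt a b k)))%C (box N)
   * Cexp (w * (z - z') * inv_square_box a b N))%C.

Definition sigma_period a b (w : C) : Prop :=
  forall z z', ~ in_lattice a b z -> ~ in_lattice a b z' ->
  is_clim (sigma_ratio a b z z' w) (Cexp ((z - z') * (wzeta a b (z + w) - wzeta a b z))).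

Lemma sigma_ratio_swap a b z z' w N : sigma_ratio b a z z' w N = sigma_ratio a b z z' w N.
Proof.
unfold sigma_ratio, inv_square_box; f_equal.
- rewrite (bigop_box_swap _ _ _ _ Cmult_monoid); apply bigop_ext; intros k _.
  now rewrite !latpt_swap.
- do 2 f_equal.
  change (bigop Cplus (RtoC 0) (fun k => / latpt b a k ^ 2)%C (box N) =
    bigop Cplus (RtoC 0) (fun k => / latpt a b k ^ 2)%C (box N)).
  rewrite (bigop_box_swap _ _ _ _ Cplus_monoid); apply bigop_ext; intros k _.
  now rewrite latpt_swap.
Qed.

Lemma zeta_box_generator a b z N : 
  (zeta_box a b (z + a) N - zeta_box a b z N)%C =
  (Csum (map (fun j => / (z - latpt a b ((- Z.of_nat N - 1)%Z, j))
     - / (z - latpt a b (Z.of_nat N, j)))%C (zrange N)) + a * inv_square_box a b N)%C.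
Proof.
pose proof (box_telescope Cplus (RtoC 0) (fun j p q => / (z - latpt a b (p, j)) - / (z - latpt a b (q, j)))%C
  N Cplus_monoid) as H.
unfold bigop in H; unfold Csum at 1; cbv beta in H; rewrite <- H; [|intros; ring].
change (fold_right Cplus 0%C) with Csum.
unfold inv_square_box; rewrite <- Csum_scal, <- Csum_plus; unfold zeta_box.
transitivity (Csum (map (fun k => zeta_term (z + a) (latpt a b k)) (box N))
  + - (1) * Csum (map (fun k => zeta_term z (latpt a b k)) (box N)))%C; [ring|].
rewrite <- Csum_scal, <- Csum_plus; apply Csum_ext; intros [i j] _; cbn [fst snd].
rewrite latpt_pred; unfold zeta_term, Cdiv.
replace (z - (latpt a b (i, j) - a))%C with (z + a - latpt a b (i, j))%C by ring.
ring.
Qed.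

(** With x = (z - z') / (z' - w) one has 1 + x = (z - w) / (z' - w), so the product telescopes to
    quotients of 1 + x at the two ends of each row. The factor exp(- x) missing there is supplied by
    the boundary part of the zeta increment at z', multiplied by z - z'; what remains is [T]. *)
Lemma sigma_period_generator a b : Im (Cconj a * b)%C <> 0 -> sigma_period a b a.
Proof.
intros HD z z' Hz Hz'.
rewrite (quasi_period_generator a b z z' HD Hz Hz').
set (d := (z - z')%C).
set (T := fun N => Cexp (d * (zeta_box a b (z' + a) N - zeta_box a b z' N))).
assert (HT : is_clim T (Cexp (d * (wzeta a b (z' + a) - wzeta a b z')))).
{ apply is_clim_Cexp, is_clim_scal, is_clim_minus; now apply wzeta_lim. }
set (x := fun k => (d * / (z' - latpt a b k))%C).
set (q := fun (N : nat) (j : Z) => ((1 + x ((- Z.of_nat N - 1)%Z, j)) * Cexp (- x ((- Z.of_nat N - 1)%Z, j))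
  / ((1 + x (Z.of_nat N, j)) * Cexp (- x (Z.of_nat N, j))))%C).
assert (Hx1 : forall k, (1 + x k)%C = ((z - latpt a b k) / (z' - latpt a b k))%C).
{ intros k; unfold x, d; field; now apply not_in_lattice_sub. }
assert (Hx0 : forall k, (1 + x k)%C <> RtoC 0).
{ intros k E; rewrite Hx1 in E.
  apply (not_in_lattice_sub a b z k Hz).
  replace (z - latpt a b k)%C with ((z - latpt a b k) / (z' - latpt a b k) * (z' - latpt a b k))%C
    by (field; now apply not_in_lattice_sub).
  rewrite E; ring. }
assert (Eq : forall N, sigma_ratio a b z z' a N =
  (bigop Cmult (RtoC 1) (q N) (zrange N) * T N)%C).
{ intros N; unfold sigma_ratio, T.
  rewrite zeta_box_generator, Cmult_plus_distr_l, Cexp_plus.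
  rewrite <- Csum_scal, <- bigop_mult_Cexp, Cmult_assoc, <- bigop_mult_mult.
  f_equal; [|f_equal; fold d; ring].
  set (D := fun j p q => ((1 + x (p, j)) / (1 + x (q, j)))%C).
  transitivity (bigop Cmult (RtoC 1) (fun k => D (snd k) (fst k - 1)%Z (fst k)) (box N)).
  - apply bigop_ext; intros [i j] _; unfold D; cbn [fst snd]; rewrite !Hx1, latpt_pred.
    replace (z - (latpt a b (i, j) - a))%C with (z + a - latpt a b (i, j))%C by ring.
    replace (z' - (latpt a b (i, j) - a))%C with (z' + a - latpt a b (i, j))%C by ring.
    field; repeat split; try (now apply not_in_lattice_sub).
    replace (z' + a - latpt a b (i, j))%C with (z' - latpt a b ((i - 1)%Z, j))%C
      by (rewrite latpt_pred; ring).
    now apply not_in_lattice_sub.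
  - rewrite (box_telescope _ _ D _ Cmult_monoid).
    + apply bigop_ext; intros j _; unfold D, q.
      set (X := x ((- Z.of_nat N - 1)%Z, j)); set (Y := x (Z.of_nat N, j)).
      replace (d * (/ (z' - latpt a b ((- Z.of_nat N - 1)%Z, j)) - / (z' - latpt a b (Z.of_nat N, j))))%C
        with (X + - Y)%C by (unfold X, Y, x; ring).
      rewrite Cexp_plus, !Cexp_opp_inv; field; repeat split; try apply Cexp_neq_0; apply Hx0.
    + intros j p r s; unfold D; field; split; apply Hx0. }
apply is_clim_ext with (fun N => bigop Cmult (RtoC 1) (q N) (zrange N) * T N)%C; [now intros; rewrite Eq|].
rewrite <- (Cmult_1_l (Cexp _)); apply is_clim_mult; trivial.
destruct (lattice_gap a b z' HD Hz') as [g [Hg Hgap]].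
set (K := Cmod d / g).
assert (HK : 0 <= K) by (apply Rdiv_le_0_compat; [apply Cmod_ge_0|trivial]).
assert (HxK : forall N k, (N <= supn k)%nat -> Cmod (x k) <= K / (INR N + 1)).
{ intros N k Hk; unfold x; rewrite Cmod_mult.
  pose proof (Cinv_boundary a b z' g N k Hg Hgap Hk) as H.
  pose proof (pos_INR N).
  replace (K / (INR N + 1)) with (Cmod d * / (g * (INR N + 1))) by (unfold K; field; lra).
  apply Rmult_le_compat_l; [apply Cmod_ge_0|trivial]. }
(* The first summand ensures e <= 1/8 for the factors, the second one keeps the total exponent below
   1/2, where exp t - 1 <= 2 t. *)
destruct (nat_above (8 * K + 256 * K ^ 2)) as [N0 HN0].
apply is_clim_rate with (128 * K ^ 2) N0; intros N HN.
apply le_INR in HN; pose proof (pos_INR N) as HNp.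
pose proof (pow2_ge_0 K) as HK2.
set (e := K / (INR N + 1)) in *.
assert (He0 : 0 <= e) by (apply Rdiv_le_0_compat; lra).
assert (EK : K = e * (INR N + 1)) by (unfold e; field; lra).
assert (He : e <= 1 / 8).
{ apply (Rmult_le_reg_r (INR N + 1)); [lra|]; rewrite <- EK; lra. }
assert (Hlen : INR (length (zrange N)) * (32 * e ^ 2) <= 64 * K ^ 2 / (INR N + 1)).
{ rewrite length_zrange, plus_INR, mult_INR; simpl (INR 2); simpl (INR 1).
  replace (64 * K ^ 2 / (INR N + 1)) with (2 * (INR N + 1) * (32 * e ^ 2)).
  - apply Rmult_le_compat_r; [nra|lra].
  - rewrite EK at 1; field; lra. }
assert (Hhalf : 64 * K ^ 2 / (INR N + 1) <= 1 / 2).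
{ apply (Rmult_le_reg_r (INR N + 1)); [lra|].
  replace (64 * K ^ 2 / (INR N + 1) * (INR N + 1)) with (64 * K ^ 2) by (field; lra); lra. }
eapply Rle_trans.
{ apply (bigop_mult_close _ _ (32 * e ^ 2)); [nra|].
  intros j _; destruct (supn_boundary N j) as [H1 H2].
  apply weierstrass_quotient; trivial; now apply HxK. }
eapply Rle_trans; [apply exp_le_linear; [apply Rmult_le_pos; [apply pos_INR|nra]|lra]|].
replace (128 * K ^ 2 / (INR N + 1)) with (2 * (64 * K ^ 2 / (INR N + 1))) by (field; lra); lra.
Qed.

(** The ratios satisfy a cocycle relation for each N: the ratio for w + w' is the ratio for w times
    the ratio for w' at the shifted points, and - w gives an inverse. The exponents satisfy the same
    relation. *)
Lemma sigma_period_lattice a b w : Im (Cconj a * b)%C <> 0 ->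
  in_lattice a b w -> sigma_period a b w.
Proof.
intros HD Hw; pattern w; revert w Hw; apply lattice_ind.
- now apply sigma_period_generator.
- intros z z' Hz Hz'.
  apply is_clim_ext with (sigma_ratio b a z z' b); [intros; apply sigma_ratio_swap|].
  rewrite <- !(wzeta_swap a b) by trivial.
  apply sigma_period_generator; [now apply lattice_swap_nondegenerate| |];
   now rewrite in_lattice_swap.
- intros w w' Hw Hw' H H' z z' Hz Hz'.
  pose proof (not_in_lattice_shift _ _ _ _ Hw Hz) as Hzw.
  pose proof (not_in_lattice_shift _ _ _ _ Hw Hz') as Hzw'.
  pose proof (not_in_lattice_shift _ _ _ _ Hw' Hzw') as Hzww'.
  apply is_clim_ext with (fun N => sigma_ratio a b (z + w) (z' + w) w' N * sigma_ratio a b z z' w N)%C.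
  + intros N; unfold sigma_ratio.
    match goal with |- (?p * ?e * (?p' * ?e'))%C = _ =>
      transitivity ((p * p') * (e * e'))%C; [ring|] end.
    rewrite <- bigop_mult_mult, <- Cexp_plus; f_equal; [|f_equal; ring].
    apply bigop_ext; intros k _; rewrite !Cplus_assoc.
    field; repeat split; now apply not_in_lattice_sub.
  + replace ((z - z') * (wzeta a b (z + (w + w')) - wzeta a b z))%C with
      ((z + w - (z' + w)) * (wzeta a b (z + w + w') - wzeta a b (z + w))
        + (z - z') * (wzeta a b (z + w) - wzeta a b z))%C by (rewrite !Cplus_assoc; ring).
    rewrite Cexp_plus; apply is_clim_mult; auto.
- intros w Hw H z z' Hz Hz'; pose proof (in_lattice_opp _ _ _ Hw) as Ho.
  pose proof (not_in_lattice_shift _ _ _ _ Ho Hz) as Hzw.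
  pose proof (not_in_lattice_shift _ _ _ _ Ho Hz') as Hzw'.
  apply is_clim_ext with (fun N => / sigma_ratio a b (z + - w) (z' + - w) w N)%C.
  + intros N; unfold sigma_ratio.
    assert (Hn : forall k, ((z + - w + w - latpt a b k) * (z' + - w - latpt a b k)
       / ((z + - w - latpt a b k) * (z' + - w + w - latpt a b k)))%C <> RtoC 0).
    { intros k; replace (z + - w + w)%C with z by ring; replace (z' + - w + w)%C with z' by ring.
      unfold Cdiv; apply Cmult_neq_0; [apply Cmult_neq_0; now apply not_in_lattice_sub|].
      intros E; apply (Cmult_neq_0 (z + - w - latpt a b k) (z' - latpt a b k));
        try now apply not_in_lattice_sub.
      set (p := ((z + - w - latpt a b k) * (z' - latpt a b k))%C) in *.
      destruct (Ceq_dec p (RtoC 0)) as [e|n]; [trivial|].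
      exfalso; apply R1_neq_R0, RtoC_inj; rewrite <- (Cinv_r p n), E; ring. }
    destruct (bigop_mult_inv _ (box N) Hn) as [E1 E2].
    match goal with |- (/ (?p * ?e))%C = _ =>
      replace (/ (p * e))%C with (/ p * / e)%C by (field; split; [apply Cexp_neq_0|exact E2]) end.
    rewrite <- E1, <- Cexp_opp_inv.
    f_equal; [|f_equal; ring].
    apply bigop_ext; intros k _.
    replace (z + - w + w)%C with z by ring; replace (z' + - w + w)%C with z' by ring.
    field; repeat split; now apply not_in_lattice_sub.
  + replace ((z - z') * (wzeta a b (z + - w) - wzeta a b z))%C with
      (- ((z + - w - (z' + - w)) * (wzeta a b (z + - w + w) - wzeta a b (z + - w))))%C
      by (replace (z + - w + w)%C with z by ring; ring).
    rewrite Cexp_opp_inv; apply is_clim_inv; [apply Cexp_neq_0|]; now apply H.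
Qed.

(** * Integrals of zeta along a horizontal line *)

Lemma is_derive_value (f : R -> R) (s d d' : R) : is_derive f s d -> d = d' -> is_derive f s d'.
Proof. now intros H <-. Qed.

Lemma is_derive_Rext (f g : R -> R) (s d : R) :
  (forall t, f t = g t) -> is_derive f s d -> is_derive g s d.
Proof. intros H; apply is_derive_ext; exact H. Qed.

Lemma is_derive_Rmult (f g : R -> R) (s df dg : R) : is_derive f s df -> is_derive g s dg ->
  is_derive (fun t => f t * g t) s (df * g s + f s * dg).
Proof. intros Hf Hg; apply (is_derive_mult f g s df dg); trivial; intros; apply Rmult_comm. Qed.

Lemma is_derive_Rplus (f g : R -> R) (s df dg : R) : is_derive f s df -> is_derive g s dg ->
  is_derive (fun t => f t + g t) s (df + dg).
Proof. intros Hf Hg; now apply (is_derive_plus f g s df dg). Qed.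

Lemma is_derive_Rminus (f g : R -> R) (s df dg : R) : is_derive f s df -> is_derive g s dg ->
  is_derive (fun t => f t - g t) s (df - dg).
Proof. intros Hf Hg; now apply (is_derive_minus f g s df dg). Qed.

Lemma is_derive_Rconst (c s : R) : is_derive (fun _ => c) s 0.
Proof. exact (is_derive_const (K := R_AbsRing) (V := R_NormedModule) c s). Qed.

Lemma is_derive_Rid (s : R) : is_derive (fun t => t) s 1.
Proof. exact (is_derive_id s). Qed.

Lemma is_derive_taylor (f : R -> R) x l d K : 0 < d ->
  (forall h, Rabs h < d -> Rabs (f (x + h) - f x - h * l) <= K * h ^ 2) -> is_derive f x l.
Proof.
intros Hd H; apply is_derive_Reals; intros eps Heps.
set (K' := Rabs K + 1); assert (HK : 0 < K') by (unfold K'; pose proof (Rabs_pos K); lra).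
assert (Hm : 0 < Rmin d (eps / K')) by (apply Rmin_glb_lt; [trivial|now apply Rdiv_lt_0_compat]).
exists (mkposreal _ Hm); intros h Hh Hlt; simpl in Hlt.
pose proof (Rmin_l d (eps / K')); pose proof (Rmin_r d (eps / K')).
specialize (H h ltac:(lra)).
replace ((f (x + h) - f x) / h - l) with ((f (x + h) - f x - h * l) / h) by (field; trivial).
unfold Rdiv; rewrite Rabs_mult, Rabs_inv.
assert (Hp : 0 < Rabs h) by now apply Rabs_pos_lt.
apply (Rmult_lt_reg_r (Rabs h)); trivial.
replace (Rabs (f (x + h) - f x - h * l) * / Rabs h * Rabs h)
  with (Rabs (f (x + h) - f x - h * l)) by (field; lra).
eapply Rle_lt_trans; [exact H|].
rewrite <- (pow2_abs h).
assert (Hk : K <= K') by (unfold K'; pose proof (Rle_abs K); lra).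
assert (He : Rabs h * K' < eps).
{ replace eps with (eps / K' * K') by (field; lra); apply Rmult_lt_compat_r; lra. }
nra.
Qed.

(** * Complex-valued functions of a real variable *)

Definition cderiv (g : R -> C) (s : R) (d : C) : Prop :=
  is_derive (fun t => Re (g t)) s (Re d) /\ is_derive (fun t => Im (g t)) s (Im d).

Lemma cderiv_value g s d d' : cderiv g s d -> d = d' -> cderiv g s d'.
Proof. now intros H <-. Qed.

Lemma cderiv_ext f g s d : (forall t, f t = g t) -> cderiv f s d -> cderiv g s d.
Proof.
intros E [H1 H2]; split; (eapply is_derive_ext; [|eassumption]); intros t; simpl; now rewrite E.
Qed.

Lemma cderiv_const c s : cderiv (fun _ => c) s (RtoC 0).
Proof.
split; apply is_derive_Rconst.
Qed.

Lemma cderiv_id s : cderiv RtoC s (RtoC 1).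
Proof.
split; [apply (is_derive_Rid s)|apply (is_derive_Rconst 0)].
Qed.

Lemma cderiv_plus f g s df dg : cderiv f s df -> cderiv g s dg ->
  cderiv (fun t => f t + g t)%C s (df + dg)%C.
Proof. intros [H1 H2] [H3 H4]; split; now apply is_derive_Rplus. Qed.

Lemma cderiv_mult f g s df dg : cderiv f s df -> cderiv g s dg ->
  cderiv (fun t => f t * g t)%C s (df * g s + f s * dg)%C.
Proof.
intros [H1 H2] [H3 H4]; split.
- eapply is_derive_value.
  + apply (is_derive_Rminus (fun t => Re (f t) * Re (g t)) (fun t => Im (f t) * Im (g t)));
     apply is_derive_Rmult; eassumption.
  + components; ring.
- eapply is_derive_value.
  + apply (is_derive_Rplus (fun t => Re (f t) * Im (g t)) (fun t => Im (f t) * Re (g t)));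
     apply is_derive_Rmult; eassumption.
  + components; ring.
Qed.

Lemma cderiv_scal c f s df : cderiv f s df -> cderiv (fun t => c * f t)%C s (c * df)%C.
Proof.
intros H; eapply cderiv_value; [apply cderiv_mult; [apply cderiv_const|exact H]|cbv beta; ring].
Qed.

Lemma cderiv_opp f s df : cderiv f s df -> cderiv (fun t => - f t)%C s (- df)%C.
Proof.
intros H; apply cderiv_ext with (fun t => - (1) * f t)%C; [intros; ring|].
eapply cderiv_value; [exact (cderiv_scal _ _ _ _ H)|ring].
Qed.

Lemma cderiv_minus f g s df dg : cderiv f s df -> cderiv g s dg ->
  cderiv (fun t => f t - g t)%C s (df - dg)%C.
Proof. intros H1 H2; apply cderiv_plus; trivial; now apply cderiv_opp. Qed.

Lemma Cnorm2_neq_0 z : z <> RtoC 0 -> fst z ^ 2 + snd z ^ 2 <> 0.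
Proof.
intros Hz E; apply Hz; destruct z as [x y]; simpl in E; unfold RtoC; f_equal; nra.
Qed.

Lemma cderiv_inv f s df : f s <> RtoC 0 -> cderiv f s df ->
  cderiv (fun t => / f t)%C s (- df / (f s * f s))%C.
Proof.
intros Hf [H1 H2]; pose proof (Cnorm2_neq_0 _ Hf) as Hn.
assert (Hd : is_derive (fun t => Re (f t) ^ 2 + Im (f t) ^ 2) s
  (2 * Re (f s) * Re df + 2 * Im (f s) * Im df)).
{ eapply is_derive_ext; [|eapply is_derive_value; [apply is_derive_Rplus;
    [apply is_derive_Rmult; exact H1|apply is_derive_Rmult; exact H2]|]].
  - intros t; simpl; ring.
  - simpl; ring. }
assert (Hff : (f s * f s)%C <> RtoC 0) by now apply Cmult_neq_0.
assert (E : (- df / (f s * f s))%C = (- df * (/ f s * / f s))%C) by (field; trivial).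
rewrite E; unfold Re, Im in *.
assert (Hi : is_derive (fun t => / (fst (f t) ^ 2 + snd (f t) ^ 2)) s
  (- (2 * fst (f s) * fst df + 2 * snd (f s) * snd df) / (fst (f s) ^ 2 + snd (f s) ^ 2) ^ 2)).
{ apply (is_derive_inv (fun t => fst (f t) ^ 2 + snd (f t) ^ 2)); trivial. }
split.
- eapply is_derive_value; [exact (is_derive_Rmult _ _ _ _ _ H1 Hi)|].
  components; unfold Cinv; cbn [fst snd]; field; trivial.
- eapply is_derive_value.
  + apply (is_derive_Rmult (fun t => - snd (f t)) _ s (- snd df)); [|exact Hi].
    apply (is_derive_opp (fun t => snd (f t))); exact H2.
  + components; unfold Cinv; cbn [fst snd]; field; trivial.
Qed.

Lemma cderiv_Cexp f s df : cderiv f s df ->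
  cderiv (fun t => Cexp (f t)) s (df * Cexp (f s))%C.
Proof.
intros [H1 H2].
assert (He : is_derive (fun t => exp (Re (f t))) s (Re df * exp (Re (f s)))).
{ apply (is_derive_comp exp (fun t => Re (f t))); trivial; apply is_derive_exp. }
assert (Hc : is_derive (fun t => cos (Im (f t))) s (Im df * - sin (Im (f s)))).
{ apply (is_derive_comp cos (fun t => Im (f t))); trivial; apply is_derive_cos. }
assert (Hs : is_derive (fun t => sin (Im (f t))) s (Im df * cos (Im (f s)))).
{ apply (is_derive_comp sin (fun t => Im (f t))); trivial; apply is_derive_sin. }
split; unfold Cexp.
- eapply is_derive_value; [exact (is_derive_Rmult _ _ _ _ _ He Hc)|components; ring].
- eapply is_derive_value; [exact (is_derive_Rmult _ _ _ _ _ He Hs)|components; ring].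
Qed.

Lemma is_derive_0_const (f : R -> R) : (forall t, is_derive f t 0) -> forall s t, f s = f t.
Proof.
intros H s t; destruct (MVT_gen f t s (fun _ => 0)) as [c [_ E]]; [auto| |lra].
intros x _; apply continuity_pt_filterlim, @ex_derive_continuous; now exists 0.
Qed.

Lemma cderiv_0_const (f : R -> C) : (forall t, cderiv f t (RtoC 0)) -> forall s t, f s = f t.
Proof.
intros H s t; rewrite (surjective_pairing (f s)), (surjective_pairing (f t)); f_equal.
- apply (is_derive_0_const (fun t => Re (f t))); intros u; apply H.
- apply (is_derive_0_const (fun t => Im (f t))); intros u; apply H.
Qed.

(** A substitute for the logarithm of g that needs no branch: the product of g and exp(- Phi) has
    derivative zero. *)
Lemma cderiv_logarithmic (g phi Phi : R -> C) :
  (forall s, cderiv g s (phi s * g s)%C) -> (forall s, cderiv Phi s (phi s)) ->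
  forall s t, g t = (g s * Cexp (Phi t - Phi s))%C.
Proof.
intros Hg HPhi s t.
assert (H : forall t, cderiv (fun t => g t * Cexp (- Phi t))%C t (RtoC 0)).
{ intros u; eapply cderiv_value.
  - apply cderiv_mult; [apply Hg|]; apply cderiv_Cexp, cderiv_opp, HPhi.
  - cbv beta; ring. }
pose proof (cderiv_0_const _ H t s) as E; cbv beta in E.
replace (Phi t - Phi s)%C with (- Phi s + - - Phi t)%C by ring.
rewrite Cexp_plus, Cmult_assoc, <- E, <- Cmult_assoc, Cexp_opp; ring.
Qed.

Lemma cderiv_continuous f s d : cderiv f s d ->
  continuous (fun t => Re (f t)) s /\ continuous (fun t => Im (f t)) s.
Proof.
intros [H1 H2]; split; apply (ex_derive_continuous (V := R_NormedModule)).
- now exists (Re d).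
- now exists (Im d).
Qed.

Lemma is_derive_primitive (f : R -> R) : (forall s, continuous f s) ->
  forall s, is_derive (fun t => RInt f 0 t) s (f s).
Proof.
intros H s; apply (is_derive_RInt f _ 0); [|apply H].
apply filter_forall; intros t; apply (@RInt_correct R_CompleteNormedModule), @ex_RInt_continuous; intros; apply H.
Qed.

Lemma cderiv_primitive (phi : R -> C) :
  (forall s, continuous (fun t => Re (phi t)) s) ->
  (forall s, continuous (fun t => Im (phi t)) s) ->
  exists Phi, forall s, cderiv Phi s (phi s).
Proof.
intros H1 H2.
exists (fun s => (RInt (fun t => Re (phi t)) 0 s, RInt (fun t => Im (phi t)) 0 s)); intros s; split.
- now apply (is_derive_primitive (fun t => Re (phi t))).
- now apply (is_derive_primitive (fun t => Im (phi t))).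
Qed.

(** There is no mean value theorem for complex values, so the two components are estimated
    separately; hence the factor 2. *)
Lemma cderiv_bound (f : R -> C) (df : R -> C) K t : (forall s, cderiv f s (df s)) ->
  (forall s, Rabs s <= Rabs t -> Cmod (df s) <= K) -> Cmod (f t - f 0)%C <= 2 * K * Rabs t.
Proof.
intros Hf Hb; eapply Rle_trans; [apply Cmod_le_abs|].
assert (H : forall p : C -> R, (forall z, Rabs (p z) <= Cmod z) ->
  (forall s, is_derive (fun u => p (f u)) s (p (df s))) ->
  Rabs (p (f t) - p (f 0)) <= K * Rabs t).
{ intros p Hp Hd; replace (Rabs t) with (Rabs (t - 0)) by (f_equal; ring).
  apply (bounded_variation (fun u => p (f u)) (fun u => p (df u))).
  intros u Hu; split; [apply Hd|].
  eapply Rle_trans; [apply Hp|apply Hb]; now rewrite !Rminus_0_r in Hu. }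
pose proof (H Re Rabs_Re_le (fun s => proj1 (Hf s))).
pose proof (H Im Rabs_Im_le (fun s => proj2 (Hf s))).
replace (Re (f t - f 0)%C) with (Re (f t) - Re (f 0)) by (components; ring).
replace (Im (f t - f 0)%C) with (Im (f t) - Im (f 0)) by (components; ring).
lra.
Qed.

Lemma cderiv_Csum {T} (f : T -> R -> C) (df : T -> C) l s :
  (forall k, cderiv (f k) s (df k)) ->
  cderiv (fun t => Csum (map (fun k => f k t) l)) s (Csum (map df l)).
Proof.
intros H; unfold Csum; induction l as [|k l IH]; simpl; [apply cderiv_const|].
now apply cderiv_plus.
Qed.

Lemma cderiv_bigop_mult {T} (f : T -> R -> C) (phi : T -> C) l s :
  (forall k, cderiv (f k) s (phi k * f k s)%C) ->
  cderiv (fun t => bigop Cmult (RtoC 1) (fun k => f k t) l) s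
    (Csum (map phi l) * bigop Cmult (RtoC 1) (fun k => f k s) l)%C.
Proof.
intros H; unfold bigop, Csum; induction l as [|k l IH]; cbn [map fold_right].
- eapply cderiv_value; [apply cderiv_const|symmetry; apply Cmult_0_l].
- eapply cderiv_value; [apply cderiv_mult; [apply H|exact IH]|cbv beta; ring].
Qed.

Lemma wzeta_line_cderiv a b x0 s : Im (Cconj a * b)%C <> 0 ->
  ~ in_lattice a b (RtoC s + x0)%C ->
  cderiv (fun t => wzeta a b (RtoC t + x0)%C) s (- wp a b (RtoC s + x0))%C.
Proof.
intros HD Hz; destruct (wzeta_taylor a b _ HD Hz) as [d [K [Hd H]]].
assert (Hh : forall h, Rabs h < d ->
  Cmod (wzeta a b (RtoC (s + h) + x0) - wzeta a b (RtoC s + x0) - RtoC h * - wp a b (RtoC s + x0))%C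
    <= K * h ^ 2).
{ intros h Hh; specialize (H (RtoC h)); rewrite Cmod_R, pow2_abs in H.
  replace (RtoC (s + h) + x0)%C with (RtoC s + x0 + RtoC h)%C by (rewrite RtoC_plus; ring).
  replace (wzeta a b (RtoC s + x0 + RtoC h) - wzeta a b (RtoC s + x0) - RtoC h * - wp a b (RtoC s + x0))%C
    with (wzeta a b (RtoC s + x0 + RtoC h) - wzeta a b (RtoC s + x0) + RtoC h * wp a b (RtoC s + x0))%C by ring.
  auto. }
split; apply is_derive_taylor with d K; trivial; intros h Hlt;
 (eapply Rle_trans; [|exact (Hh h Hlt)]).
- eapply Rle_trans; [|apply Rabs_Re_le]; right; f_equal; components; ring.
- eapply Rle_trans; [|apply Rabs_Im_le]; right; f_equal; components; ring.
Qed.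

Lemma cderiv_inv_shift c s : (RtoC s - c)%C <> RtoC 0 ->
  cderiv (fun t => / (RtoC t - c))%C s (- / ((RtoC s - c) * (RtoC s - c)))%C.
Proof.
intros H; eapply cderiv_value.
- apply (cderiv_inv (fun t => RtoC t - c)%C); trivial.
  apply cderiv_minus; [apply cderiv_id|apply cderiv_const].
- field; trivial.
Qed.

(** [W] plays the role of log (sigma(s + x0) / sigma(s - x0)). The partial sums of zeta integrate to
    logarithms of finite products, whose increment over the period is the ratio with z = x0, z' = -
    x0 and w = L. The exponential of W L - W 0 is thus the limit known from the law of sigma, and
    the exponents agree up to a multiple of 2 pi i. *)
Lemma wzeta_line_integral a b x0 L (W : R -> C) : Im (Cconj a * b)%C <> 0 ->
  in_lattice a b (RtoC L) -> (forall s, ~ in_lattice a b (RtoC s + x0)%C) ->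
  (forall s, cderiv W s (wzeta a b (RtoC s + x0) - wzeta a b (RtoC s - x0))%C) ->
  exists k : Z, (W L - W 0)%C =
    (RtoC 2 * x0 * (wzeta a b (x0 + RtoC L) - wzeta a b x0) + Ci * RtoC (2 * PI * IZR k))%C.
Proof.
intros HD HL Hp HZ.
assert (Hm : forall s, ~ in_lattice a b (RtoC s - x0)%C).
{ intros s H; apply (Hp (- s)); replace (RtoC (- s) + x0)%C with (- (RtoC s - x0))%C
    by (rewrite RtoC_opp; ring); now apply in_lattice_opp. }
assert (Hp0 : ~ in_lattice a b x0) by (rewrite <- (Cplus_0_l x0); apply Hp).
assert (Hm0 : ~ in_lattice a b (- x0)%C).
{ replace (- x0)%C with (RtoC 0 - x0)%C by ring; apply Hm. }
assert (Hp' : forall s k, (RtoC s - (latpt a b k - x0))%C <> RtoC 0).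
{ intros s k; replace (RtoC s - (latpt a b k - x0))%C with (RtoC s + x0 - latpt a b k)%C by ring.
  now apply not_in_lattice_sub. }
assert (Hm' : forall s k, (RtoC s - (latpt a b k + x0))%C <> RtoC 0).
{ intros s k; replace (RtoC s - (latpt a b k + x0))%C with (RtoC s - x0 - latpt a b k)%C by ring.
  now apply not_in_lattice_sub. }
set (psi := fun N s => (zeta_box a b (RtoC s + x0) N - zeta_box a b (RtoC s - x0) N)%C).
(* In the difference of two zeta terms the corrections 1 / w cancel, and the terms z / w^2 leave the
   constant 2 x0 / w^2. *)
set (v := fun s k => (/ (RtoC s - (latpt a b k - x0)) - / (RtoC s - (latpt a b k + x0)))%C).
assert (Epsi : forall N s, psi N s = (Csum (map (v s) (box N)) + RtoC 2 * x0 * inv_square_box a b N)%C).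
{ intros N s; unfold psi, inv_square_box, zeta_box; rewrite <- Csum_scal, <- Csum_plus.
  transitivity (Csum (map (fun k => zeta_term (RtoC s + x0) (latpt a b k)) (box N))
    + - (1) * Csum (map (fun k => zeta_term (RtoC s - x0) (latpt a b k)) (box N)))%C; [ring|].
  rewrite <- Csum_scal, <- Csum_plus; apply Csum_ext; intros k _; unfold v, zeta_term, Cdiv.
  replace (RtoC s - (latpt a b k - x0))%C with (RtoC s + x0 - latpt a b k)%C by ring.
  replace (RtoC s - (latpt a b k + x0))%C with (RtoC s - x0 - latpt a b k)%C by ring.
  ring. }
assert (Hv : forall N s, exists d, cderiv (fun t => Csum (map (v t) (box N))) s d).
{ intros N s; eexists; apply (cderiv_Csum (fun k t => v t k)); intros k; unfold v.
  apply cderiv_minus; now apply cderiv_inv_shift. }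
assert (HP : forall N, exists P, forall s, cderiv P s (Csum (map (v s) (box N)))).
{ intros N; apply cderiv_primitive; intros s; destruct (Hv N s) as [d Hd];
   apply (cderiv_continuous _ _ _ Hd). }
assert (HG : forall N P, (forall s, cderiv P s (Csum (map (v s) (box N)))) ->
  Cexp (P L - P 0 + RtoC L * (RtoC 2 * x0 * inv_square_box a b N))%C
    = sigma_ratio a b x0 (- x0)%C (RtoC L) N).
{ intros N P HPN.
  set (g := fun k t => ((RtoC t - (latpt a b k - x0)) * / (RtoC t - (latpt a b k + x0)))%C).
  assert (Hg : forall k s, cderiv (g k) s (v s k * g k s)%C).
  { intros k s; eapply cderiv_value.
    - apply cderiv_mult; [|now apply cderiv_inv_shift].
      apply cderiv_minus; [apply cderiv_id|apply cderiv_const].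
    - unfold g, v; cbv beta; field; split; auto. }
  pose proof (cderiv_logarithmic _ _ _
    (fun s => cderiv_bigop_mult (fun k => g k) (v s) (box N) s (fun k => Hg k s)) HPN 0 L) as E.
  cbv beta in E.
  assert (Hg0 : forall k, g k 0 <> RtoC 0).
  { intros k; unfold g; intros E0; apply (Hp' 0 k).
    replace (RtoC 0 - (latpt a b k - x0))%C with
      ((RtoC 0 - (latpt a b k - x0)) * / (RtoC 0 - (latpt a b k + x0)) * (RtoC 0 - (latpt a b k + x0)))%C
      by (rewrite <- Cmult_assoc, (Cinv_l _ (Hm' 0 k)); ring).
    rewrite E0; ring. }
  destruct (bigop_mult_inv (fun k => g k 0) (box N) Hg0) as [E1 E2].
  assert (E3 : Cexp (P L - P 0)%C =
    (/ bigop Cmult (RtoC 1) (fun k => g k 0) (box N) * bigop Cmult (RtoC 1) (fun k => g k L) (box N))%C).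
  { rewrite E; field; exact E2. }
  rewrite Cexp_plus, E3, <- E1, <- bigop_mult_mult; unfold sigma_ratio; f_equal; [|f_equal; ring].
  apply bigop_ext; intros k _; unfold g.
  assert (A1 := not_in_lattice_sub a b x0 k Hp0).
  assert (A2 := not_in_lattice_sub a b (- x0)%C k Hm0).
  assert (A3 := not_in_lattice_sub a b (RtoC L - x0)%C k (Hm L)).
  assert (A4 := not_in_lattice_sub a b (RtoC L + x0)%C k (Hp L)).
  replace (RtoC 0 - (latpt a b k - x0))%C with (x0 - latpt a b k)%C by ring.
  replace (RtoC 0 - (latpt a b k + x0))%C with (- x0 - latpt a b k)%C by ring.
  replace (RtoC L - (latpt a b k - x0))%C with (RtoC L + x0 - latpt a b k)%C by ring.
  replace (RtoC L - (latpt a b k + x0))%C with (RtoC L - x0 - latpt a b k)%C by ring.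
  replace (x0 + RtoC L - latpt a b k)%C with (RtoC L + x0 - latpt a b k)%C by ring.
  replace (- x0 + RtoC L - latpt a b k)%C with (RtoC L - x0 - latpt a b k)%C by ring.
  field; repeat split; trivial. }
destruct (wzeta_box a b (Rabs L + Cmod x0) HD) as [A [M0 HA]].
{ pose proof (Rabs_pos L); pose proof (Cmod_ge_0 x0); lra. }
set (Y := (W L - W 0)%C).
assert (HY : is_clim (sigma_ratio a b x0 (- x0)%C (RtoC L)) (Cexp Y)).
(* Among the logarithms of the partial ratio, [y] is the one obtained by integrating the partial sum
   along the segment. It converges to [Y] itself and not merely modulo 2 pi i, by uniform
   convergence of the integrands. *)
{ assert (Hch : forall N, exists y, Cexp y = sigma_ratio a b x0 (- x0)%C (RtoC L) N /\
    ((M0 <= N)%nat -> Cmod (y - Y)%C <= 4 * A * Rabs L / (INR N + 1))).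
  { intros N; destruct (HP N) as [P HPN].
    exists (P L - P 0 + RtoC L * (RtoC 2 * x0 * inv_square_box a b N))%C; split; [now apply HG|].
    intros HN.
    set (Q := fun t => (P t + RtoC t * (RtoC 2 * x0 * inv_square_box a b N) - W t)%C).
    replace (P L - P 0 + RtoC L * (RtoC 2 * x0 * inv_square_box a b N) - Y)%C
      with (Q L - Q 0)%C by (unfold Q, Y; ring).
    replace (4 * A * Rabs L / (INR N + 1)) with (2 * (2 * A / (INR N + 1)) * Rabs L)
      by (unfold Rdiv; ring).
    apply (cderiv_bound Q (fun s => psi N s - (wzeta a b (RtoC s + x0) - wzeta a b (RtoC s - x0)))%C).
    - intros s; unfold Q; apply cderiv_minus; [|apply HZ]; rewrite Epsi.
      apply cderiv_plus; [apply HPN|].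
      eapply cderiv_value; [apply cderiv_mult; [apply cderiv_id|apply cderiv_const]|cbv beta; ring].
    - intros s Hs; unfold psi.
      replace (zeta_box a b (RtoC s + x0) N - zeta_box a b (RtoC s - x0) N -
        (wzeta a b (RtoC s + x0) - wzeta a b (RtoC s - x0)))%C
        with ((zeta_box a b (RtoC s + x0) N - wzeta a b (RtoC s + x0)) +
          - (zeta_box a b (RtoC s - x0) N - wzeta a b (RtoC s - x0)))%C by ring.
      eapply Rle_trans; [apply Cmod_triangle|rewrite Cmod_opp].
      assert (B : forall z, Cmod z <= Rabs L + Cmod x0 ->
        Cmod (zeta_box a b z N - wzeta a b z)%C <= A / (INR N + 1)).
      { intros z Hz; apply HA; trivial; [apply NoDup_box|now apply incl_box]. }
      assert (B1 := B (RtoC s + x0)%C); assert (B2 := B (RtoC s - x0)%C).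
      replace (2 * A / (INR N + 1)) with (A / (INR N + 1) + A / (INR N + 1)) by (unfold Rdiv; ring).
      apply Rplus_le_compat; [apply B1|apply B2];
       (eapply Rle_trans; [apply Cmod_triangle|]); rewrite ?Cmod_opp, Cmod_R; lra. }
  (* Beyond [M1] the error y - Y is at most 1/2, as the quadratic estimate of the exponential
     demands. *)
  destruct (nat_above (2 * (4 * A * Rabs L))) as [M1 HM1].
  apply is_clim_rate with (Cmod (Cexp Y) * (4 * (4 * A * Rabs L))) (Nat.max M0 M1); intros N HN.
  destruct (Hch N) as [y [<- Hy]]; specialize (Hy ltac:(lia)).
  assert (HN1 : INR M1 <= INR N) by (apply le_INR; lia).
  pose proof (pos_INR N).
  assert (Hsmall : 4 * A * Rabs L / (INR N + 1) <= 1 / 2).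
  { apply (Rmult_le_reg_r (INR N + 1)); [lra|]; unfold Rdiv at 1.
    rewrite Rmult_assoc, Rinv_l by lra; lra. }
  replace (Cexp y - Cexp Y)%C with (Cexp Y * ((Cexp (y - Y) - 1 - (y - Y)) + (y - Y)))%C.
  2:{ replace (Cexp y) with (Cexp Y * Cexp (y - Y))%C by (rewrite <- Cexp_plus; f_equal; ring); ring. }
  rewrite Cmod_mult; unfold Rdiv; rewrite Rmult_assoc.
  apply Rmult_le_compat_l; [apply Cmod_ge_0|].
  eapply Rle_trans; [apply Cmod_triangle|].
  pose proof (Cexp_quadratic (y - Y)%C ltac:(lra)); pose proof (Cmod_ge_0 (y - Y)%C).
  unfold Rdiv in Hy; rewrite (Rmult_assoc 4 (4 * A * Rabs L)); nra. }
pose proof (sigma_period_lattice a b _ HD HL x0 (- x0)%C Hp0 Hm0) as HX.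
pose proof (is_clim_unique _ _ _ HY HX) as E.
set (X := ((x0 - - x0) * (wzeta a b (x0 + RtoC L) - wzeta a b x0))%C) in *.
destruct (Cexp_eq_1 (Y - X)%C) as [k Hk].
{ unfold Cminus at 1; rewrite Cexp_plus, E, Cexp_opp; reflexivity. }
exists k; rewrite <- Hk; unfold X; ring.
Qed.

(** * Constrained elastic curves *)

(* Coquelicot types equalities of reals in convertible but different ways, which
   confuses ring and field. *)
Ltac real_eq := match goal with |- @eq _ ?x ?y => change (@eq R x y); cbv beta end.

Lemma RInt_antiderivative (f df : R -> R) a b :
  (forall s, is_derive f s (df s)) -> (forall s, continuous df s) -> RInt df a b = f b - f a :> R.
Proof.
intros H1 H2; apply is_RInt_unique.
apply (is_RInt_derive (V := R_CompleteNormedModule) f df a b); intros; [apply H1|apply H2].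
Qed.

Lemma wzeta_period_line a b w1 x0 n : Im (Cconj a * b)%C <> 0 ->
  half_period_along a b (RtoC 1) w1 -> (forall s, ~ in_lattice a b (RtoC s + x0)%C) ->
  in_lattice a b (RtoC (2 * INR n * w1)) /\
  (wzeta a b (x0 + RtoC (2 * INR n * w1)) - wzeta a b x0)%C =
    (RtoC (2 * INR n) * wzeta a b (RtoC w1))%C.
Proof.
intros HD [Hw [H2 H1]] Hx.
assert (H2' : in_lattice a b (RtoC (2 * w1))) by (rewrite <- (Cmult_1_r (RtoC (2 * w1))); exact H2).
assert (H1' : ~ in_lattice a b (RtoC w1)).
{ rewrite <- (Cmult_1_r (RtoC w1)); apply H1; lra. }
split.
- destruct H2' as [k Hk]; exists (Z.of_nat n * fst k, Z.of_nat n * snd k)%Z.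
  transitivity (RtoC (INR n) * RtoC (2 * w1))%C; [rewrite <- RtoC_mult; f_equal; ring|].
  rewrite Hk; unfold latpt; cbn [fst snd].
  rewrite !mult_IZR, <- !INR_IZR_INZ, !RtoC_mult; ring.
- apply wzeta_real_period; trivial; rewrite <- (Cplus_0_l x0); apply Hx.
Qed.

(** The real part of zeta along the line integrates kappa^2, while the imaginary part is - kappa / 4
    up to a constant. *)
Lemma elastic_zeta_derive a b x0 G mu kappa : Im (Cconj a * b)%C <> 0 ->
  (forall s, ~ in_lattice a b (RtoC s + x0)%C) ->
  (forall s, wp a b (RtoC s + x0)%C =
    (Ci * RtoC (Derive kappa s / 4) - RtoC (kappa s ^ 2 / 8 + (mu + G) / 12))%C) ->
  forall s,
    is_derive (fun t => Re (wzeta a b (RtoC t + x0))) s (kappa s ^ 2 / 8 + (mu + G) / 12) /\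
    is_derive (fun t => Im (wzeta a b (RtoC t + x0))) s (- Derive kappa s / 4).
Proof.
intros HD Hx Hwp s; destruct (wzeta_line_cderiv a b x0 s HD (Hx s)) as [H1 H2].
rewrite Hwp in H1, H2; split.
- eapply is_derive_value; [exact H1|components; ring].
- eapply is_derive_value; [exact H2|components; field].
Qed.

Lemma continuous_ex_derive (f : R -> R) s : ex_derive f s -> continuous f s.
Proof. apply (ex_derive_continuous (V := R_NormedModule)). Qed.

Lemma elastic_energy G mu lam nu a b w1 w3 rho x0 kappa n :
  elastic_data G mu lam nu a b w1 w3 rho x0 kappa ->
  (forall s, ex_derive kappa s) ->
  kappa (2 * INR n * w1) = kappa 0 ->
  RtoC (RInt (fun s => kappa s ^ 2) 0 (2 * INR n * w1)) =
    (RtoC 16 * RtoC (INR n) * wzeta a b (RtoC w1)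
      - RtoC (2 / 3 * (mu + G) * (2 * INR n * w1)))%C.
Proof.
intros [_ _ _ HD _ _ _ Hw1 _ _ _ _ Hx Hwp] Hk Hper.
destruct (wzeta_period_line a b w1 x0 n HD Hw1 Hx) as [_ Hp].
set (L := 2 * INR n * w1) in *.
pose proof (elastic_zeta_derive a b x0 G mu kappa HD Hx Hwp) as Hz.
set (F := fun t => wzeta a b (RtoC t + x0)%C) in *.
assert (E1 : RInt (fun s => kappa s ^ 2) 0 L = 8 * (Re (F L) - Re (F 0)) - 2 / 3 * (mu + G) * L).
{ rewrite (RInt_antiderivative (fun s => 8 * Re (F s) - 2 / 3 * (mu + G) * s)).
  - real_eq; ring.
  - intros s; eapply is_derive_value.
    + apply is_derive_Rminus; apply is_derive_Rmult;
       [apply is_derive_Rconst|exact (proj1 (Hz s))|apply is_derive_Rconst|apply is_derive_Rid].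
    + real_eq; field.
  - intros s; apply continuous_ex_derive; auto_derive; apply Hk. }
(* Periodicity of kappa makes the quasi-period real, so the identity holds between complex numbers
   although only real parts are integrated. *)
assert (E2 : Im (F L) = Im (F 0)).
{ assert (H : forall t, is_derive (fun t => Im (F t) + kappa t * / 4) t 0).
  { intros t; eapply is_derive_value.
    - apply is_derive_Rplus; [exact (proj2 (Hz t))|].
      apply is_derive_Rmult; [exact (Derive_correct _ _ (Hk t))|apply is_derive_Rconst].
    - real_eq; field. }
  pose proof (is_derive_0_const _ H L 0) as E; cbv beta in E; rewrite Hper in E; lra. }
assert (E3 : (F L - F 0)%C = (RtoC (2 * INR n) * wzeta a b (RtoC w1))%C).
{ rewrite <- Hp; unfold F; f_equal; [f_equal; ring|do 2 f_equal; ring]. }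
replace (RtoC 16 * RtoC (INR n) * wzeta a b (RtoC w1))%C with (RtoC 8 * (F L - F 0))%C.
2:{ rewrite E3, !RtoC_mult; ring_simplify; replace (RtoC 16) with (RtoC 8 * RtoC 2)%C
      by (rewrite <- RtoC_mult; f_equal; ring); ring. }
rewrite E1; components; cbn [fst snd] in *; unfold Im in E2; rewrite E2; f_equal; unfold Re; ring.
Qed.

(** Here kappa = c - 4 Im zeta(s + x0). As x0 is imaginary and the lattice is invariant under
    conjugation, zeta(s - x0) is the conjugate of zeta(s + x0), so that 2 i Im zeta(s + x0) = zeta(s
    + x0) - zeta(s - x0). Its integral over the closed curve is known modulo 2 pi i. *)
Lemma elastic_total_curvature G mu lam nu a b w1 w3 rho x0 kappa n :
  elastic_data G mu lam nu a b w1 w3 rho x0 kappa ->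
  (forall s, ex_derive kappa s) ->
  exists k : Z,
  RtoC (RInt kappa 0 (2 * INR n * w1) / 2) =
    (RtoC 4 * Ci * RtoC (INR n) * wzeta a b (RtoC w1) * x0
      + RtoC 2 * RtoC (INR n) * RtoC w1 * (RtoC (kappa 0 / 2) - RtoC 2 * Ci * wzeta a b x0)
      + RtoC (2 * PI * IZR k))%C.
Proof.
intros [_ _ _ HD _ _ Hreal Hw1 _ _ _ Hx0 Hx Hwp] Hk.
destruct (wzeta_period_line a b w1 x0 n HD Hw1 Hx) as [HL Hp].
set (L := 2 * INR n * w1) in *.
pose proof (elastic_zeta_derive a b x0 G mu kappa HD Hx Hwp) as Hz.
set (F := fun t => wzeta a b (RtoC t + x0)%C) in *.
set (c := kappa 0 + 4 * Im (F 0)).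
assert (Hkap : forall s, kappa s = c - 4 * Im (F s)).
{ assert (H : forall t, is_derive (fun t => Im (F t) + kappa t * / 4) t 0).
  { intros t; eapply is_derive_value.
    - apply is_derive_Rplus; [exact (proj2 (Hz t))|].
      apply is_derive_Rmult; [exact (Derive_correct _ _ (Hk t))|apply is_derive_Rconst].
    - real_eq; field. }
  intros s; pose proof (is_derive_0_const _ H s 0) as E; cbv beta in E; unfold c; lra. }
assert (Hconj : forall s, (RtoC s - x0)%C = Cconj (RtoC s + x0)).
{ intros s; destruct x0 as [u v]; cbn [Re fst] in Hx0; components; f_equal; subst; unfold Re in *; simpl in *; try ring; try lra. }
assert (HKe : exists K : R -> R, (forall s, is_derive K s (kappa s)) /\
  K 0 = 0 /\ K L = RInt kappa 0 L).
{ exists (fun t => RInt kappa 0 t); split; [|split; [|trivial]].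
  - apply is_derive_primitive; intros; now apply continuous_ex_derive.
  - apply (RInt_point (V := R_CompleteNormedModule)). }
destruct HKe as [K [HK [HK0 HKL]]]; rewrite <- HKL.
(* The antiderivative of zeta(s + x0) - zeta(s - x0) = i (c - kappa) / 2, expressed through an
   antiderivative of kappa. *)
set (W := fun s => (0, (c * s - K s) / 2) : C).
assert (HW : forall s, is_derive (fun t => (c * t - K t) * / 2) s ((c - kappa s) * / 2)).
{ intros s; eapply is_derive_value.
  - apply is_derive_Rmult; [|apply is_derive_Rconst].
    apply is_derive_Rminus; [apply is_derive_Rmult; [apply is_derive_Rconst|apply is_derive_Rid]|].
    exact (HK s).
  - real_eq; ring. }
destruct (wzeta_line_integral a b x0 L W HD HL Hx) as [k Ek].
{ intros s; rewrite Hconj, wzeta_conj by trivial; split.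
  - apply (is_derive_Rext (fun _ => 0)); [reflexivity|].
    eapply is_derive_value; [exact (is_derive_Rconst 0 s)|].
    generalize (wzeta a b (RtoC s + x0)); intros [u v]; components; ring.
  - apply (is_derive_Rext (fun t => (c * t - K t) * / 2)); [reflexivity|].
    eapply is_derive_value; [exact (HW s)|].
    rewrite Hkap; change (wzeta a b (RtoC s + x0)) with (F s).
    generalize (F s); intros [u v]; components; field. }
exists (- k)%Z.
assert (HF0 : F 0 = wzeta a b x0) by (unfold F; f_equal; ring).
(* Since - x0 is the conjugate of x0, oddness makes zeta(x0) purely imaginary. Hence kappa(0) / 2 -
   2 i zeta(x0) is real and equal to c / 2. *)
assert (Hz0 : Re (F 0) = 0).
{ rewrite HF0; pose proof (wzeta_conj a b x0 HD Hreal) as E.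
  replace (Cconj x0) with (- x0)%C in E.
  - rewrite wzeta_odd in E by trivial.
    apply (f_equal Re) in E; revert E; components; lra.
  - destruct x0 as [u v]; components; f_equal; unfold Re in Hx0; simpl in Hx0; lra. }
rewrite <- HF0.
replace (RtoC (K L / 2)) with (RtoC (c * L / 2) + Ci * (W L - W 0))%C.
2:{ unfold W; rewrite HK0; components; unfold Rdiv; f_equal; ring. }
rewrite Ek, Hp.
replace (F 0) with (Ci * RtoC (Im (F 0)))%C.
2:{ unfold Re in Hz0; rewrite (surjective_pairing (F 0)), Hz0; components; f_equal; ring. }
rewrite opp_IZR; unfold c, L.
generalize (wzeta a b (RtoC w1)) (Im (F 0)) (kappa 0) (INR n) (IZR k) PI; intros e f q N j p.
clear; destruct x0, e; components; f_equal; field.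
Qed.

(** * Smooth functions *)

(** The form of [smooth] in one variable that makes closure under products and inverses an induction
    on n. *)
Fixpoint Cn (n : nat) (f : R -> R) : Prop :=
  match n with
  | O => True
  | S n => (forall s, ex_derive f s) /\ Cn n (Derive f)
  end.

Definition Cinf (f : R -> R) : Prop := forall n, Cn n f.

Lemma Cinf_ex_derive f : Cinf f -> forall s, ex_derive f s.
Proof. intros H; apply (H 1%nat). Qed.

Lemma Cinf_Derive f : Cinf f -> Cinf (Derive f).
Proof. intros H n; apply (H (S n)). Qed.

Lemma Cinf_continuous f : Cinf f -> forall s, continuous f s.
Proof. intros H s; apply continuous_ex_derive, Cinf_ex_derive, H. Qed.

Lemma Cinf_is_derive f : Cinf f -> forall s, is_derive f s (Derive f s).
Proof. intros H s; apply Derive_correct, Cinf_ex_derive, H. Qed.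

Lemma Cn_pred n f : Cn (S n) f -> Cn n f.
Proof.
revert f; induction n as [|n IH]; intros f; [easy|].
intros [H1 H2]; split; trivial; now apply IH.
Qed.

Lemma Cn_plus n f g : Cn n f -> Cn n g -> Cn n (fun t => f t + g t).
Proof.
revert f g; induction n as [|n IH]; intros f g; [easy|]; intros [F1 F2] [G1 G2]; split.
- intros s; apply (ex_derive_plus f g s); auto.
- replace (Derive (fun t => f t + g t)) with (fun t => Derive f t + Derive g t); [auto|].
  apply functional_extensionality; intros t; symmetry; apply (Derive_plus f g); auto.
Qed.

Lemma Cn_mult n f g : Cn n f -> Cn n g -> Cn n (fun t => f t * g t).
Proof.
revert f g; induction n as [|n IH]; intros f g; [easy|]; intros HF HG.
pose proof (Cn_pred _ _ HF) as HF'; pose proof (Cn_pred _ _ HG) as HG'.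
destruct HF as [F1 F2]; destruct HG as [G1 G2]; split.
- intros s; apply (ex_derive_mult f g s); auto.
- replace (Derive (fun t => f t * g t)) with (fun t => Derive f t * g t + f t * Derive g t).
  + apply Cn_plus; auto.
  + apply functional_extensionality; intros t; symmetry; apply (Derive_mult f g); auto.
Qed.

Lemma Cn_const n c : Cn n (fun _ => c).
Proof.
revert c; induction n as [|n IH]; intros c; [easy|]; split.
- intros s; exists 0; apply is_derive_Rconst.
- replace (Derive (fun _ => c)) with (fun _ : R => 0); [auto|].
  apply functional_extensionality; intros t; symmetry; apply (Derive_const c).
Qed.

Lemma Cinf_plus f g : Cinf f -> Cinf g -> Cinf (fun t => f t + g t).
Proof. intros H1 H2 n; now apply Cn_plus. Qed.

Lemma Cinf_mult f g : Cinf f -> Cinf g -> Cinf (fun t => f t * g t).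
Proof. intros H1 H2 n; now apply Cn_mult. Qed.

Lemma Cinf_const c : Cinf (fun _ => c).
Proof. intros n; apply Cn_const. Qed.

Lemma Cinf_opp f : Cinf f -> Cinf (fun t => - f t).
Proof.
intros H; replace (fun t => - f t) with (fun t => (-1) * f t).
- apply (Cinf_mult (fun _ => -1)); trivial; apply Cinf_const.
- apply functional_extensionality; intros; ring.
Qed.

Lemma Cinf_minus f g : Cinf f -> Cinf g -> Cinf (fun t => f t - g t).
Proof. intros H1 H2; apply (Cinf_plus f (fun t => - g t)); trivial; now apply Cinf_opp. Qed.

Lemma Derive_shift (f g : R -> R) s u :
  (forall h, f (s + h) = g (u + h)) -> Derive f s = Derive g u.
Proof.
intros H; unfold Derive; f_equal; apply Lim_ext; intros h.
pose proof (H 0) as H0; rewrite !Rplus_0_r in H0; now rewrite H, H0.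
Qed.

Lemma Derive_periodic (f : R -> R) L : (forall s, f (s + L) = f s) ->
  forall s, Derive f (s + L) = Derive f s.
Proof.
intros H s; apply Derive_shift; intros h.
rewrite <- (H (s + h)); f_equal; ring.
Qed.

Lemma ex_derive_shift (f g : R -> R) s u :
  (forall h, g (u + h) = f (s + h)) -> ex_derive f s -> ex_derive g u.
Proof.
intros H [d Hd]; exists d.
apply (is_derive_Rext (fun t => f (t + (s - u)))).
- intros t; replace (t + (s - u)) with (s + (t - u)) by ring.
  rewrite <- H; f_equal; ring.
- replace d with (scal 1 d) by (unfold scal; simpl; unfold mult; simpl; ring).
  apply (is_derive_comp f (fun t => t + (s - u))).
  + replace (u + (s - u)) with s by ring; exact Hd.
  + eapply is_derive_value.
    * exact (is_derive_Rplus _ _ _ _ _ (is_derive_Rid u) (is_derive_Rconst (s - u) u)).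
    * ring.
Qed.

Lemma smooth_dirD {V : NormedModule R_AbsRing} (f : V -> R) v : smooth f -> smooth (dirD v f).
Proof.
intros H vs; specialize (H (vs ++ [v])); rewrite fold_right_app in H; exact H.
Qed.

Lemma smooth_ex_derive {V : NormedModule R_AbsRing} (f : V -> R) p v : smooth f ->
  ex_derive (fun h : R => f (plus p (scal h v))) 0.
Proof. intros H; apply (H []). Qed.

Lemma smooth_continuous {V : NormedModule R_AbsRing} (f : V -> R) p : smooth f -> continuous f p.
Proof. intros H; apply (H []). Qed.

Lemma dirD_R (f : R -> R) : dirD (V := R_NormedModule) 1 f = Derive f.
Proof.
apply functional_extensionality; intros s; unfold dirD; apply Derive_shift; intros h.
unfold plus, scal; simpl; unfold mult; simpl; f_equal; ring.
Qed.

Lemma smooth_curve_Cinf f : smooth_curve f -> Cinf f.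
Proof.
intros H n; revert f H; induction n as [|n IH]; intros f H; [easy|]; split.
- intros s; pose proof (smooth_ex_derive (V := R_NormedModule) f s 1 H) as E; revert E.
  apply ex_derive_shift; intros h; unfold plus, scal; simpl; unfold mult; simpl; f_equal; ring.
- apply IH; rewrite <- dirD_R; now apply smooth_dirD.
Qed.

Lemma dirD_e1 (f : R2 -> R) (s t : R) : dirD e1 f (s, t) = Derive (fun u => f (u, t)) s.
Proof.
unfold dirD; apply Derive_shift; intros h.
unfold plus, scal, e1; simpl; unfold prod_plus, prod_scal, plus, scal; simpl; unfold mult; simpl.
do 2 f_equal; real_eq; ring.
Qed.

Lemma dirD_e2 (f : R2 -> R) (s t : R) : dirD e2 f (s, t) = Derive (fun u => f (s, u)) t.
Proof.
unfold dirD; apply Derive_shift; intros h.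
unfold plus, scal, e2; simpl; unfold prod_plus, prod_scal, plus, scal; simpl; unfold mult; simpl.
do 2 f_equal; real_eq; ring.
Qed.

Lemma smooth_ex_derive_e1 (f : R2 -> R) (s t : R) : smooth f -> ex_derive (fun u => f (u, t)) s.
Proof.
intros H; pose proof (smooth_ex_derive f (s, t) e1 H) as E; revert E.
apply ex_derive_shift; intros h.
unfold plus, scal, e1; simpl; unfold prod_plus, prod_scal, plus, scal; simpl; unfold mult; simpl.
do 2 f_equal; real_eq; ring.
Qed.

Lemma smooth_ex_derive_e2 (f : R2 -> R) (s t : R) : smooth f -> ex_derive (fun u => f (s, u)) t.
Proof.
intros H; pose proof (smooth_ex_derive f (s, t) e2 H) as E; revert E.
apply ex_derive_shift; intros h.
unfold plus, scal, e2; simpl; unfold prod_plus, prod_scal, plus, scal; simpl; unfold mult; simpl.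
do 2 f_equal; real_eq; ring.
Qed.

(* Functions of this form are closed under directional differentiation. *)
Lemma smooth_ridge (f g : R -> R) (a b c d : R) : Cinf f -> Cinf g ->
  smooth (V := R2) (fun p => f (a * fst p + b * snd p) + g (c * fst p + d * snd p)).
Proof.
intros Hf Hg.
assert (Hlin : forall a b (p v : R2) h,
  a * fst (plus p (scal h v)) + b * snd (plus p (scal h v)) =
  (a * fst p + b * snd p) + h * (a * fst v + b * snd v)).
{ intros a' b' [p1 p2] [v1 v2] h; unfold plus, scal; simpl.
  unfold plus, scal; simpl; unfold mult; simpl; real_eq; ring. }
assert (Hd : forall (f : R -> R), Cinf f -> forall a b (p v : R2),
  is_derive (fun h => f (a * fst (plus p (scal h v)) + b * snd (plus p (scal h v)))) 0
    ((a * fst v + b * snd v) * Derive f (a * fst p + b * snd p))).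
{ clear - Hlin; intros f Hf a b p v.
  apply (is_derive_Rext (fun h => f ((a * fst p + b * snd p) + h * (a * fst v + b * snd v)))).
  { intros h; now rewrite Hlin. }
  apply (is_derive_comp f (fun h => (a * fst p + b * snd p) + h * (a * fst v + b * snd v))).
  - rewrite Rmult_0_l, Rplus_0_r; now apply Cinf_is_derive.
  - eapply is_derive_value.
    + apply is_derive_Rplus; [apply is_derive_Rconst|].
      apply is_derive_Rmult; [apply is_derive_Rid|apply is_derive_Rconst].
    + cbv beta; ring. }
set (F := fun p : R2 => f (a * fst p + b * snd p) + g (c * fst p + d * snd p)).
assert (Hform : forall vs, exists f' g', Cinf f' /\ Cinf g' /\ fold_right dirD F vs =
  (fun p : R2 => f' (a * fst p + b * snd p) + g' (c * fst p + d * snd p))).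
{ induction vs as [|v vs [f' [g' [Hf' [Hg' E]]]]]; [exists f, g; auto|].
  exists (fun t => (a * fst v + b * snd v) * Derive f' t),
         (fun t => (c * fst v + d * snd v) * Derive g' t).
  split; [apply (Cinf_mult (fun _ => _)); [apply Cinf_const|now apply Cinf_Derive]|].
  split; [apply (Cinf_mult (fun _ => _)); [apply Cinf_const|now apply Cinf_Derive]|].
  cbn [fold_right]; rewrite E; apply functional_extensionality; intros p; unfold dirD.
  apply is_derive_unique, is_derive_Rplus; now apply Hd. }
intros vs; destruct (Hform vs) as [f' [g' [Hf' [Hg' E]]]]; cbv zeta; fold F; rewrite E; clear E.
assert (Hc : forall (h : R -> R) a b (p : R2), Cinf h ->
  continuous (fun p : R2 => h (a * fst p + b * snd p)) p).
{ intros h a' b' p Hh.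
  apply (continuous_comp (fun p : R2 => a' * fst p + b' * snd p) h); [|now apply Cinf_continuous].
  apply (continuous_plus (fun p : R2 => a' * fst p) (fun p : R2 => b' * snd p)).
  - apply (continuous_scal_r a' (fun p : R2 => fst p)); apply continuous_fst.
  - apply (continuous_scal_r b' (fun p : R2 => snd p)); apply continuous_snd. }
intros p; split.
- apply (continuous_plus (fun p : R2 => f' (a * fst p + b * snd p))
    (fun p : R2 => g' (c * fst p + d * snd p))); now apply Hc.
- intros v; eexists; apply is_derive_Rplus; now apply Hd.
Qed.

(** * Tori of revolution *)

(** A profile (A, B, C) in a half sphere, rotated in the last two coordinates. The form is stable
    under differentiation in s, and differentiation in t only passes to [rotation_angular] and back,
    so all derivatives of the torus are obtained by rewriting. *)
Definition rotation (A B C : R -> R) (p : R2) : R4 :=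
  ((A (fst p), B (fst p)), (C (fst p) * cos (snd p), C (fst p) * sin (snd p))).

Definition rotation_angular (C : R -> R) (p : R2) : R4 :=
  ((0, 0), (- C (fst p) * sin (snd p), C (fst p) * cos (snd p))).

Lemma Derive_cos t : Derive cos t = - sin t.
Proof. apply is_derive_unique, is_derive_cos. Qed.

Lemma Derive_sin t : Derive sin t = cos t.
Proof. apply is_derive_unique, is_derive_sin. Qed.

Lemma D4_rotation_e1 A B C : D4 e1 (rotation A B C) = rotation (Derive A) (Derive B) (Derive C).
Proof.
apply functional_extensionality; intros [s t]; unfold D4, rotation; cbn [fst snd].
rewrite !dirD_e1; unfold Re, Im; cbn [fst snd].
rewrite !Derive_scal_l; reflexivity.
Qed.

Lemma D4_rotation_e2 A B C : D4 e2 (rotation A B C) = rotation_angular C.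
Proof.
apply functional_extensionality; intros [s t]; unfold D4, rotation, rotation_angular; cbn [fst snd].
rewrite !dirD_e2; unfold Re, Im; cbn [fst snd].
rewrite !Derive_const, !Derive_scal, Derive_cos, Derive_sin; do 2 f_equal; ring.
Qed.

Lemma D4_rotation_angular_e2 C : D4 e2 (rotation_angular C) = rotation (fun _ => 0) (fun _ => 0) (fun s => - C s).
Proof.
apply functional_extensionality; intros [s t]; unfold D4, rotation, rotation_angular; cbn [fst snd].
rewrite !dirD_e2; unfold Re, Im; cbn [fst snd].
rewrite !Derive_const, !Derive_scal, Derive_cos, Derive_sin; do 2 f_equal; ring.
Qed.

Lemma det4_rotation a b c a1 b1 c1 a2 b2 c2 co si : co ^ 2 + si ^ 2 = 1 ->
  det4 ((a, b), (c * co, c * si)) ((a1, b1), (c1 * co, c1 * si))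
    ((0, 0), (- c * si, c * co)) ((a2, b2), (c2 * co, c2 * si)) =
  - c * (a * (b1 * c2 - b2 * c1) - b * (a1 * c2 - a2 * c1) + c * (a1 * b2 - a2 * b1)).
Proof.
intros H; unfold det4.
transitivity ((- c * (a * (b1 * c2 - b2 * c1) - b * (a1 * c2 - a2 * c1) + c * (a1 * b2 - a2 * b1)))
  * (co ^ 2 + si ^ 2)); [ring|rewrite H; ring].
Qed.

Lemma sin2_cos2_pow t : cos t ^ 2 + sin t ^ 2 = 1.
Proof. pose proof (sin2_cos2 t) as H; unfold Rsqr in H; simpl; lra. Qed.

(** The hypothesis on the speed of the profile makes the metric C^2 (g^2 ds^2 + dt^2) with constant
    g, a multiple of a flat metric. *)
Lemma area_density_rotation A B C s t g : 0 < g -> 0 < C s ->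
  Derive A s ^ 2 + Derive B s ^ 2 + Derive C s ^ 2 = g ^ 2 * C s ^ 2 ->
  area_density (rotation A B C) (s, t) = g * C s ^ 2 /\
  fund1 (rotation A B C) e1 e1 (s, t) = g ^ 2 * C s ^ 2 /\
  fund1 (rotation A B C) e1 e2 (s, t) = 0 /\
  fund1 (rotation A B C) e2 e2 (s, t) = C s ^ 2.
Proof.
intros Hg HC HE.
assert (E1 : fund1 (rotation A B C) e1 e1 (s, t) = g ^ 2 * C s ^ 2).
{ unfold fund1; rewrite D4_rotation_e1; unfold dot4, rotation, Re, Im; cbn [fst snd].
  rewrite <- HE, <- (Rmult_1_r (Derive C s ^ 2)), <- (sin2_cos2_pow t); ring. }
assert (E2 : fund1 (rotation A B C) e1 e2 (s, t) = 0).
{ unfold fund1; rewrite D4_rotation_e1, D4_rotation_e2.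
  unfold dot4, rotation, rotation_angular, Re, Im; cbn [fst snd]; ring. }
assert (E3 : fund1 (rotation A B C) e2 e2 (s, t) = C s ^ 2).
{ unfold fund1; rewrite D4_rotation_e2.
  unfold dot4, rotation_angular, Re, Im; cbn [fst snd].
  rewrite <- (Rmult_1_r (C s ^ 2)), <- (sin2_cos2_pow t); ring. }
repeat split; trivial.
unfold area_density; rewrite E1, E2, E3.
replace (g ^ 2 * C s ^ 2 * C s ^ 2 - 0 ^ 2) with ((g * C s ^ 2) ^ 2) by ring.
apply sqrt_pow2, Rmult_le_pos; [lra|apply pow2_ge_0].
Qed.

Lemma mean_curvature_rotation A B C s t g : 0 < g -> 0 < C s ->
  Derive A s ^ 2 + Derive B s ^ 2 + Derive C s ^ 2 = g ^ 2 * C s ^ 2 ->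
  let a1 := Derive A s in let b1 := Derive B s in let c1 := Derive C s in
  let a2 := Derive (Derive A) s in let b2 := Derive (Derive B) s in
  let c2 := Derive (Derive C) s in
  mean_curvature (rotation A B C) (s, t) =
    - (A s * (b1 * c2 - b2 * c1) - B s * (a1 * c2 - a2 * c1) + C s * (a1 * b2 - a2 * b1)
       - g ^ 2 * C s * (A s * b1 - B s * a1)) / (2 * g ^ 3 * C s ^ 3).
Proof.
intros Hg HC HE; cbv zeta.
destruct (area_density_rotation A B C s t g Hg HC HE) as [Ea [E1 [E2 E3]]].
unfold mean_curvature; rewrite E1, E2, E3; unfold fund2; rewrite Ea.
rewrite D4_rotation_e1, D4_rotation_e1, !D4_rotation_e2, D4_rotation_angular_e2.
unfold rotation, rotation_angular; cbn [fst snd].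
rewrite !det4_rotation by apply sin2_cos2_pow.
field; lra.
Qed.

(** The algebra of conformal invariance. The values [x2] and [y2] are the second derivatives of a
    curve of constant hyperbolic speed and curvature k, while a, b, c and their derivatives come
    from inverse stereographic projection. The left-hand side of the second identity is g times the
    Willmore integrand, and the last term on the right is the second derivative of log c. *)
Lemma revolution_algebra x y x1 y1 k Q : 0 < y -> 0 < x1 ^ 2 + y1 ^ 2 -> Q = x ^ 2 + y ^ 2 + 1 ->
  let x2 := k * y1 + 2 * x1 * y1 / y in
  let y2 := - k * x1 - (x1 ^ 2 - y1 ^ 2) / y in
  let Q1 := 2 * (x * x1 + y * y1) in
  let Q2 := 2 * (x1 ^ 2 + x * x2 + y1 ^ 2 + y * y2) in
  let a := 2 * x / Q in let b := (Q - 2) / Q in let c := 2 * y / Q in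
  let a1 := 2 * (x1 * Q - x * Q1) / Q ^ 2 in
  let b1 := 2 * Q1 / Q ^ 2 in
  let c1 := 2 * (y1 * Q - y * Q1) / Q ^ 2 in
  let a2 := 2 * (x2 * Q - x * Q2) / Q ^ 2 - 4 * (x1 * Q - x * Q1) * Q1 / Q ^ 3 in
  let b2 := 2 * Q2 / Q ^ 2 - 4 * Q1 ^ 2 / Q ^ 3 in
  let c2 := 2 * (y2 * Q - y * Q2) / Q ^ 2 - 4 * (y1 * Q - y * Q1) * Q1 / Q ^ 3 in
  let g2 := (x1 ^ 2 + y1 ^ 2) / y ^ 2 in
  a1 ^ 2 + b1 ^ 2 + c1 ^ 2 = g2 * c ^ 2 /\
  (a * (b1 * c2 - b2 * c1) - b * (a1 * c2 - a2 * c1) + c * (a1 * b2 - a2 * b1)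
    - g2 * c * (a * b1 - b * a1)) ^ 2 / (4 * g2 ^ 2 * c ^ 4) + g2 * c ^ 2 =
  k ^ 2 / 4 - (c * c2 - c1 ^ 2) / c ^ 2.
Proof.
intros Hy HS HQ; cbv zeta.
assert (HQ0 : x ^ 2 + y ^ 2 + 1 <> 0) by nra.
subst Q; split; field; repeat split; try lra; trivial.
Qed.

Lemma hyp_speed_1 G x y s : G < 0 -> 0 < y s -> hyp_speed G x y s = 1 ->
  Derive x s ^ 2 + Derive y s ^ 2 = - G * y s ^ 2.
Proof.
intros HG Hy H; unfold hyp_speed in H.
set (E := Derive x s ^ 2 + Derive y s ^ 2) in *.
assert (HP : 0 < - G * y s ^ 2) by (apply Rmult_lt_0_compat; [lra|now apply pow_lt]).
assert (HE : 0 <= E) by (unfold E; apply Rplus_le_le_0_compat; apply pow2_ge_0).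
assert (H2 : E / (- G * y s ^ 2) = 1).
{ rewrite <- (sqrt_sqrt (E / (- G * y s ^ 2))), H; [ring|].
  apply Rmult_le_pos; [trivial|left; now apply Rinv_0_lt_compat]. }
replace E with (E / (- G * y s ^ 2) * (- G * y s ^ 2)) by (field; lra).
rewrite H2; ring.
Qed.

(** Differentiating the constant speed shows that the covariant acceleration is orthogonal to the
    velocity. Hence it is determined by its normal component, the curvature. *)
Lemma hyp_arclength_second G x y : G < 0 -> hyp_arclength G x y -> forall s,
  let k := hyp_curvature G x y s in let x1 := Derive x s in let y1 := Derive y s in
  Derive (Derive x) s = k * y1 + 2 * x1 * y1 / y s /\
  Derive (Derive y) s = - k * x1 - (x1 ^ 2 - y1 ^ 2) / y s.
Proof.
intros HG [Hx [Hy Hs]] s k x1 y1.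
apply smooth_curve_Cinf in Hx; apply smooth_curve_Cinf in Hy.
assert (Hsp : forall s, Derive x s ^ 2 + Derive y s ^ 2 = - G * y s ^ 2).
{ intros t; destruct (Hs t); now apply hyp_speed_1. }
pose proof (Hsp s) as H1; fold x1 y1 in H1; destruct (Hs s) as [Hyp _].
set (x2 := Derive (Derive x) s); set (y2 := Derive (Derive y) s).
assert (H2 : x1 * x2 + y1 * y2 = - G * y s * y1).
{ assert (Hx1 := Cinf_is_derive _ (Cinf_Derive _ Hx) s).
  assert (Hy1 := Cinf_is_derive _ (Cinf_Derive _ Hy) s).
  assert (Hy0 := Cinf_is_derive _ Hy s).
  assert (D1 : is_derive (fun t => Derive x t * Derive x t + Derive y t * Derive y t) s
    (2 * (x1 * x2 + y1 * y2))).
  { eapply is_derive_value.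
    - apply is_derive_Rplus; apply is_derive_Rmult; [exact Hx1|exact Hx1|exact Hy1|exact Hy1].
    - real_eq; fold x1 y1 x2 y2; ring. }
  assert (D2 : is_derive (fun t => - G * (y t * y t)) s (2 * (- G * y s * y1))).
  { eapply is_derive_value.
    - apply is_derive_Rmult; [apply is_derive_Rconst|].
      apply is_derive_Rmult; [exact Hy0|exact Hy0].
    - real_eq; fold y1; ring. }
  assert (D3 : is_derive (fun t => - G * (y t * y t)) s (2 * (x1 * x2 + y1 * y2))).
  { refine (is_derive_Rext _ _ _ _ _ D1); intros t; pose proof (Hsp t); simpl in *; lra. }
  assert (E : 2 * (x1 * x2 + y1 * y2) = 2 * (- G * y s * y1)); [|lra].
  transitivity (Derive (fun t => - G * (y t * y t)) s);
    [symmetry; exact (is_derive_unique _ _ _ D3)|exact (is_derive_unique _ _ _ D2)]. }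
assert (Ek : k = (y1 * (x2 - 2 * x1 * y1 / y s) - x1 * (y2 + (x1 ^ 2 - y1 ^ 2) / y s))
  / (- G * y s ^ 2)) by reflexivity.
assert (HP : 0 < - G * y s ^ 2) by (apply Rmult_lt_0_compat; [lra|now apply pow_lt]).
assert (Hort : x1 * (x2 - 2 * x1 * y1 / y s) + y1 * (y2 + (x1 ^ 2 - y1 ^ 2) / y s) = 0).
{ replace (x1 * (x2 - 2 * x1 * y1 / y s) + y1 * (y2 + (x1 ^ 2 - y1 ^ 2) / y s))
    with (x1 * x2 + y1 * y2 - (x1 ^ 2 + y1 ^ 2) * y1 / y s) by (field; lra).
  rewrite H1, H2; field; lra. }
set (ax := x2 - 2 * x1 * y1 / y s) in *; set (ay := y2 + (x1 ^ 2 - y1 ^ 2) / y s) in *.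
assert (Ex : ax = k * y1).
{ rewrite Ek, <- H1; apply (Rmult_eq_reg_r (x1 ^ 2 + y1 ^ 2)); [|lra].
  transitivity (y1 * (y1 * ax - x1 * ay) + x1 * (x1 * ax + y1 * ay)); [ring|].
  rewrite Hort; field; lra. }
assert (Ey : ay = - k * x1).
{ rewrite Ek, <- H1; apply (Rmult_eq_reg_r (x1 ^ 2 + y1 ^ 2)); [|lra].
  transitivity (- x1 * (y1 * ax - x1 * ay) + y1 * (x1 * ax + y1 * ay)); [ring|].
  rewrite Hort; field; lra. }
unfold ax, ay in Ex, Ey; split; lra.
Qed.

Lemma hyp_curvature_ex_derive G x y s : G < 0 -> hyp_arclength G x y ->
  ex_derive (hyp_curvature G x y) s.
Proof.
intros HG [Hx [Hy Hs]]; destruct (Hs s) as [Hyp _].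
apply smooth_curve_Cinf in Hx; apply smooth_curve_Cinf in Hy.
pose proof (Cinf_ex_derive _ Hx) as X0; pose proof (Cinf_ex_derive _ Hy) as Y0.
pose proof (Cinf_ex_derive _ (Cinf_Derive _ Hx)) as X1.
pose proof (Cinf_ex_derive _ (Cinf_Derive _ Hy)) as Y1.
pose proof (Cinf_ex_derive _ (Cinf_Derive _ (Cinf_Derive _ Hx))) as X2.
pose proof (Cinf_ex_derive _ (Cinf_Derive _ (Cinf_Derive _ Hy))) as Y2.
assert (E : hyp_curvature G x y = fun s =>
  (Derive y s * (Derive (Derive x) s - 2 * Derive x s * Derive y s / y s)
   - Derive x s * (Derive (Derive y) s + (Derive x s ^ 2 - Derive y s ^ 2) / y s))
  / (- G * y s ^ 2)) by reflexivity.
rewrite E; clear E Hx Hy Hs; generalize dependent (Derive (Derive x)); generalize dependent (Derive (Derive y)).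
generalize dependent (Derive x); generalize dependent (Derive y).
intros y1 Y1 x1 X1 y2 Y2 x2 X2.
auto_derive; repeat split; auto; try lra.
apply Rmult_integral_contrapositive_currified; [lra|].
apply Rgt_not_eq; nra.
Qed.

Lemma hyp_curvature_periodic G x y L s :
  (forall s, x (s + L) = x s /\ y (s + L) = y s) ->
  hyp_curvature G x y (s + L) = hyp_curvature G x y s.
Proof.
intros H.
pose proof (Derive_periodic x L (fun t => proj1 (H t))) as X1.
pose proof (Derive_periodic y L (fun t => proj2 (H t))) as Y1.
pose proof (Derive_periodic _ L X1) as X2; pose proof (Derive_periodic _ L Y1) as Y2.
pose proof (proj2 (H s)) as Y0.
change (hyp_curvature G x y) with (fun s =>
  (Derive y s * (Derive (Derive x) s - 2 * Derive x s * Derive y s / y s)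
   - Derive x s * (Derive (Derive y) s + (Derive x s ^ 2 - Derive y s ^ 2) / y s))
  / (- G * y s ^ 2)); cbv beta.
now rewrite X1, X2, Y1, Y2, Y0.
Qed.

Definition profileA (x y : R -> R) (s : R) : R := 2 * x s / (x s ^ 2 + y s ^ 2 + 1).
Definition profileB (x y : R -> R) (s : R) : R :=
  (x s ^ 2 + y s ^ 2 + 1 - 2) / (x s ^ 2 + y s ^ 2 + 1).
Definition profileC (x y : R -> R) (s : R) : R := 2 * y s / (x s ^ 2 + y s ^ 2 + 1).

Lemma revolution_torus_rotation x y :
  revolution_torus x y = rotation (profileA x y) (profileB x y) (profileC x y).
Proof.
apply functional_extensionality; intros [s t].
unfold revolution_torus, rotation, inv_stereo, profileA, profileB, profileC; cbn [fst snd].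
assert (E : x s ^ 2 + (y s * cos t) ^ 2 + (y s * sin t) ^ 2 = x s ^ 2 + y s ^ 2).
{ rewrite <- (Rmult_1_r (y s ^ 2)), <- (sin2_cos2_pow t); ring. }
rewrite E; unfold Rdiv; f_equal; f_equal; ring.
Qed.

Lemma profile_norm_pos (x y : R -> R) s : 0 < x s ^ 2 + y s ^ 2 + 1.
Proof. pose proof (pow2_ge_0 (x s)); pose proof (pow2_ge_0 (y s)); lra. Qed.

Lemma Derive_profile (x y : R -> R) : (forall s, ex_derive x s) -> (forall s, ex_derive y s) ->
  let Q := fun s => x s ^ 2 + y s ^ 2 + 1 in
  let Q1 := fun s => 2 * (x s * Derive x s + y s * Derive y s) in
  Derive (profileA x y) = (fun s => 2 * (Derive x s * Q s - x s * Q1 s) / Q s ^ 2) /\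
  Derive (profileB x y) = (fun s => 2 * Q1 s / Q s ^ 2) /\
  Derive (profileC x y) = (fun s => 2 * (Derive y s * Q s - y s * Q1 s) / Q s ^ 2).
Proof.
intros Hx Hy; cbv zeta; repeat split; apply functional_extensionality; intros s;
 apply is_derive_unique; unfold profileA, profileB, profileC; pose proof (profile_norm_pos x y s);
 (auto_derive; [repeat split; auto; simpl in *; lra|
  change (Derive (fun t => x t) s) with (Derive x s);
  change (Derive (fun t => y t) s) with (Derive y s); field; simpl in *; lra]).
Qed.

Lemma Derive2_profile (x y : R -> R) : Cinf x -> Cinf y -> forall s,
  let x1 := Derive x s in let y1 := Derive y s in
  let x2 := Derive (Derive x) s in let y2 := Derive (Derive y) s in
  let Q := x s ^ 2 + y s ^ 2 + 1 in
  let Q1 := 2 * (x s * x1 + y s * y1) in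
  let Q2 := 2 * (x1 ^ 2 + x s * x2 + y1 ^ 2 + y s * y2) in
  is_derive (Derive (profileA x y)) s
    (2 * (x2 * Q - x s * Q2) / Q ^ 2 - 4 * (x1 * Q - x s * Q1) * Q1 / Q ^ 3) /\
  is_derive (Derive (profileB x y)) s (2 * Q2 / Q ^ 2 - 4 * Q1 ^ 2 / Q ^ 3) /\
  is_derive (Derive (profileC x y)) s
    (2 * (y2 * Q - y s * Q2) / Q ^ 2 - 4 * (y1 * Q - y s * Q1) * Q1 / Q ^ 3).
Proof.
intros Hx Hy s; cbv zeta.
pose proof (Cinf_ex_derive _ Hx) as X0; pose proof (Cinf_ex_derive _ Hy) as Y0.
pose proof (Cinf_ex_derive _ (Cinf_Derive _ Hx)) as X1.
pose proof (Cinf_ex_derive _ (Cinf_Derive _ Hy)) as Y1.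
destruct (Derive_profile x y X0 Y0) as [EA [EB EC]]; rewrite EA, EB, EC.
assert (X0' := Cinf_is_derive _ Hx s); assert (Y0' := Cinf_is_derive _ Hy s).
clear EA EB EC; generalize dependent (Derive x); generalize dependent (Derive y).
intros y1 Y1 Y0' x1 X1 X0'.
pose proof (profile_norm_pos x y s).
split; [|split]; (auto_derive; [repeat split; auto; simpl in *; nra|
  change (Derive (fun t => x t) s) with (Derive x s);
  change (Derive (fun t => y t) s) with (Derive y s);
  change (Derive (fun t => x1 t) s) with (Derive x1 s);
  change (Derive (fun t => y1 t) s) with (Derive y1 s);
  rewrite (is_derive_unique _ _ _ X0'), (is_derive_unique _ _ _ Y0'); field; simpl in *; lra]).
Qed.

Lemma Cinf_id : Cinf (fun t => t).
Proof.
intros n; destruct n as [|n]; [easy|split].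
- intros s; exists 1; apply is_derive_Rid.
- replace (Derive (fun t => t)) with (fun _ : R => 1); [apply Cn_const|].
  apply functional_extensionality; intros t; symmetry; apply Derive_id.
Qed.

Lemma Cinf_inv f : (forall s, f s <> 0) -> Cinf f -> Cinf (fun t => / f t).
Proof.
intros H0 Hf n; induction n as [|n IH]; [easy|split].
- intros s; apply ex_derive_inv; [now apply Cinf_ex_derive|apply H0].
- replace (Derive (fun t => / f t)) with (fun t => - Derive f t * (/ f t * / f t)).
  + apply Cn_mult; [apply Cinf_opp, Cinf_Derive, Hf|now apply Cn_mult].
  + apply functional_extensionality; intros t; symmetry.
    rewrite Derive_inv; [|now apply Cinf_ex_derive|apply H0].
    field; apply H0.
Qed.

Lemma RInt_const_R (c L : R) : RInt (fun _ => c) 0 L = L * c.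
Proof. rewrite RInt_const; unfold scal; simpl; unfold mult; simpl; real_eq; ring. Qed.

Lemma Cinf_profileC x y : Cinf x -> Cinf y -> Cinf (profileC x y).
Proof.
intros Hx Hy; unfold profileC, Rdiv.
apply (Cinf_mult (fun s => 2 * y s)); [apply (Cinf_mult (fun _ => 2)); [apply Cinf_const|trivial]|].
apply (Cinf_inv (fun s => x s ^ 2 + y s ^ 2 + 1)).
- intros s; pose proof (profile_norm_pos x y s); lra.
- replace (fun s => x s ^ 2 + y s ^ 2 + 1) with (fun s => (x s * x s + y s * y s) + 1).
  + apply (Cinf_plus (fun s => x s * x s + y s * y s)); [|apply Cinf_const].
    apply (Cinf_plus (fun s => x s * x s)); now apply Cinf_mult.
  + apply functional_extensionality; intros s; ring.
Qed.

(* By conformal invariance (H^2 + 1 - K) dA is a quarter of the squared hyperbolic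
   curvature; the last term is K dA, the derivative of a periodic function. *)
Lemma revolution_pointwise G x y s t : G < 0 -> hyp_arclength G x y ->
  let g := sqrt (- G) in let F := rotation (profileA x y) (profileB x y) (profileC x y) in
  0 < profileC x y s /\
  Derive (profileA x y) s ^ 2 + Derive (profileB x y) s ^ 2 + Derive (profileC x y) s ^ 2
    = g ^ 2 * profileC x y s ^ 2 /\
  (mean_curvature F (s, t) ^ 2 + 1) * area_density F (s, t) =
    / g * (hyp_curvature G x y s ^ 2 / 4
      - Derive (fun s => Derive (profileC x y) s * / profileC x y s) s).
Proof.
intros HG Harc g F; pose proof (hyp_arclength_second G x y HG Harc s) as H2; cbv zeta in H2.
destruct Harc as [Hx [Hy Hs]]; apply smooth_curve_Cinf in Hx; apply smooth_curve_Cinf in Hy.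
destruct (Hs s) as [Hyp Hsp]; apply hyp_speed_1 in Hsp; trivial; clear Hs.
assert (Hg : 0 < g) by (apply sqrt_lt_R0; lra).
assert (Hg2 : g ^ 2 = - G) by (apply pow2_sqrt; lra).
pose proof (profile_norm_pos x y s) as HQ.
assert (HC : 0 < profileC x y s) by (unfold profileC; apply Rdiv_lt_0_compat; lra).
destruct (Derive_profile x y (Cinf_ex_derive _ Hx) (Cinf_ex_derive _ Hy)) as [EA [EB EC]].
destruct (Derive2_profile x y Hx Hy s) as [EA2 [EB2 EC2]].
assert (HS : 0 < Derive x s ^ 2 + Derive y s ^ 2).
{ rewrite Hsp; apply Rmult_lt_0_compat; [lra|now apply pow_lt]. }
assert (Eg : g ^ 2 = (Derive x s ^ 2 + Derive y s ^ 2) / y s ^ 2).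
{ rewrite Hg2, Hsp; field; lra. }
destruct (revolution_algebra (x s) (y s) (Derive x s) (Derive y s) (hyp_curvature G x y s)
  _ Hyp HS eq_refl) as [A1 A2].
rewrite <- (proj1 H2), <- (proj2 H2), <- Eg in A2; rewrite <- Eg in A1.
set (A := profileA x y) in *; set (B := profileB x y) in *; set (C := profileC x y) in *.
assert (V : Derive (fun s => Derive C s * / C s) s =
  (C s * Derive (Derive C) s - Derive C s ^ 2) / C s ^ 2).
{ apply is_derive_unique; assert (HCi : Cinf C) by now apply Cinf_profileC.
  eapply is_derive_value.
  - apply is_derive_Rmult; [exact (Cinf_is_derive _ (Cinf_Derive _ HCi) s)|].
    apply (is_derive_inv C s (Derive C s)); [exact (Cinf_is_derive _ HCi s)|lra].
  - real_eq; field; lra. }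
rewrite V; clear V.
apply is_derive_unique in EA2; apply is_derive_unique in EB2; apply is_derive_unique in EC2.
assert (HE : Derive A s ^ 2 + Derive B s ^ 2 + Derive C s ^ 2 = g ^ 2 * C s ^ 2).
{ rewrite EA, EB, EC; unfold C, profileC; exact A1. }
split; [trivial|split; [trivial|]].
unfold F; rewrite (mean_curvature_rotation A B C s t g Hg HC HE).
destruct (area_density_rotation A B C s t g Hg HC HE) as [Ea _]; rewrite Ea.
assert (EAs : Derive A s = 2 * (Derive x s * (x s ^ 2 + y s ^ 2 + 1)
  - x s * (2 * (x s * Derive x s + y s * Derive y s))) / (x s ^ 2 + y s ^ 2 + 1) ^ 2)
  by (rewrite EA; reflexivity).
assert (EBs : Derive B s = 2 * (2 * (x s * Derive x s + y s * Derive y s)) / (x s ^ 2 + y s ^ 2 + 1) ^ 2)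
  by (rewrite EB; reflexivity).
assert (ECs : Derive C s = 2 * (Derive y s * (x s ^ 2 + y s ^ 2 + 1)
  - y s * (2 * (x s * Derive x s + y s * Derive y s))) / (x s ^ 2 + y s ^ 2 + 1) ^ 2)
  by (rewrite EC; reflexivity).
assert (A3 : (A s * (Derive B s * Derive (Derive C) s - Derive (Derive B) s * Derive C s)
    - B s * (Derive A s * Derive (Derive C) s - Derive (Derive A) s * Derive C s)
    + C s * (Derive A s * Derive (Derive B) s - Derive (Derive A) s * Derive B s)
    - g ^ 2 * C s * (A s * Derive B s - B s * Derive A s)) ^ 2 / (4 * (g ^ 2) ^ 2 * C s ^ 4)
    + g ^ 2 * C s ^ 2 =
  hyp_curvature G x y s ^ 2 / 4 - (C s * Derive (Derive C) s - Derive C s ^ 2) / C s ^ 2).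
{ rewrite EA2, EB2, EC2, EAs, EBs, ECs; exact A2. }
rewrite <- A3; field; lra.
Qed.

Lemma willmore_revolution G x y L : G < 0 -> hyp_arclength G x y ->
  (forall s, x (s + L) = x s /\ y (s + L) = y s) ->
  willmore L (2 * PI) (revolution_torus x y) =
    PI / (2 * sqrt (- G)) * RInt (fun s => hyp_curvature G x y s ^ 2) 0 L.
Proof.
intros HG Harc Hper; rewrite revolution_torus_rotation; unfold willmore.
set (g := sqrt (- G)); set (k := hyp_curvature G x y).
set (U := fun s => Derive (profileC x y) s * / profileC x y s).
assert (Hg : 0 < g) by (apply sqrt_lt_R0; lra).
assert (HU : Cinf U).
{ destruct (Harc) as [Hx [Hy _]]; apply smooth_curve_Cinf in Hx; apply smooth_curve_Cinf in Hy.
  pose proof (Cinf_profileC x y Hx Hy) as HC.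
  apply (Cinf_mult (Derive (profileC x y))); [now apply Cinf_Derive|].
  apply (Cinf_inv (profileC x y)); trivial.
  intros s; destruct (revolution_pointwise G x y s 0 HG Harc) as [H _]; lra. }
transitivity (RInt (fun s => 2 * PI * (/ g * (k s ^ 2 / 4 - Derive U s))) 0 L).
{ apply RInt_ext; intros s _; rewrite <- (RInt_const_R _ (2 * PI)); apply RInt_ext; intros t _.
  now destruct (revolution_pointwise G x y s t HG Harc) as [_ [_ H]]. }
assert (Hk : forall s, ex_derive k s) by (intros; now apply hyp_curvature_ex_derive).
assert (Hk2 : forall s, continuous (fun s => k s ^ 2) s).
{ intros s; apply continuous_ex_derive; auto_derive; apply Hk. }
pose proof (is_derive_primitive _ Hk2) as HK.
assert (HK0 : RInt (fun s => k s ^ 2) 0 0 = 0) by apply (RInt_point (V := R_CompleteNormedModule)).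
change (forall s : R, is_derive (fun t => RInt (fun s => k s ^ 2) 0 t) s (k s ^ 2)) in HK.
assert (HKe : exists K : R -> R, (forall s, is_derive K s (k s ^ 2)) /\
  K 0 = 0 /\ K L = RInt (fun s => k s ^ 2) 0 L).
{ exists (fun t => RInt (fun s => k s ^ 2) 0 t); repeat split; trivial; apply HK. }
clear HK HK0; destruct HKe as [K [HK [HK0 HKL]]]; rewrite <- HKL.
rewrite (RInt_antiderivative (fun s => 2 * PI * (/ g * (K s * / 4 - U s)))).
(* [U] is the logarithmic derivative of the periodic function C, so its increment over a period
   vanishes. *)
- assert (EU : U L = U 0).
  { unfold U; replace L with (0 + L) by ring.
    assert (HpC : forall s, profileC x y (s + L) = profileC x y s).
    { intros s; unfold profileC; destruct (Hper s) as [-> ->]; trivial. }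
    now rewrite HpC, (Derive_periodic _ _ HpC). }
  rewrite EU, HK0; real_eq; field; lra.
- intros s; eapply is_derive_value.
  + apply is_derive_Rmult; [apply is_derive_Rconst|].
    apply is_derive_Rmult; [apply is_derive_Rconst|].
    apply is_derive_Rminus; [|exact (Cinf_is_derive _ HU s)].
    apply is_derive_Rmult; [exact (HK s)|apply is_derive_Rconst].
  + real_eq; field; lra.
- intros s; apply (continuous_scal_r (2 * PI) (fun s => / g * (k s ^ 2 / 4 - Derive U s))).
  apply (continuous_scal_r (/ g) (fun s => k s ^ 2 / 4 - Derive U s)).
  apply (continuous_minus (fun s => k s ^ 2 / 4) (Derive U)).
  + apply continuous_ex_derive; auto_derive; apply Hk.
  + apply Cinf_continuous, Cinf_Derive, HU.
Qed.

(** * The conformal class of a torus of revolution *)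

Lemma is_derive_affine (a b : R) : is_derive (fun h => a + h * b) 0 b.
Proof.
eapply is_derive_value.
- apply is_derive_Rplus; [apply is_derive_Rconst|].
  apply is_derive_Rmult; [apply is_derive_Rid|apply is_derive_Rconst].
- real_eq; ring.
Qed.

Lemma is_derive_along (f : R -> R) (a b d : R) : is_derive f a d ->
  is_derive (fun h => f (a + h * b)) 0 (b * d).
Proof.
intros H; apply (is_derive_comp f (fun h => a + h * b)); [|apply is_derive_affine].
now replace (a + 0 * b) with a by ring.
Qed.

Lemma smooth_linear (a b : R) : smooth (V := R2) (fun p => a * fst p + b * snd p).
Proof.
pose proof (smooth_ridge (fun t => t) (fun _ => 0) a b 0 0 Cinf_id (Cinf_const 0)) as H.
replace (fun p : R2 => a * fst p + b * snd p)
  with (fun p : R2 => (a * fst p + b * snd p) + 0); [exact H|].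
apply functional_extensionality; intros p; real_eq; ring.
Qed.

Lemma minus_components (p q : R2) : minus p q = (fst p - fst q, snd p - snd q).
Proof. now destruct p, q. Qed.

Lemma conformal_class_revolution G x y L : G < 0 -> 0 < L -> hyp_arclength G x y ->
  conformal_class L (2 * PI) (revolution_torus x y)
    (RtoC (2 * PI)) (Ci * RtoC (sqrt (- G) * L))%C.
Proof.
intros HG HL Harc; rewrite revolution_torus_rotation.
set (g := sqrt (- G)); assert (Hg : 0 < g) by (apply sqrt_lt_R0; lra).
pose proof PI_RGT_0 as Hpi.
split.
{ components; intros E.
  assert (0 < 2 * PI * (g * L)) by (apply Rmult_lt_0_compat; [lra|now apply Rmult_lt_0_compat]).
  assert (2 * PI * (g * L) = 0) by (rewrite <- E; ring); lra. }
(* The angle of rotation becomes the real coordinate, which gives the generator 2 pi; dividing the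
   other coordinate by g turns C^2 (g^2 ds^2 + dt^2) into a multiple of the flat metric. The roles
   of the two generators are exchanged, whence [swap] below. *)
exists (fun p => (/ g * snd p, fst p)), (fun p => (snd p, g * fst p)).
assert (Hlin : forall (f : R2 -> R) a b, (forall p, f p = a * fst p + b * snd p) -> smooth f).
{ intros f a b E; replace f with (fun p : R2 => a * fst p + b * snd p); [apply smooth_linear|].
  apply functional_extensionality; intros p; symmetry; apply E. }
split; [split|].
{ apply (Hlin _ 0 (/ g)); intros [p1 p2]; change R in p1, p2; cbn beta iota delta [fst snd]; real_eq; ring. }
{ apply (Hlin _ 1 0); intros [p1 p2]; change R in p1, p2; cbn beta iota delta [fst snd]; real_eq; ring. }
split; [split|].
{ apply (Hlin _ 0 1); intros [p1 p2]; change R in p1, p2; cbn beta iota delta [fst snd]; real_eq; ring. }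
{ apply (Hlin _ g 0); intros [p1 p2]; change R in p1, p2; cbn beta iota delta [fst snd]; real_eq; ring. }
split; [intros [p1 p2]; change R in p1, p2; cbn beta iota delta [fst snd];
  refine (f_equal2 pair _ _); real_eq; field; lra|].
split; [intros [p1 p2]; change R in p1, p2; cbn beta iota delta [fst snd];
  refine (f_equal2 pair _ _); real_eq; field; lra|].
split.
{ intros [p1 p2] [q1 q2]; change R in p1, p2, q1, q2; rewrite !minus_components; cbn beta iota delta [fst snd]; split; intros [k Hk].
  - exists (swap k); unfold latpt, swap in *; revert Hk; components; intros Hk.
    injection Hk as E1 E2; f_equal; [|lra].
    apply (Rmult_eq_reg_l g); [|lra].
    transitivity (p2 + - q2); [field; lra|rewrite E2; ring].
  - exists (swap k); unfold latpt, swap in *; revert Hk; components; intros Hk.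
    injection Hk as E1 E2; change (minus (p1, p2) (q1, q2)) with (p1 - q1, p2 - q2).
    f_equal; [lra|].
    assert (H : g * (/ g * p2 - / g * q2) = p2 - q2) by (field; lra).
    rewrite E1 in H; lra. }
intros [p1 p2]; change R in p1, p2; set (s := / g * p2); set (t := p1).
destruct (revolution_pointwise G x y s t HG Harc) as [HC [HE _]]; fold g in HE.
destruct Harc as [Hx [Hy _]]; apply smooth_curve_Cinf in Hx; apply smooth_curve_Cinf in Hy.
pose proof (Cinf_ex_derive _ (Cinf_profileC x y Hx Hy) s) as dC.
assert (dA : ex_derive (profileA x y) s).
{ unfold profileA; pose proof (profile_norm_pos x y s); auto_derive.
  repeat split; try (now apply Cinf_ex_derive); simpl in *; lra. }
assert (dB : ex_derive (profileB x y) s).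
{ unfold profileB; pose proof (profile_norm_pos x y s); auto_derive.
  repeat split; try (now apply Cinf_ex_derive); simpl in *; lra. }
set (A := profileA x y) in *; set (B := profileB x y) in *; set (C := profileC x y) in *.
apply Derive_correct in dA; apply Derive_correct in dB; apply Derive_correct in dC.
set (A1 := Derive A s) in *; set (B1 := Derive B s) in *; set (C1 := Derive C s) in *.
assert (HD : forall v1 v2 : R, D4 (v1, v2) (fun q => rotation A B C (/ g * snd q, fst q)) (p1, p2) =
  ((/ g * v2 * A1, / g * v2 * B1),
   (/ g * v2 * C1 * cos t + C s * (v1 * - sin t), / g * v2 * C1 * sin t + C s * (v1 * cos t)))).
{ intros v1 v2; unfold D4, dirD, rotation, Re, Im; cbn [fst snd].
  assert (Hs : forall (f : R -> R) d, is_derive f s d ->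
    is_derive (fun h => f (/ g * (p2 + h * v2))) 0 (/ g * v2 * d)).
  { intros f d Hf; apply (is_derive_Rext (fun h => f (s + h * (/ g * v2)))).
    - intros h; f_equal; unfold s; ring.
    - now apply is_derive_along. }
  assert (Ht : forall (f : R -> R) d, is_derive f t d ->
    is_derive (fun h => f (p1 + h * v1)) 0 (v1 * d)).
  { intros f d Hf; now apply is_derive_along. }
  assert (E0s : / g * (p2 + 0 * v2) = s) by (unfold s; ring).
  assert (E0t : p1 + 0 * v1 = t) by (unfold t; ring).
  f_equal; f_equal; apply is_derive_unique.
  - exact (Hs A A1 dA).
  - exact (Hs B B1 dB).
  - eapply is_derive_value.
    + exact (is_derive_Rmult _ _ _ _ _ (Hs C C1 dC) (Ht cos _ (is_derive_cos t))).
    + cbv beta; rewrite E0s, E0t; real_eq; ring.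
  - eapply is_derive_value.
    + exact (is_derive_Rmult _ _ _ _ _ (Hs C C1 dC) (Ht sin _ (is_derive_sin t))).
    + cbv beta; rewrite E0s, E0t; real_eq; ring. }
exists (C s ^ 2); split; [now apply pow_lt|]; intros [v1 v2] [w1 w2].
change R in v1, v2, w1, w2; unfold fund1; rewrite !HD; unfold dot4, Re, Im; cbn [fst snd].
pose proof (sin2_cos2_pow t) as Hcs.
transitivity (/ g ^ 2 * (v2 * w2) * (A1 ^ 2 + B1 ^ 2 + C1 ^ 2 * (cos t ^ 2 + sin t ^ 2))
  + C s ^ 2 * (v1 * w1) * (cos t ^ 2 + sin t ^ 2)).
{ real_eq; field; lra. }
rewrite Hcs, Rmult_1_r, HE; real_eq; field; lra.
Qed.

(** * Hopf tori *)

Lemma half_period_pos a b w1 n : half_period_along a b (RtoC 1) w1 -> (0 < n)%nat ->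
  0 < 2 * INR n * w1.
Proof.
intros [H _] Hn; apply lt_0_INR in Hn; apply Rmult_lt_0_compat; lra.
Qed.

(** By (mu + G) / 6 = wp(omega3) the term 2/3 (mu + G) L becomes 8 n omega1 wp(omega3). The factor
    [/ sqrt (- G)] arises since kappa^2 ds, measured in curvature G, is divided by sqrt (- G) on
    passing to curvature -1; it equals 1 for G = -1. *)
Lemma revolution_case G mu lam nu a b w1 w3 rho x0 n x y :
  (0 < n)%nat ->
  let L := 2 * INR n * w1 in
  G < 0 ->
  RtoC ((mu + G) / 6) = wp a b (Ci * RtoC w3)%C ->
  hyp_arclength G x y ->
  (forall s, x (s + L) = x s /\ y (s + L) = y s) ->
  elastic_data G mu lam nu a b w1 w3 rho x0 (hyp_curvature G x y) ->
  RInt (hyp_speed G x y) 0 L = L /\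
  conformal_class L (2 * PI) (revolution_torus x y)
    (RtoC (2 * PI)) (Ci * RtoC (sqrt (- G) * L))%C /\
  RtoC (willmore L (2 * PI) (revolution_torus x y)) =
    (RtoC (/ sqrt (- G)) *
     (RtoC 8 * RtoC (INR n) * wzeta a b (RtoC w1) * RtoC PI
      - RtoC 4 * RtoC (INR n) * RtoC w1 * wp a b (Ci * RtoC w3) * RtoC PI))%C.
Proof.
intros Hn L HG Hwp Harc Hper Hed.
assert (HL : 0 < L) by (eapply half_period_pos; [apply (ed_omega1 _ _ _ _ _ _ _ _ _ _ _ Hed)|trivial]).
split; [|split].
- rewrite (RInt_ext _ (fun _ => 1)); [rewrite RInt_const_R; real_eq; ring|].
  intros s _; apply Harc.
- now apply conformal_class_revolution.
- assert (Hg : 0 < sqrt (- G)) by (apply sqrt_lt_R0; lra).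
  rewrite (willmore_revolution G) by trivial; rewrite RtoC_mult.
  unfold L; rewrite (elastic_energy _ _ _ _ _ _ _ _ _ _ _ _ Hed).
  + rewrite <- Hwp; generalize (wzeta a b (RtoC w1)); intros [u v].
    components; f_equal; field; lra.
  + intros s; now apply hyp_curvature_ex_derive.
  + rewrite <- (hyp_curvature_periodic G x y L 0 Hper); f_equal; unfold L; ring.
Qed.

(** * The Hopf map in the moving frame of a lift *)

Definition hopf_vec (p1 p2 q1 q2 : R) : R3 :=
  (2 * (p1 * q1 + p2 * q2), 2 * (p2 * q1 - p1 * q2), p1 ^ 2 + p2 ^ 2 - (q1 ^ 2 + q2 ^ 2)).

Lemma hopf_unit p1 p2 q1 q2 : p1 ^ 2 + p2 ^ 2 + q1 ^ 2 + q2 ^ 2 = 1 ->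
  hopf ((p1, p2), (q1, q2)) = hopf_vec p1 p2 q1 q2.
Proof.
intros H; unfold hopf, hopf_vec; cbn [fst snd].
assert (E1 : Cmod (p1, p2) ^ 2 = p1 ^ 2 + p2 ^ 2).
{ unfold Cmod; cbn [fst snd]; apply pow2_sqrt; nra. }
assert (E2 : Cmod (q1, q2) ^ 2 = q1 ^ 2 + q2 ^ 2).
{ unfold Cmod; cbn [fst snd]; apply pow2_sqrt; nra. }
rewrite E1, E2; replace (p1 ^ 2 + p2 ^ 2 + (q1 ^ 2 + q2 ^ 2)) with 1 by lra.
components; f_equal; [f_equal|]; field.
Qed.

(* Decomposition of a vector in the basis l, il, jl, ijl of R^4 = C^2. *)
Definition frame_vec (p1 p2 q1 q2 x1 x2 y1 y2 : R) : R4 :=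
  ((x1 * p1 - x2 * p2 - (y1 * q1 + y2 * q2), x1 * p2 + x2 * p1 - (y2 * q1 - y1 * q2)),
   (x1 * q1 - x2 * q2 + (y1 * p1 + y2 * p2), x1 * q2 + x2 * q1 + (y2 * p1 - y1 * p2))).

Lemma frame_decomposition p1 p2 q1 q2 a1 a2 b1 b2 :
  p1 ^ 2 + p2 ^ 2 + q1 ^ 2 + q2 ^ 2 = 1 ->
  ((a1, a2), (b1, b2)) = frame_vec p1 p2 q1 q2
    (a1 * p1 + a2 * p2 + b1 * q1 + b2 * q2)
    (a2 * p1 - a1 * p2 + b2 * q1 - b1 * q2)
    (b1 * p1 - b2 * p2 - (a1 * q1 - a2 * q2))
    (b1 * p2 + b2 * p1 - (a1 * q2 + a2 * q1)).
Proof.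
intros H; unfold frame_vec; f_equal; f_equal.
- rewrite <- (Rmult_1_r a1) at 1; rewrite <- H; ring.
- rewrite <- (Rmult_1_r a2) at 1; rewrite <- H; ring.
- rewrite <- (Rmult_1_r b1) at 1; rewrite <- H; ring.
- rewrite <- (Rmult_1_r b2) at 1; rewrite <- H; ring.
Qed.

Definition times_i (v : R4) : R4 := ((Ci * fst v)%C, (Ci * snd v)%C).

(** In this and the following identities the two sides are homogeneous of different degrees in l.
    Multiplying by a power of |l|^2 = 1 equalizes the degrees and leaves a polynomial identity. *)
Lemma hopf_area_algebra p1 p2 q1 q2 al b1 b2 :
  p1 ^ 2 + p2 ^ 2 + q1 ^ 2 + q2 ^ 2 = 1 ->
  let l := ((p1, p2), (q1, q2)) in
  let l1 := frame_vec p1 p2 q1 q2 0 al b1 b2 in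
  dot4 l1 (times_i l) = al /\ dot4 l1 l1 = al ^ 2 + (b1 ^ 2 + b2 ^ 2).
Proof.
intros H l l1; unfold l, l1, dot4, frame_vec, times_i; components; split.
- transitivity (al * (p1 ^ 2 + p2 ^ 2 + q1 ^ 2 + q2 ^ 2)); [ring|rewrite H; ring].
- transitivity ((al ^ 2 + (b1 ^ 2 + b2 ^ 2)) * (p1 ^ 2 + p2 ^ 2 + q1 ^ 2 + q2 ^ 2)); [ring|rewrite H; ring].
Qed.

(** For a Hopf torus the metric coefficients are F22 = 1 and F12 = al, and the second fundamental
    form vanishes on the fibre direction, so the first expression is the numerator of the mean
    curvature. The same [D] is found in the geodesic curvature of the image curve, which relates the
    two curvatures. *)
Lemma hopf_mean_algebra p1 p2 q1 q2 al b1 b2 x1 x2 y1 y2 :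
  p1 ^ 2 + p2 ^ 2 + q1 ^ 2 + q2 ^ 2 = 1 ->
  let l := ((p1, p2), (q1, q2)) in
  let l1 := frame_vec p1 p2 q1 q2 0 al b1 b2 in
  let l2 := frame_vec p1 p2 q1 q2 x1 x2 y1 y2 in
  let D := b1 * (y2 - 2 * al * b1) - b2 * (y1 + 2 * al * b2) in
  det4 l l1 (times_i l) l2 - 2 * al * det4 l l1 (times_i l) (times_i l1) = - D /\
  det4 l l1 (times_i l) (times_i (times_i l)) = 0.
Proof.
intros H l l1 l2 D; unfold l, l1, l2, det4, frame_vec, times_i; components; split; [|ring].
transitivity (- D * (p1 ^ 2 + p2 ^ 2 + q1 ^ 2 + q2 ^ 2) ^ 2); [unfold D; ring|rewrite H; ring].
Qed.

(** Together with [hopf_vec2]: the first two derivatives of [hopf_vec] along a curve with velocity v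
    and acceleration w. *)
Definition hopf_vec1 (p1 p2 q1 q2 : R) (v : R4) : R3 :=
  let '((a1, a2), (b1, b2)) := v in
  (2 * (a1 * q1 + p1 * b1 + a2 * q2 + p2 * b2),
   2 * (a2 * q1 + p2 * b1 - a1 * q2 - p1 * b2),
   2 * (p1 * a1 + p2 * a2 - (q1 * b1 + q2 * b2))).

Definition hopf_vec2 (p1 p2 q1 q2 : R) (v w : R4) : R3 :=
  let '((a1, a2), (b1, b2)) := v in
  let '((c1, c2), (d1, d2)) := w in
  (2 * (c1 * q1 + 2 * (a1 * b1) + p1 * d1 + c2 * q2 + 2 * (a2 * b2) + p2 * d2),
   2 * (c2 * q1 + 2 * (a2 * b1) + p2 * d1 - c1 * q2 - 2 * (a1 * b2) - p1 * d2),
   2 * (p1 * c1 + a1 ^ 2 + p2 * c2 + a2 ^ 2 - (q1 * d1 + b1 ^ 2 + q2 * d2 + b2 ^ 2))).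

Lemma hopf_curvature_algebra p1 p2 q1 q2 al b1 b2 x1 x2 y1 y2 :
  p1 ^ 2 + p2 ^ 2 + q1 ^ 2 + q2 ^ 2 = 1 ->
  let l1 := frame_vec p1 p2 q1 q2 0 al b1 b2 in
  let l2 := frame_vec p1 p2 q1 q2 x1 x2 y1 y2 in
  let h := hopf_vec p1 p2 q1 q2 in
  let h1 := hopf_vec1 p1 p2 q1 q2 l1 in
  let h2 := hopf_vec2 p1 p2 q1 q2 l1 l2 in
  let D := b1 * (y2 - 2 * al * b1) - b2 * (y1 + 2 * al * b2) in
  dot3 h1 h1 = 4 * (b1 ^ 2 + b2 ^ 2) /\ det3 h h1 h2 = - 4 * D.
Proof.
intros H l1 l2 h h1 h2 D.
unfold h1, h2, h, l1, l2, hopf_vec, hopf_vec1, hopf_vec2, frame_vec, det3, cross3, dot3;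
 cbn beta iota; split.
- transitivity (4 * (b1 ^ 2 + b2 ^ 2) * (p1 ^ 2 + p2 ^ 2 + q1 ^ 2 + q2 ^ 2) ^ 2); [ring|rewrite H; ring].
- transitivity (- 4 * D * (p1 ^ 2 + p2 ^ 2 + q1 ^ 2 + q2 ^ 2) ^ 3); [unfold D; ring|rewrite H; ring].
Qed.

(** [om] is the complex determinant of the lift and a vector r over P. By the first identity it
    vanishes only where the curve meets P; the second computes its angular velocity. *)
Lemma hopf_holonomy_algebra p1 p2 q1 q2 al b1 b2 r1 r2 t1 t2 :
  p1 ^ 2 + p2 ^ 2 + q1 ^ 2 + q2 ^ 2 = 1 -> r1 ^ 2 + r2 ^ 2 + t1 ^ 2 + t2 ^ 2 = 1 ->
  let l1 := frame_vec p1 p2 q1 q2 0 al b1 b2 in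
  let h := hopf_vec p1 p2 q1 q2 in
  let h1 := hopf_vec1 p1 p2 q1 q2 l1 in
  let P := hopf_vec r1 r2 t1 t2 in
  let om : C := ((p1, p2) * (t1, t2) - (q1, q2) * (r1, r2))%C in
  let om1 : C := (fst l1 * (t1, t2) - snd l1 * (r1, r2))%C in
  1 - dot3 h P = 2 * (fst om ^ 2 + snd om ^ 2) /\
  4 * Im (om1 * Cconj om)%C = 4 * al * (fst om ^ 2 + snd om ^ 2) - det3 P h h1.
Proof.
intros H HP l1 h h1 P om om1.
unfold om1, om, h1, l1, h, P, hopf_vec, hopf_vec1, frame_vec, det3, cross3, dot3; components; cbn beta iota; split.
- transitivity (((p1 ^ 2 + p2 ^ 2 + q1 ^ 2 + q2 ^ 2) * (r1 ^ 2 + r2 ^ 2 + t1 ^ 2 + t2 ^ 2)) -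
   (2 * (p1 * q1 + p2 * q2) * (2 * (r1 * t1 + r2 * t2)) +
 2 * (p2 * q1 - p1 * q2) * (2 * (r2 * t1 - r1 * t2)) +
 (p1 ^ 2 + p2 ^ 2 - (q1 ^ 2 + q2 ^ 2)) * (r1 ^ 2 + r2 ^ 2 - (t1 ^ 2 + t2 ^ 2))));
   [rewrite H, HP; ring|ring].
- match goal with |- ?A = 4 * al * ?B - ?D =>
    assert (E : (A - 4 * al * B) * (p1 ^ 2 + p2 ^ 2 + q1 ^ 2 + q2 ^ 2) = - D) by ring end.
  rewrite H in E; lra.
Qed.

Lemma velocity_components (c : R -> R3) s : velocity c s =
  (Derive (fun t => fst (fst (c t))) s, Derive (fun t => snd (fst (c t))) s,
   Derive (fun t => snd (c t)) s).
Proof. unfold velocity, D3; now rewrite !dirD_R. Qed.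

Lemma velocity_scal3 k (c : R -> R3) s : velocity (fun t => scal3 k (c t)) s = scal3 k (velocity c s).
Proof.
rewrite !velocity_components; unfold scal3.
f_equal; [f_equal|]; rewrite <- Derive_scal; apply Derive_ext; intros t; now destruct (c t) as [[? ?] ?].
Qed.

Lemma velocity_ext (c d : R -> R3) s : (forall t, c t = d t) -> velocity c s = velocity d s.
Proof. intros H; f_equal; now apply functional_extensionality. Qed.

Lemma velocity_hopf_vec p1 p2 q1 q2 : Cinf p1 -> Cinf p2 -> Cinf q1 -> Cinf q2 -> forall s,
  let v := fun s => hopf_vec (p1 s) (p2 s) (q1 s) (q2 s) in
  let l1 := fun s => ((Derive p1 s, Derive p2 s), (Derive q1 s, Derive q2 s)) in
  let l2 := fun s => ((Derive (Derive p1) s, Derive (Derive p2) s),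
                      (Derive (Derive q1) s, Derive (Derive q2) s)) in
  velocity v s = hopf_vec1 (p1 s) (p2 s) (q1 s) (q2 s) (l1 s) /\
  velocity (velocity v) s = hopf_vec2 (p1 s) (p2 s) (q1 s) (q2 s) (l1 s) (l2 s).
Proof.
intros H1 H2 H3 H4 s v l1 l2.
assert (E1 : forall s, velocity v s = hopf_vec1 (p1 s) (p2 s) (q1 s) (q2 s) (l1 s)).
{ clear s; intros s; rewrite velocity_components; unfold v, hopf_vec, hopf_vec1, l1; cbn [fst snd].
  pose proof (Cinf_ex_derive _ H1 s); pose proof (Cinf_ex_derive _ H2 s).
  pose proof (Cinf_ex_derive _ H3 s); pose proof (Cinf_ex_derive _ H4 s).
  f_equal; [f_equal|]; apply is_derive_unique; (auto_derive; [tauto|];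
   change (Derive (fun t => p1 t) s) with (Derive p1 s);
   change (Derive (fun t => p2 t) s) with (Derive p2 s);
   change (Derive (fun t => q1 t) s) with (Derive q1 s);
   change (Derive (fun t => q2 t) s) with (Derive q2 s); ring). }
split; [apply E1|].
rewrite (velocity_ext _ _ s E1); rewrite velocity_components; unfold hopf_vec1, hopf_vec2, l1, l2; cbn [fst snd].
pose proof (Cinf_is_derive _ H1 s) as D1; pose proof (Cinf_is_derive _ H2 s) as D2.
pose proof (Cinf_is_derive _ H3 s) as D3; pose proof (Cinf_is_derive _ H4 s) as D4.
pose proof (Cinf_ex_derive _ (Cinf_Derive _ H1) s) as D5.
pose proof (Cinf_ex_derive _ (Cinf_Derive _ H2) s) as D6.
pose proof (Cinf_ex_derive _ (Cinf_Derive _ H3) s) as D7.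
pose proof (Cinf_ex_derive _ (Cinf_Derive _ H4) s) as D8.
clear E1 v l1 l2 H1 H2 H3 H4.
generalize dependent (Derive p1); generalize dependent (Derive p2).
generalize dependent (Derive q1); generalize dependent (Derive q2).
intros b2 D4 D8 b1 D3 D7 a2 D2 D6 a1 D1 D5.
assert (X1 : ex_derive p1 s) by (eexists; exact D1).
assert (X2 : ex_derive p2 s) by (eexists; exact D2).
assert (X3 : ex_derive q1 s) by (eexists; exact D3).
assert (X4 : ex_derive q2 s) by (eexists; exact D4).
f_equal; [f_equal|]; apply is_derive_unique; (auto_derive; [tauto|];
 change (Derive (fun t => p1 t) s) with (Derive p1 s);
 change (Derive (fun t => p2 t) s) with (Derive p2 s);
 change (Derive (fun t => q1 t) s) with (Derive q1 s);
 change (Derive (fun t => q2 t) s) with (Derive q2 s);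
 change (Derive (fun t => a1 t) s) with (Derive a1 s);
 change (Derive (fun t => a2 t) s) with (Derive a2 s);
 change (Derive (fun t => b1 t) s) with (Derive b1 s);
 change (Derive (fun t => b2 t) s) with (Derive b2 s);
 rewrite (is_derive_unique _ _ _ D1), (is_derive_unique _ _ _ D2),
  (is_derive_unique _ _ _ D3), (is_derive_unique _ _ _ D4); ring).
Qed.

Definition lift (p1 p2 q1 q2 : R -> R) (s : R) : R4 := ((p1 s, p2 s), (q1 s, q2 s)).

Lemma D4_hopf_torus_e1 p1 p2 q1 q2 :
  (forall s, ex_derive p1 s) -> (forall s, ex_derive p2 s) ->
  (forall s, ex_derive q1 s) -> (forall s, ex_derive q2 s) ->
  D4 e1 (hopf_torus (lift p1 p2 q1 q2)) =
    hopf_torus (lift (Derive p1) (Derive p2) (Derive q1) (Derive q2)).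
Proof.
intros H1 H2 H3 H4; apply functional_extensionality; intros [s t].
unfold D4; rewrite !dirD_e1; unfold hopf_torus, lift; components.
f_equal; f_equal; rewrite ?Derive_minus, ?Derive_plus, ?Derive_scal; trivial;
 apply ex_derive_scal; auto.
Qed.

Lemma D4_hopf_torus_e2 l :
  D4 e2 (hopf_torus l) = hopf_torus (fun s => times_i (l s)).
Proof.
apply functional_extensionality; intros [s t].
unfold D4; rewrite !dirD_e2; unfold hopf_torus, times_i; components.
f_equal; f_equal; (apply is_derive_unique; auto_derive; [trivial|ring]).
Qed.

(** Multiplication by a unit complex number is an isometry, so the geometry is independent of the
    fibre coordinate and can be computed from the lift alone. Being of determinant one, it preserves
    [det4] as well. *)
Lemma dot4_hopf_torus l m p : dot4 (hopf_torus l p) (hopf_torus m p) = dot4 (l (fst p)) (m (fst p)).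
Proof.
unfold dot4, hopf_torus; destruct p as [s t]; cbn [fst snd].
pose proof (sin2_cos2_pow t) as H.
destruct (l s) as [[a1 a2] [a3 a4]], (m s) as [[b1 b2] [b3 b4]]; components.
transitivity ((a1 * b1 + a2 * b2 + a3 * b3 + a4 * b4) * (cos t ^ 2 + sin t ^ 2)); [ring|rewrite H; ring].
Qed.

Lemma det4_hopf_torus k l m n p :
  det4 (hopf_torus k p) (hopf_torus l p) (hopf_torus m p) (hopf_torus n p) =
  det4 (k (fst p)) (l (fst p)) (m (fst p)) (n (fst p)).
Proof.
unfold hopf_torus; destruct p as [s t]; cbn [fst snd].
pose proof (sin2_cos2_pow t) as H.
destruct (k s) as [[k1 k2] [k3 k4]], (l s) as [[l1 l2] [l3 l4]],
  (m s) as [[m1 m2] [m3 m4]], (n s) as [[n1 n2] [n3 n4]]; unfold det4; components.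
match goal with |- _ = ?D => transitivity (D * (cos t ^ 2 + sin t ^ 2) ^ 2); [ring|rewrite H; ring] end.
Qed.

Record unit_lift (G : R) (c : R -> R3) (p1 p2 q1 q2 : R -> R) : Prop := {
  ul_p1 : Cinf p1; ul_p2 : Cinf p2; ul_q1 : Cinf q1; ul_q2 : Cinf q2;
  ul_norm : forall s, p1 s ^ 2 + p2 s ^ 2 + q1 s ^ 2 + q2 s ^ 2 = 1;
  ul_hopf : forall s, scal3 (sqrt G) (c s) = hopf_vec (p1 s) (p2 s) (q1 s) (q2 s);
  ul_speed : forall s, sph_speed c s = 1
}.

Lemma unit_lift_exists G c l : sph_arclength G c -> hopf_lift G c l ->
  exists p1 p2 q1 q2, unit_lift G c p1 p2 q1 q2 /\ l = lift p1 p2 q1 q2.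
Proof.
intros [_ Hc] [[H1 [H2 [H3 H4]]] Hl].
exists (fun s => Re (fst (l s))), (fun s => Im (fst (l s))),
  (fun s => Re (snd (l s))), (fun s => Im (snd (l s))).
assert (E : forall s, l s = ((Re (fst (l s)), Im (fst (l s))), (Re (snd (l s)), Im (snd (l s))))).
{ intros s; now destruct (l s) as [[? ?] [? ?]]. }
assert (N : forall s, Re (fst (l s)) ^ 2 + Im (fst (l s)) ^ 2 + Re (snd (l s)) ^ 2 + Im (snd (l s)) ^ 2 = 1).
{ intros s; destruct (Hl s) as [Hn _]; unfold dot4 in Hn; rewrite <- Hn; ring. }
split; [|apply functional_extensionality; exact E].
constructor; try (apply smooth_curve_Cinf; assumption); [exact N| |apply Hc].
intros s; destruct (Hl s) as [_ Hh]; rewrite <- Hh, (E s) at 1; apply hopf_unit, N.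
Qed.

(* l' = i alpha l + (beta1 + i beta2) j l. *)
Definition hopf_alpha (p1 p2 q1 q2 : R -> R) (s : R) : R :=
  (Derive p2 s * p1 s - Derive p1 s * p2 s) + (Derive q2 s * q1 s - Derive q1 s * q2 s).

Definition hopf_beta1 (p1 p2 q1 q2 : R -> R) (s : R) : R :=
  Derive q1 s * p1 s - Derive q2 s * p2 s - (Derive p1 s * q1 s - Derive p2 s * q2 s).

Definition hopf_beta2 (p1 p2 q1 q2 : R -> R) (s : R) : R :=
  Derive q1 s * p2 s + Derive q2 s * p1 s - (Derive p1 s * q2 s + Derive p2 s * q1 s).

Lemma scal3_scal3 a b v : scal3 a (scal3 b v) = scal3 (a * b) v.
Proof. destruct v as [[x y] z]; unfold scal3; f_equal; [f_equal|]; ring. Qed.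

Lemma dot3_scal3 a b u v : dot3 (scal3 a u) (scal3 b v) = a * b * dot3 u v.
Proof. destruct u as [[x y] z], v as [[x' y'] z']; unfold scal3, dot3; ring. Qed.

Lemma det3_scal3 a b c u v w : det3 (scal3 a u) (scal3 b v) (scal3 c w) = a * b * c * det3 u v w.
Proof.
destruct u as [[x y] z], v as [[x' y'] z'], w as [[x2 y2] z2].
unfold det3, scal3, cross3, dot3; ring.
Qed.

Lemma unit_lift_frame G c p1 p2 q1 q2 s : unit_lift G c p1 p2 q1 q2 ->
  ((Derive p1 s, Derive p2 s), (Derive q1 s, Derive q2 s)) =
  frame_vec (p1 s) (p2 s) (q1 s) (q2 s) 0 (hopf_alpha p1 p2 q1 q2 s)
    (hopf_beta1 p1 p2 q1 q2 s) (hopf_beta2 p1 p2 q1 q2 s).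
Proof.
intros [H1 H2 H3 H4 HN _ _].
assert (T : Derive p1 s * p1 s + Derive p2 s * p2 s + Derive q1 s * q1 s + Derive q2 s * q2 s = 0).
{ pose proof (Cinf_is_derive _ H1 s) as D1; pose proof (Cinf_is_derive _ H2 s) as D2.
  pose proof (Cinf_is_derive _ H3 s) as D3; pose proof (Cinf_is_derive _ H4 s) as D4.
  assert (D : is_derive (fun t => p1 t * p1 t + p2 t * p2 t + q1 t * q1 t + q2 t * q2 t) s
    (2 * (Derive p1 s * p1 s + Derive p2 s * p2 s + Derive q1 s * q1 s + Derive q2 s * q2 s))).
  { eapply is_derive_value.
    - exact (is_derive_Rplus _ _ _ _ _ (is_derive_Rplus _ _ _ _ _ (is_derive_Rplus _ _ _ _ _
        (is_derive_Rmult _ _ _ _ _ D1 D1) (is_derive_Rmult _ _ _ _ _ D2 D2))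
        (is_derive_Rmult _ _ _ _ _ D3 D3)) (is_derive_Rmult _ _ _ _ _ D4 D4)).
    - real_eq; ring. }
  assert (D0 : is_derive (fun _ => 1) s
    (2 * (Derive p1 s * p1 s + Derive p2 s * p2 s + Derive q1 s * q1 s + Derive q2 s * q2 s))).
  { refine (is_derive_Rext _ _ _ _ _ D); intros t; pose proof (HN t); simpl in *; lra. }
  assert (E : 2 * (Derive p1 s * p1 s + Derive p2 s * p2 s + Derive q1 s * q1 s + Derive q2 s * q2 s) = 0);
    [|lra].
  transitivity (Derive (fun _ : R => 1) s); [symmetry; exact (is_derive_unique _ _ _ D0)|].
  exact (is_derive_unique _ _ _ (is_derive_Rconst 1 s)). }
rewrite (frame_decomposition _ _ _ _ (Derive p1 s) (Derive p2 s) (Derive q1 s) (Derive q2 s) (HN s)).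
rewrite T; unfold hopf_alpha, hopf_beta1, hopf_beta2; f_equal; ring.
Qed.

Lemma unit_lift_velocity G c p1 p2 q1 q2 s : 0 < G -> unit_lift G c p1 p2 q1 q2 ->
  let l1 := fun s => ((Derive p1 s, Derive p2 s), (Derive q1 s, Derive q2 s)) in
  let l2 := fun s => ((Derive (Derive p1) s, Derive (Derive p2) s),
                      (Derive (Derive q1) s, Derive (Derive q2) s)) in
  c s = scal3 (/ sqrt G) (hopf_vec (p1 s) (p2 s) (q1 s) (q2 s)) /\
  velocity c s = scal3 (/ sqrt G) (hopf_vec1 (p1 s) (p2 s) (q1 s) (q2 s) (l1 s)) /\
  velocity (velocity c) s = scal3 (/ sqrt G) (hopf_vec2 (p1 s) (p2 s) (q1 s) (q2 s) (l1 s) (l2 s)).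
Proof.
intros HG [H1 H2 H3 H4 _ Hh _] l1 l2.
assert (Hg : 0 < sqrt G) by now apply sqrt_lt_R0.
assert (Ec : forall s, c s = scal3 (/ sqrt G) (hopf_vec (p1 s) (p2 s) (q1 s) (q2 s))).
{ intros t; rewrite <- Hh, scal3_scal3, Rinv_l by lra.
  destruct (c t) as [[? ?] ?]; unfold scal3; f_equal; [f_equal|]; ring. }
destruct (velocity_hopf_vec p1 p2 q1 q2 H1 H2 H3 H4 s) as [E1 E2].
split; [apply Ec|split].
- rewrite (velocity_ext _ _ s Ec), velocity_scal3, E1; reflexivity.
- rewrite (velocity_ext (velocity c) (fun t => scal3 (/ sqrt G)
    (velocity (fun s => hopf_vec (p1 s) (p2 s) (q1 s) (q2 s)) t)) s).
  + rewrite velocity_scal3, E2; reflexivity.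
  + intros t; now rewrite (velocity_ext _ _ t Ec), velocity_scal3.
Qed.

Lemma unit_lift_curvature G c p1 p2 q1 q2 s : 0 < G -> unit_lift G c p1 p2 q1 q2 ->
  let h := hopf_vec (p1 s) (p2 s) (q1 s) (q2 s) in
  let h1 := hopf_vec1 (p1 s) (p2 s) (q1 s) (q2 s) ((Derive p1 s, Derive p2 s), (Derive q1 s, Derive q2 s)) in
  let h2 := hopf_vec2 (p1 s) (p2 s) (q1 s) (q2 s) ((Derive p1 s, Derive p2 s), (Derive q1 s, Derive q2 s))
    ((Derive (Derive p1) s, Derive (Derive p2) s), (Derive (Derive q1) s, Derive (Derive q2) s)) in
  dot3 h1 h1 = G /\ sph_curvature G c s = / G * det3 h h1 h2.
Proof.
intros HG Hu h h1 h2.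
assert (Hg : 0 < sqrt G) by now apply sqrt_lt_R0.
assert (Hg2 : sqrt G * sqrt G = G) by (apply sqrt_sqrt; lra).
destruct (unit_lift_velocity G c p1 p2 q1 q2 s HG Hu) as [E0 [E1 E2]].
fold h in E0; fold h1 in E1; fold h2 in E2; split.
- pose proof (ul_speed _ _ _ _ _ _ Hu s) as Hs; unfold sph_speed in Hs.
  rewrite E1, dot3_scal3 in Hs.
  assert (Hn : 0 <= / sqrt G * / sqrt G * dot3 h1 h1).
  { apply Rmult_le_pos.
    - left; apply Rmult_lt_0_compat; now apply Rinv_0_lt_compat.
    - destruct h1 as [[x y] z]; unfold dot3; nra. }
  pose proof (sqrt_sqrt _ Hn) as Hq; rewrite Hs in Hq.
  replace (dot3 h1 h1) with
    (/ sqrt G * / sqrt G * dot3 h1 h1 * (sqrt G * sqrt G)) by (field; lra).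
  rewrite <- Hq, Hg2; ring.
- unfold sph_curvature; rewrite E2, E1, (ul_hopf _ _ _ _ _ _ Hu s); fold h.
  replace h with (scal3 1 h) at 1 by (destruct h as [[? ?] ?]; unfold scal3; f_equal; [f_equal|]; ring).
  rewrite det3_scal3; f_equal.
  transitivity (/ (sqrt G * sqrt G)); [field; lra|now rewrite Hg2].
Qed.

(** The Hopf map doubles the length of horizontal vectors, and the curve on the unit sphere has
    speed sqrt G; hence the horizontal part of l' has squared length G / 4. The metric coefficients
    are al^2 + G / 4, al and 1, with the constant determinant G / 4. *)
Lemma hopf_torus_geometry G c p1 p2 q1 q2 s t : 0 < G -> unit_lift G c p1 p2 q1 q2 ->
  let f := hopf_torus (lift p1 p2 q1 q2) in let al := hopf_alpha p1 p2 q1 q2 s in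
  hopf_beta1 p1 p2 q1 q2 s ^ 2 + hopf_beta2 p1 p2 q1 q2 s ^ 2 = G / 4 /\
  area_density f (s, t) = sqrt G / 2 /\
  mean_curvature f (s, t) ^ 2 = sph_curvature G c s ^ 2 / G.
Proof.
intros HG Hu f al.
assert (Hg : 0 < sqrt G) by now apply sqrt_lt_R0.
assert (Hg2 : sqrt G * sqrt G = G) by (apply sqrt_sqrt; lra).
pose proof (ul_norm _ _ _ _ _ _ Hu s) as HN.
destruct (unit_lift_curvature G c p1 p2 q1 q2 s HG Hu) as [Hsp Hk].
pose proof (unit_lift_frame G c p1 p2 q1 q2 s Hu) as Ef; fold al in Ef.
set (b1 := hopf_beta1 p1 p2 q1 q2 s) in *; set (b2 := hopf_beta2 p1 p2 q1 q2 s) in *.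
destruct (hopf_area_algebra _ _ _ _ al b1 b2 HN) as [A1 A2].
set (w := ((Derive (Derive p1) s, Derive (Derive p2) s), (Derive (Derive q1) s, Derive (Derive q2) s))) in *.
pose proof (frame_decomposition (p1 s) (p2 s) (q1 s) (q2 s) (Derive (Derive p1) s) (Derive (Derive p2) s)
  (Derive (Derive q1) s) (Derive (Derive q2) s) HN) as Ew; fold w in Ew.
match type of Ew with _ = frame_vec _ _ _ _ ?a ?b ?c ?d =>
  set (x1 := a) in Ew; set (x2 := b) in Ew; set (y1 := c) in Ew; set (y2 := d) in Ew end.
destruct (hopf_mean_algebra _ _ _ _ al b1 b2 x1 x2 y1 y2 HN) as [M1 M2].
destruct (hopf_curvature_algebra _ _ _ _ al b1 b2 x1 x2 y1 y2 HN) as [K1 K2].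
rewrite Ef in Hsp, Hk; rewrite Ew in Hk; rewrite K1 in Hsp; rewrite K2 in Hk.
set (D := b1 * (y2 - 2 * al * b1) - b2 * (y1 + 2 * al * b2)) in *.
assert (Hb : b1 ^ 2 + b2 ^ 2 = G / 4) by lra.
split; [trivial|].
destruct Hu as [H1 H2 H3 H4 _ _ _].
pose proof (Cinf_ex_derive _ H1) as X1; pose proof (Cinf_ex_derive _ H2) as X2.
pose proof (Cinf_ex_derive _ H3) as X3; pose proof (Cinf_ex_derive _ H4) as X4.
pose proof (Cinf_ex_derive _ (Cinf_Derive _ H1)) as Y1; pose proof (Cinf_ex_derive _ (Cinf_Derive _ H2)) as Y2.
pose proof (Cinf_ex_derive _ (Cinf_Derive _ H3)) as Y3; pose proof (Cinf_ex_derive _ (Cinf_Derive _ H4)) as Y4.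
set (l := lift p1 p2 q1 q2) in *.
assert (D1 : D4 e1 f = hopf_torus (lift (Derive p1) (Derive p2) (Derive q1) (Derive q2)))
  by now apply D4_hopf_torus_e1.
assert (D2 : D4 e2 f = hopf_torus (fun s => times_i (l s))) by apply D4_hopf_torus_e2.
assert (D11 : D4 e1 (D4 e1 f) = hopf_torus (lift (Derive (Derive p1)) (Derive (Derive p2)) (Derive (Derive q1)) (Derive (Derive q2))))
  by (rewrite D1; now apply D4_hopf_torus_e1).
assert (D22 : D4 e2 (D4 e2 f) = hopf_torus (fun s => times_i (times_i (l s))))
  by (rewrite D2; apply D4_hopf_torus_e2).
assert (D12 : D4 e1 (D4 e2 f) = hopf_torus (fun s => times_i (lift (Derive p1) (Derive p2) (Derive q1) (Derive q2) s))).
{ rewrite D2.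
  replace (fun s => times_i (l s)) with (lift (fun s => - p2 s) p1 (fun s => - q2 s) q1).
  - assert (Z2 : forall u, ex_derive (fun s : R => - p2 s) u)
      by (intros u; exact (ex_derive_opp p2 u (X2 u))).
    assert (Z4 : forall u, ex_derive (fun s : R => - q2 s) u)
      by (intros u; exact (ex_derive_opp q2 u (X4 u))).
    rewrite (D4_hopf_torus_e1 _ _ _ _ Z2 X1 Z4 X3).
    f_equal; apply functional_extensionality; intros u; unfold lift, times_i; components.
    rewrite !Derive_opp; f_equal; f_equal; ring.
  - apply functional_extensionality; intros u; unfold l, lift, times_i; components; f_equal; f_equal; ring. }
assert (Ew' : lift (Derive (Derive p1)) (Derive (Derive p2)) (Derive (Derive q1)) (Derive (Derive q2)) s = w) by reflexivity.
assert (Ef' : lift (Derive p1) (Derive p2) (Derive q1) (Derive q2) s =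
  frame_vec (p1 s) (p2 s) (q1 s) (q2 s) 0 al b1 b2) by exact Ef.
assert (El : l s = ((p1 s, p2 s), (q1 s, q2 s))) by reflexivity.
assert (F11 : fund1 f e1 e1 (s, t) = al ^ 2 + (b1 ^ 2 + b2 ^ 2)).
{ unfold fund1; rewrite D1, dot4_hopf_torus; cbn [fst]; rewrite Ef'; exact A2. }
assert (F12 : fund1 f e1 e2 (s, t) = al).
{ unfold fund1; rewrite D1, D2, dot4_hopf_torus; cbn [fst]; rewrite Ef', El; exact A1. }
assert (F22 : fund1 f e2 e2 (s, t) = 1).
{ unfold fund1; rewrite D2, dot4_hopf_torus; cbn [fst]; rewrite El; unfold dot4, times_i; components.
  transitivity (p1 s ^ 2 + p2 s ^ 2 + q1 s ^ 2 + q2 s ^ 2); [ring|exact HN]. }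
assert (Ha : area_density f (s, t) = sqrt G / 2).
{ unfold area_density; rewrite F11, F12, F22, Hb.
  replace ((al ^ 2 + G / 4) * 1 - al ^ 2) with ((sqrt G / 2) ^ 2).
  - apply sqrt_pow2; lra.
  - replace ((sqrt G / 2) ^ 2) with (sqrt G * sqrt G / 4) by field; rewrite Hg2; ring. }
split; [trivial|].
assert (N11 : fund2 f e1 e1 (s, t) - 2 * al * fund2 f e1 e2 (s, t) = - D / (sqrt G / 2)).
{ unfold fund2; rewrite Ha, D11, D12, D1, D2; unfold f at 1 2.
  rewrite !det4_hopf_torus; cbn [fst]; rewrite Ew', Ef', El, Ew, <- M1; field; lra. }
assert (N22 : fund2 f e2 e2 (s, t) = 0).
{ unfold fund2; rewrite D22, D1, D2; unfold f at 1; rewrite det4_hopf_torus; cbn [fst].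
  rewrite Ef', El, M2; unfold Rdiv; ring. }
unfold mean_curvature; rewrite F11, F12, F22, N22, Ha, Hk.
replace (1 * fund2 f e1 e1 (s, t) - 2 * al * fund2 f e1 e2 (s, t) + (al ^ 2 + (b1 ^ 2 + b2 ^ 2)) * 0)
  with (- D / (sqrt G / 2)) by (rewrite <- N11; ring).
transitivity (D ^ 2 / (sqrt G * sqrt G * (sqrt G * sqrt G) * (sqrt G * sqrt G)) * 16);
  [field; lra|rewrite Hg2; field; lra].
Qed.

(** * Holonomy and the area form *)

Lemma sph_curvature_Cinf G c : sph_arclength G c -> Cinf (sph_curvature G c).
Proof.
intros [[H1 [H2 H3]] _].
apply smooth_curve_Cinf in H1; apply smooth_curve_Cinf in H2; apply smooth_curve_Cinf in H3.
set (c1 := fun t => fst (fst (c t))) in *; set (c2 := fun t => snd (fst (c t))) in *.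
set (c3 := fun t => snd (c t)) in *.
replace (sph_curvature G c) with (fun s => sqrt G * (
  c1 s * (Derive c2 s * Derive (Derive c3) s - Derive c3 s * Derive (Derive c2) s)
  + c2 s * (Derive c3 s * Derive (Derive c1) s - Derive c1 s * Derive (Derive c3) s)
  + c3 s * (Derive c1 s * Derive (Derive c2) s - Derive c2 s * Derive (Derive c1) s))).
- assert (M : forall f g h, Cinf f -> Cinf g -> Cinf h ->
    Cinf (fun s => f s * (Derive g s * Derive (Derive h) s - Derive h s * Derive (Derive g) s))).
  { intros f g h Hf Hg Hh; apply (Cinf_mult f); trivial.
    apply (Cinf_minus (fun s => Derive g s * Derive (Derive h) s)
      (fun s => Derive h s * Derive (Derive g) s)); apply Cinf_mult;
     repeat apply Cinf_Derive; trivial. }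
  apply (Cinf_mult (fun _ => sqrt G)); [apply Cinf_const|].
  pose proof (Cinf_plus _ _ (Cinf_plus _ _ (M _ _ _ H1 H2 H3) (M _ _ _ H2 H3 H1)) (M _ _ _ H3 H1 H2)) as H.
  exact H.
- apply functional_extensionality; intros s; unfold sph_curvature.
  rewrite (velocity_components (velocity c)), (velocity_components c).
  replace (fun t => fst (fst (velocity c t))) with (Derive c1)
    by (apply functional_extensionality; intros t; now rewrite velocity_components).
  replace (fun t => snd (fst (velocity c t))) with (Derive c2)
    by (apply functional_extensionality; intros t; now rewrite velocity_components).
  replace (fun t => snd (velocity c t)) with (Derive c3)
    by (apply functional_extensionality; intros t; now rewrite velocity_components).
  assert (Ec : c s = (c1 s, c2 s, c3 s)) by (unfold c1, c2, c3; now destruct (c s) as [[? ?] ?]).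
  fold c1 c2 c3; rewrite Ec; unfold det3, scal3, dot3, cross3; ring.
Qed.

Lemma velocity_periodic c L : (forall s, c (s + L) = c s) ->
  forall s, velocity c (s + L) = velocity c s.
Proof.
intros H s; rewrite !velocity_components; f_equal; [f_equal|];
 apply (Derive_periodic (fun t => _) L); intros t; now rewrite H.
Qed.

Lemma sph_curvature_periodic G c L s : (forall s, c (s + L) = c s) ->
  sph_curvature G c (s + L) = sph_curvature G c s.
Proof.
intros H; unfold sph_curvature.
pose proof (velocity_periodic c L H) as H1; pose proof (velocity_periodic _ L H1) as H2.
now rewrite H, H1, H2.
Qed.

Lemma willmore_hopf G c p1 p2 q1 q2 L : 0 < G -> sph_arclength G c -> unit_lift G c p1 p2 q1 q2 ->
  willmore L (2 * PI) (hopf_torus (lift p1 p2 q1 q2)) =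
    PI / sqrt G * (RInt (fun s => sph_curvature G c s ^ 2) 0 L + G * L).
Proof.
intros HG Hc Hu; unfold willmore; set (k := sph_curvature G c).
assert (Hg : 0 < sqrt G) by now apply sqrt_lt_R0.
assert (Hg2 : sqrt G * sqrt G = G) by (apply sqrt_sqrt; lra).
transitivity (RInt (fun s => 2 * PI * ((k s ^ 2 / G + 1) * (sqrt G / 2))) 0 L).
{ apply RInt_ext; intros s _; rewrite <- (RInt_const_R _ (2 * PI)); apply RInt_ext; intros t _.
  destruct (hopf_torus_geometry G c p1 p2 q1 q2 s t HG Hu) as [_ [Ha Hm]].
  apply (f_equal2 Rmult); [apply (f_equal2 Rplus); [exact Hm|reflexivity]|exact Ha]. }
pose proof (sph_curvature_Cinf G c Hc) as Hk; fold k in Hk.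
assert (Hk2 : forall s, continuous (fun s => k s ^ 2) s).
{ intros s; apply continuous_ex_derive; auto_derive; apply (Cinf_ex_derive _ Hk). }
assert (HKe : exists K : R -> R, (forall s, is_derive K s (k s ^ 2)) /\
  K 0 = 0 /\ K L = RInt (fun s => k s ^ 2) 0 L).
{ exists (fun t => RInt (fun s => k s ^ 2) 0 t); split; [now apply is_derive_primitive|].
  split; [apply (RInt_point (V := R_CompleteNormedModule))|trivial]. }
destruct HKe as [K [HK [HK0 HKL]]]; rewrite <- HKL.
rewrite (RInt_antiderivative (fun s => PI / sqrt G * (K s + G * s))).
- rewrite HK0; real_eq; ring.
- intros s; eapply is_derive_value.
  + apply is_derive_Rmult; [apply is_derive_Rconst|].
    apply is_derive_Rplus; [exact (HK s)|].
    apply is_derive_Rmult; [apply is_derive_Rconst|apply is_derive_Rid].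
  + real_eq; transitivity (PI / sqrt G * (k s ^ 2 + sqrt G * sqrt G)); [rewrite Hg2; field; lra|].
    transitivity (PI * (k s ^ 2 / (sqrt G * sqrt G) + 1) * sqrt G); [field; lra|rewrite Hg2; field; lra].
- intros s; apply continuous_ex_derive; auto_derive; apply (Cinf_ex_derive _ Hk).
Qed.

Lemma hopf_vec_surjective (P : R3) : dot3 P P = 1 ->
  exists r1 r2 t1 t2, r1 ^ 2 + r2 ^ 2 + t1 ^ 2 + t2 ^ 2 = 1 /\ hopf_vec r1 r2 t1 t2 = P.
Proof.
destruct P as [[x y] z]; unfold dot3, hopf_vec; intros H.
destruct (Req_dec z (-1)) as [->|Hz].
(* The section used in the other case divides by a first entry that vanishes at this pole. *)
- exists 0, 0, 1, 0; split; [ring|].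
  assert (x = 0) by nra; assert (y = 0) by nra; subst; f_equal; [f_equal|]; ring.
- assert (Hz' : 0 < (1 + z) / 2) by nra.
  set (r := sqrt ((1 + z) / 2)); assert (Hr : 0 < r) by now apply sqrt_lt_R0.
  assert (Hr2 : r ^ 2 = (1 + z) / 2) by (apply pow2_sqrt; lra).
  (* The point of the fibre whose first entry is real and positive; the third coordinate r^2 - (1 -
     r^2) = z determines r. *)
  exists r, 0, (x / (2 * r)), (- y / (2 * r)).
  assert (E : (x / (2 * r)) ^ 2 + (- y / (2 * r)) ^ 2 = (1 - z) / 2).
  { transitivity ((x * x + y * y) / (4 * r ^ 2)); [field; lra|].
    rewrite Hr2; replace (x * x + y * y) with ((1 - z) * (1 + z)) by lra; field; lra. }
  split.
  { transitivity (r ^ 2 + ((x / (2 * r)) ^ 2 + (- y / (2 * r)) ^ 2)); [ring|rewrite E, Hr2; field]. }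
  f_equal; [f_equal; field; lra|]; rewrite E, Hr2; field.
Qed.

(* The pull-back under h of a primitive of the area form of the unit sphere
   punctured at P. *)
Definition theta_form (P : R3) (h : R -> R3) (s : R) : R :=
  - det3 P (h s) (velocity h s) / (1 - dot3 (h s) P).

Lemma dot3_lt_1 (u v : R3) : dot3 u u = 1 -> dot3 v v = 1 -> u <> v -> dot3 u v < 1.
Proof.
destruct u as [[x y] z], v as [[x' y'] z']; unfold dot3; intros H1 H2 H.
apply Rnot_le_lt; intros Hle; apply H.
assert (E : (x - x') * (x - x') + (y - y') * (y - y') + (z - z') * (z - z') <= 0) by lra.
assert (Hz : forall t r s, t * t + r * r + s * s <= 0 -> t = 0).
{ intros t r s Hs; apply Rsqr_0_uniq; unfold Rsqr; nra. }
pose proof (Hz (x - x') (y - y') (z - z') ltac:(lra)).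
pose proof (Hz (y - y') (x - x') (z - z') ltac:(lra)).
pose proof (Hz (z - z') (x - x') (y - y') ltac:(lra)).
f_equal; [f_equal|]; lra.
Qed.

Lemma hopf_vec_norm p1 p2 q1 q2 : p1 ^ 2 + p2 ^ 2 + q1 ^ 2 + q2 ^ 2 = 1 ->
  dot3 (hopf_vec p1 p2 q1 q2) (hopf_vec p1 p2 q1 q2) = 1.
Proof.
intros H; unfold dot3, hopf_vec.
transitivity ((p1 ^ 2 + p2 ^ 2 + q1 ^ 2 + q2 ^ 2) ^ 2); [ring|rewrite H; ring].
Qed.

Lemma hopf_alpha_Cinf G c p1 p2 q1 q2 : unit_lift G c p1 p2 q1 q2 -> Cinf (hopf_alpha p1 p2 q1 q2).
Proof.
intros [H1 H2 H3 H4 _ _ _].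
assert (M : forall f g, Cinf f -> Cinf g -> Cinf (fun s => Derive f s * g s - Derive g s * f s)).
{ intros f g Hf Hg.
  apply (Cinf_minus (fun s => Derive f s * g s) (fun s => Derive g s * f s));
   apply Cinf_mult; trivial; now apply Cinf_Derive. }
exact (Cinf_plus _ _ (M _ _ H2 H1) (M _ _ H4 H3)).
Qed.

(* If r in C^2 lies over P, then det (l, r) is a closed curve in C minus 0 whose
   logarithmic derivative has the imaginary part alpha + theta / 2. *)
Lemma holonomy_theta G c p1 p2 q1 q2 L P : 0 < G -> unit_lift G c p1 p2 q1 q2 ->
  (forall s, lift p1 p2 q1 q2 (s + L) = lift p1 p2 q1 q2 s) ->
  dot3 P P = 1 -> (forall s, scal3 (sqrt G) (c s) <> P) ->
  let th := theta_form P (fun s => scal3 (sqrt G) (c s)) in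
  (forall s, continuous th s) /\
  exists k : Z, RInt th 0 L = 4 * PI * IZR k - 2 * RInt (hopf_alpha p1 p2 q1 q2) 0 L.
Proof.
intros HG Hu Hper HP Hne th.
destruct (hopf_vec_surjective P HP) as [r1 [r2 [t1 [t2 [Hn HPe]]]]].
pose proof Hu as [H1 H2 H3 H4 HN Hh _].
set (al := hopf_alpha p1 p2 q1 q2).
set (om := fun s => ((p1 s, p2 s) * (t1, t2) - (q1 s, q2 s) * (r1, r2))%C).
set (om1 := fun s => ((Derive p1 s, Derive p2 s) * (t1, t2) - (Derive q1 s, Derive q2 s) * (r1, r2))%C).
assert (Hcd : forall (f g : R -> R), Cinf f -> Cinf g -> forall s,
  cderiv (fun t => (f t, g t) : C) s (Derive f s, Derive g s)).
{ intros f g Hf Hg s; split; [exact (Cinf_is_derive _ Hf s)|exact (Cinf_is_derive _ Hg s)]. }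
assert (Hom : forall s, cderiv om s (om1 s)).
{ intros s; unfold om, om1; apply cderiv_minus.
  - eapply cderiv_value; [apply cderiv_mult; [now apply Hcd|apply cderiv_const]|cbv beta; ring].
  - eapply cderiv_value; [apply cderiv_mult; [now apply Hcd|apply cderiv_const]|cbv beta; ring]. }
assert (Hom1 : forall s, exists d, cderiv om1 s d).
{ intros s; eexists; unfold om1; apply cderiv_minus.
  - apply cderiv_mult; [apply Hcd; now apply Cinf_Derive|apply cderiv_const].
  - apply cderiv_mult; [apply Hcd; now apply Cinf_Derive|apply cderiv_const]. }
assert (Halg : forall s, 1 - dot3 (scal3 (sqrt G) (c s)) P = 2 * (fst (om s) ^ 2 + snd (om s) ^ 2) /\
  4 * Im (om1 s * Cconj (om s))%C = 4 * al s * (fst (om s) ^ 2 + snd (om s) ^ 2)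
    - det3 P (scal3 (sqrt G) (c s)) (velocity (fun s => scal3 (sqrt G) (c s)) s)).
{ intros s.
  pose proof (hopf_holonomy_algebra (p1 s) (p2 s) (q1 s) (q2 s) (al s) (hopf_beta1 p1 p2 q1 q2 s)
    (hopf_beta2 p1 p2 q1 q2 s) r1 r2 t1 t2 (HN s) Hn) as H; cbv zeta in H.
  rewrite HPe in H; unfold al in H; rewrite <- (unit_lift_frame G c p1 p2 q1 q2 s Hu) in H.
  destruct (velocity_hopf_vec p1 p2 q1 q2 H1 H2 H3 H4 s) as [V _].
  rewrite (velocity_ext _ _ s Hh), V, Hh; exact H. }
assert (Hpos : forall s, 0 < fst (om s) ^ 2 + snd (om s) ^ 2).
{ intros s; destruct (Halg s) as [E _].
  pose proof (dot3_lt_1 (scal3 (sqrt G) (c s)) P) as Hlt.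
  rewrite Hh in Hlt at 1 2; specialize (Hlt (hopf_vec_norm _ _ _ _ (HN s)) HP (Hne s)); lra. }
assert (Hom0 : forall s, om s <> RtoC 0).
{ intros s E; pose proof (Hpos s) as H; rewrite E in H; simpl in H; lra. }
set (phi := fun s => (om1 s * / om s)%C).
assert (Hphi : forall s, Im (phi s) = al s + th s / 2).
{ intros s; destruct (Halg s) as [E1 E2]; specialize (Hpos s).
  unfold th, theta_form; rewrite E1.
  replace (det3 P (scal3 (sqrt G) (c s)) (velocity (fun s => scal3 (sqrt G) (c s)) s))
    with (4 * al s * (fst (om s) ^ 2 + snd (om s) ^ 2) - 4 * Im (om1 s * Cconj (om s))%C) by lra.
  unfold phi; revert Hpos; destruct (om s) as [u v], (om1 s) as [u1 v1].
  unfold Cinv; components; intros Hpos; field; lra. }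
assert (Hphid : forall s, exists d, cderiv phi s d).
{ intros s; destruct (Hom1 s) as [d Hd]; eexists; unfold phi; apply cderiv_mult; [exact Hd|].
  apply (cderiv_inv om); [apply Hom0|apply Hom]. }
destruct (cderiv_primitive phi) as [Phi HPhi].
{ intros s; destruct (Hphid s) as [d Hd]; apply (cderiv_continuous _ _ _ Hd). }
{ intros s; destruct (Hphid s) as [d Hd]; apply (cderiv_continuous _ _ _ Hd). }
assert (Hal : Cinf al) by exact (hopf_alpha_Cinf G c p1 p2 q1 q2 Hu).
assert (Eth : forall s, th s = 2 * Im (phi s) - 2 * al s) by (intros s; rewrite Hphi; field).
assert (Hc : forall s, continuous th s).
{ intros s; apply (continuous_ext (fun s => 2 * Im (phi s) - 2 * al s)); [intros; now rewrite Eth|].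
  destruct (Hphid s) as [d Hd].
  apply (continuous_minus (fun s => 2 * Im (phi s)) (fun s => 2 * al s)).
  - apply (continuous_scal_r 2 (fun s => Im (phi s))), (cderiv_continuous _ _ _ Hd).
  - apply (continuous_scal_r 2 al), Cinf_continuous, Hal. }
split; trivial.
pose proof (cderiv_logarithmic om phi Phi) as Hlog.
assert (Hg : forall s, cderiv om s (phi s * om s)%C).
{ intros s; eapply cderiv_value; [apply Hom|]; unfold phi; field; apply Hom0. }
specialize (Hlog Hg HPhi 0 L).
assert (HomL : om L = om 0).
{ pose proof (Hper 0) as E; rewrite Rplus_0_l in E; unfold lift in E; injection E as E1 E2 E3 E4.
  unfold om; now rewrite E1, E2, E3, E4. }
destruct (Cexp_eq_1 (Phi L - Phi 0)%C) as [k Hk].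
{ rewrite HomL in Hlog; replace (Cexp (Phi L - Phi 0)) with (/ om 0 * (om 0 * Cexp (Phi L - Phi 0)))%C
    by (field; apply Hom0).
  rewrite <- Hlog; field; apply Hom0. }
exists k.
assert (HKe : exists K : R -> R, (forall s, is_derive K s (al s)) /\ K 0 = 0 /\ K L = RInt al 0 L).
{ exists (fun t => RInt al 0 t); split; [apply is_derive_primitive, Cinf_continuous, Hal|].
  split; [apply (RInt_point (V := R_CompleteNormedModule))|trivial]. }
destruct HKe as [K [HK [HK0 HKL]]]; rewrite <- HKL.
rewrite (RInt_antiderivative (fun s => 2 * Im (Phi s) - 2 * K s)); trivial.
- apply (f_equal Im) in Hk; revert Hk; destruct (Phi L) as [u v], (Phi 0) as [u' v']; components.
  intros Hk; rewrite HK0; real_eq; lra.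
- intros s; eapply is_derive_value.
  + apply is_derive_Rminus; apply is_derive_Rmult;
     [apply is_derive_Rconst|exact (proj2 (HPhi s))|apply is_derive_Rconst|exact (HK s)].
  + rewrite Eth; real_eq; ring.
Qed.

Lemma Cinf_primitive B f : (forall s, is_derive B s (f s)) -> Cinf f -> Cinf B.
Proof.
intros HB Hf [|n]; [easy|split].
- intros s; eexists; apply HB.
- replace (Derive B) with f; [apply Hf|].
  apply functional_extensionality; intros s; symmetry; apply is_derive_unique, HB.
Qed.

Lemma primitive_periodic B f L : (forall s, is_derive B s (f s)) -> (forall s, f (s + L) = f s) ->
  forall s (k : Z), B (s + IZR k * L) = B s + IZR k * (B L - B 0).
Proof.
intros HB Hf.
assert (H1 : forall s, B (s + L) - B s = B L - B 0).
{ intros s; replace L with (0 + L) at 2 by ring.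
  apply (is_derive_0_const (fun s => B (s + L) - B s)); intros t.
  eapply is_derive_value.
  - apply is_derive_Rminus; [|exact (HB t)].
    apply (is_derive_comp B (fun u => u + L) t (f (t + L)) 1); [apply HB|].
    eapply is_derive_value; [exact (is_derive_Rplus _ _ _ _ _ (is_derive_Rid t) (is_derive_Rconst L t))|].
    ring.
  - unfold scal; simpl; unfold mult; simpl; rewrite Hf; real_eq; ring. }
assert (H2 : forall (n : nat) s, B (s + INR n * L) = B s + INR n * (B L - B 0)).
{ induction n as [|n IH]; intros s.
  - simpl INR; rewrite !Rmult_0_l, !Rplus_0_r; trivial.
  - rewrite S_INR; replace (s + (INR n + 1) * L) with ((s + INR n * L) + L) by ring.
    pose proof (H1 (s + INR n * L)); pose proof (IH s); lra. }
intros s k; destruct (Z.abs_eq_or_opp k) as [E|E]; rewrite <- Zabs2Nat.id_abs in E.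
- rewrite <- E, <- INR_IZR_INZ; apply H2.
- replace k with (- Z.of_nat (Z.abs_nat k))%Z by lia.
  rewrite opp_IZR, <- INR_IZR_INZ.
  pose proof (H2 (Z.abs_nat k) (s + - INR (Z.abs_nat k) * L)) as E2.
  replace (s + - INR (Z.abs_nat k) * L + INR (Z.abs_nat k) * L) with s in E2 by ring; lra.
Qed.

(** The metric of the torus is (dt + al ds)^2 + (G / 4) ds^2. With an antiderivative B of al, the
    coordinates u = - t - B(s) and v = sqrt G s / 2 make it du^2 + dv^2. Then s -> s + L shifts u by
    minus the integral of al, which is G A / 2 modulo 2 pi. The sign of u is chosen to obtain G A /
    2 and not its negative. *)
Lemma conformal_class_hopf G c p1 p2 q1 q2 L A (j : Z) : 0 < G -> 0 < L ->
  unit_lift G c p1 p2 q1 q2 ->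
  (forall s, lift p1 p2 q1 q2 (s + L) = lift p1 p2 q1 q2 s) ->
  G * A / 2 = 2 * PI * IZR j - RInt (hopf_alpha p1 p2 q1 q2) 0 L ->
  conformal_class L (2 * PI) (hopf_torus (lift p1 p2 q1 q2))
    (RtoC (2 * PI)) (RtoC (G * A / 2) + Ci * RtoC (sqrt G * L / 2))%C.
Proof.
intros HG HL Hu Hper HA.
set (al := hopf_alpha p1 p2 q1 q2) in *.
pose proof (hopf_alpha_Cinf G c p1 p2 q1 q2 Hu) as Hal; fold al in Hal.
assert (Hg : 0 < sqrt G) by now apply sqrt_lt_R0.
assert (Hg2 : sqrt G * sqrt G = G) by (apply sqrt_sqrt; lra).
set (g := sqrt G) in *; pose proof PI_RGT_0 as Hpi.
assert (HBe : exists B : R -> R, (forall s, is_derive B s (al s)) /\ B 0 = 0 /\ B L = RInt al 0 L).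
{ exists (fun t => RInt al 0 t); split; [apply is_derive_primitive, Cinf_continuous, Hal|].
  split; [apply (RInt_point (V := R_CompleteNormedModule))|trivial]. }
destruct HBe as [B [HB [HB0 HBL]]].
pose proof (Cinf_primitive B al HB Hal) as HBC.
assert (Halp : forall s, al (s + L) = al s).
{ assert (Hp : forall s, p1 (s + L) = p1 s /\ p2 (s + L) = p2 s /\ q1 (s + L) = q1 s /\ q2 (s + L) = q2 s).
  { intros s; pose proof (Hper s) as E; unfold lift in E; injection E; auto. }
  assert (P1 : forall s, p1 (s + L) = p1 s) by (intros; apply Hp).
  assert (P2 : forall s, p2 (s + L) = p2 s) by (intros; apply Hp).
  assert (P3 : forall s, q1 (s + L) = q1 s) by (intros; apply Hp).
  assert (P4 : forall s, q2 (s + L) = q2 s) by (intros; apply Hp).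
  intros s; unfold al, hopf_alpha.
  now rewrite !(Derive_periodic _ _ P1), !(Derive_periodic _ _ P2), !(Derive_periodic _ _ P3),
    !(Derive_periodic _ _ P4), P1, P2, P3, P4. }
pose proof (primitive_periodic B al L HB Halp) as HBp.
rewrite <- HBL in HA; rewrite HB0 in HBp; rewrite HA; clear HBL HA.
split.
{ components; intros E.
  assert (0 < 2 * PI * (g * L / 2)).
  { apply Rmult_lt_0_compat; [lra|]; apply Rdiv_lt_0_compat; [now apply Rmult_lt_0_compat|lra]. }
  assert (2 * PI * (g * L / 2) = 0) by (rewrite <- E; ring); lra. }
exists (fun p => (2 / g * snd p, - fst p - B (2 / g * snd p))),
       (fun p => (- snd p - B (fst p), g / 2 * fst p)).
assert (Hridge : forall (f : R2 -> R) (u v : R -> R) a b c d, Cinf u -> Cinf v ->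
  (forall x y : R, f (x, y) = u (a * x + b * y) + v (c * x + d * y)) -> smooth f).
{ intros f u v a b c' d Hcu Hcv E.
  pose proof (smooth_ridge u v a b c' d Hcu Hcv) as H.
  replace f with (fun p : R2 => u (a * fst p + b * snd p) + v (c' * fst p + d * snd p)); [exact H|].
  apply functional_extensionality; intros [x y]; symmetry; apply E. }
pose proof (Cinf_opp _ HBC) as HBo.
split; [split|].
{ apply (Hridge _ (fun t => t) (fun _ => 0) 0 (2 / g) 0 0 Cinf_id (Cinf_const 0)).
  intros u v; cbn beta iota delta [fst snd]; real_eq; ring. }
{ apply (Hridge _ (fun t => t) (fun t => - B t) (-1) 0 0 (2 / g) Cinf_id HBo).
  intros u v; cbn beta iota delta [fst snd].
  replace (0 * u + 2 / g * v) with (2 / g * v) by ring; real_eq; ring. }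
split; [split|].
{ apply (Hridge _ (fun t => t) (fun t => - B t) 0 (-1) 1 0 Cinf_id HBo).
  intros u v; cbn beta iota delta [fst snd].
  replace (1 * u + 0 * v) with u by ring; real_eq; ring. }
{ apply (Hridge _ (fun t => t) (fun _ => 0) (g / 2) 0 0 0 Cinf_id (Cinf_const 0)).
  intros u v; cbn beta iota delta [fst snd]; real_eq; ring. }
split; [intros [u v]; change R in u, v; cbn beta iota delta [fst snd];
  refine (f_equal2 pair _ _); real_eq; [ring|field; lra]|].
split; [intros [u v]; change R in u, v; cbn beta iota delta [fst snd]|].
{ replace (2 / g * (g / 2 * u)) with u by (field; lra).
  refine (f_equal2 pair _ _); real_eq; ring. }
split.
{ intros [u v] [u' v']; change R in u, v, u', v'; rewrite !minus_components.
  cbn beta iota delta [fst snd].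
  set (s := 2 / g * v); set (s' := 2 / g * v').
  assert (Ev : v - v' = g / 2 * (s - s')) by (unfold s, s'; field; lra).
  split; intros [k Hk].
  - unfold latpt in Hk; revert Hk; change (minus (u, v) (u', v')) with (u - u', v - v').
    components; intros Hk; injection Hk as E1 E2.
    assert (Es : s = s' + IZR (snd k) * L).
    { apply (Rmult_eq_reg_l (g / 2)); [|lra]; lra. }
    (* G A / 2 agrees with the holonomy only modulo 2 pi, so the given generator differs from the
       actual translation by [j] turns of the fibre; the change of basis compensates for them. *)
    exists (snd k, - fst k - j * snd k)%Z; unfold latpt; cbn [fst snd].
    rewrite minus_IZR, opp_IZR, mult_IZR, Es, HBp; components; f_equal; lra.
  - unfold latpt in Hk; revert Hk; components; intros Hk; injection Hk as E1 E2.
    assert (Es : s = s' + IZR (fst k) * L) by lra.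
    exists (- snd k - j * fst k, fst k)%Z; unfold latpt; cbn [fst snd].
    rewrite Es, HBp in E2.
    change (minus (u, v) (u', v')) with (u - u', v - v'); rewrite Ev, Es.
    rewrite minus_IZR, opp_IZR, mult_IZR; components; f_equal; lra. }
intros [u v]; change R in u, v.
set (s := 2 / g * v); set (t := - u - B s).
destruct (hopf_torus_geometry G c p1 p2 q1 q2 s t HG Hu) as [Hb _].
pose proof (unit_lift_frame G c p1 p2 q1 q2 s Hu) as Ef; fold al in Ef.
destruct (hopf_area_algebra _ _ _ _ (al s) (hopf_beta1 p1 p2 q1 q2 s) (hopf_beta2 p1 p2 q1 q2 s)
  (ul_norm _ _ _ _ _ _ Hu s)) as [A1 A2].
rewrite <- Ef in A1, A2; rewrite Hb in A2.
pose proof (ul_norm _ _ _ _ _ _ Hu s) as HN.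
destruct Hu as [H1 H2 H3 H4 _ _ _].
(* The tangent vector x l' + y i l at s, kept constant so that the lemma on inner products of Hopf
   tori applies to it. *)
set (comb := fun x y => (lift (fun _ => x * Derive p1 s - y * p2 s) (fun _ => x * Derive p2 s + y * p1 s)
  (fun _ => x * Derive q1 s - y * q2 s) (fun _ => x * Derive q2 s + y * q1 s))).
assert (HD : forall v1 v2 : R,
  D4 (v1, v2) (fun q => hopf_torus (lift p1 p2 q1 q2) (2 / g * snd q, - fst q - B (2 / g * snd q))) (u, v) =
  hopf_torus (comb (2 / g * v2) (- v1 - al s * (2 / g * v2))) (s, t)).
{ intros v1 v2; set (x := 2 / g * v2); set (y := - v1 - al s * x).
  assert (Hs : forall (f : R -> R), Cinf f ->
    is_derive (fun h => f (2 / g * (v + h * v2))) 0 (x * Derive f s)).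
  { intros f Hf; apply (is_derive_Rext (fun h => f (s + h * x))).
    - intros h; f_equal; unfold s, x; ring.
    - apply is_derive_along, Cinf_is_derive, Hf. }
  assert (Ht0 : is_derive (fun h => - (u + h * v1) - B (2 / g * (v + h * v2))) 0 y).
  { eapply is_derive_value.
    - apply is_derive_Rminus; [|exact (Hs B HBC)].
      apply (is_derive_opp (fun h => u + h * v1) 0 v1), is_derive_affine.
    - unfold y; rewrite (is_derive_unique _ _ _ (HB s)); unfold opp; simpl; real_eq; ring. }
  assert (E0 : - (u + 0 * v1) - B (2 / g * (v + 0 * v2)) = t).
  { unfold t, s; rewrite !Rmult_0_l, !Rplus_0_r; reflexivity. }
  assert (Es0 : 2 / g * (v + 0 * v2) = s) by (unfold s; ring).
  assert (Hcos : is_derive (fun h => cos (- (u + h * v1) - B (2 / g * (v + h * v2)))) 0 (y * - sin t)).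
  { apply (is_derive_comp cos _ 0 (- sin t) y); [rewrite E0; apply is_derive_cos|exact Ht0]. }
  assert (Hsin : is_derive (fun h => sin (- (u + h * v1) - B (2 / g * (v + h * v2)))) 0 (y * cos t)).
  { apply (is_derive_comp sin _ 0 (cos t) y); [rewrite E0; apply is_derive_sin|exact Ht0]. }
  assert (K1 : forall f f' : R -> R, Cinf f -> Cinf f' ->
    Derive (fun h => cos (- (u + h * v1) - B (2 / g * (v + h * v2))) * f (2 / g * (v + h * v2))
      - sin (- (u + h * v1) - B (2 / g * (v + h * v2))) * f' (2 / g * (v + h * v2))) 0 =
    cos t * (x * Derive f s - y * f' s) - sin t * (x * Derive f' s + y * f s)).
  { intros f f' Hf Hf'; apply is_derive_unique; eapply is_derive_value.
    - exact (is_derive_Rminus _ _ _ _ _ (is_derive_Rmult _ _ _ _ _ Hcos (Hs f Hf))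
        (is_derive_Rmult _ _ _ _ _ Hsin (Hs f' Hf'))).
    - cbv beta; rewrite E0, Es0; real_eq; ring. }
  assert (K2 : forall f f' : R -> R, Cinf f -> Cinf f' ->
    Derive (fun h => cos (- (u + h * v1) - B (2 / g * (v + h * v2))) * f' (2 / g * (v + h * v2))
      + sin (- (u + h * v1) - B (2 / g * (v + h * v2))) * f (2 / g * (v + h * v2))) 0 =
    cos t * (x * Derive f' s + y * f s) + sin t * (x * Derive f s - y * f' s)).
  { intros f f' Hf Hf'; apply is_derive_unique; eapply is_derive_value.
    - exact (is_derive_Rplus _ _ _ _ _ (is_derive_Rmult _ _ _ _ _ Hcos (Hs f' Hf'))
        (is_derive_Rmult _ _ _ _ _ Hsin (Hs f Hf))).
    - cbv beta; rewrite E0, Es0; real_eq; ring. }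
  unfold D4, dirD, hopf_torus, comb, lift; components.
  refine (f_equal2 pair (f_equal2 pair _ _) (f_equal2 pair _ _)).
  - exact (K1 p1 p2 H1 H2).
  - exact (K2 p1 p2 H1 H2).
  - exact (K1 q1 q2 H3 H4).
  - exact (K2 q1 q2 H3 H4). }
exists 1; split; [lra|]; intros [v1 v2] [w1 w2]; change R in v1, v2, w1, w2.
unfold fund1; rewrite !HD, dot4_hopf_torus; unfold comb, lift; cbn [fst snd].
clear HD; set (x := 2 / g * v2); set (x' := 2 / g * w2).
assert (F12 : dot4 ((Derive p1 s, Derive p2 s), (Derive q1 s, Derive q2 s))
  (times_i ((p1 s, p2 s), (q1 s, q2 s))) = al s) by exact A1.
assert (F11 : dot4 ((Derive p1 s, Derive p2 s), (Derive q1 s, Derive q2 s))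
  ((Derive p1 s, Derive p2 s), (Derive q1 s, Derive q2 s)) = al s ^ 2 + G / 4) by exact A2.
unfold dot4, times_i in F11, F12 |- *; revert F11 F12; components; intros F11 F12.
set (y := - v1 - al s * x); set (y' := - w1 - al s * x').
match type of F11 with ?E = _ => match type of F12 with ?F = _ =>
  transitivity (x * x' * E + (x * y' + x' * y) * F
    + y * y' * (p1 s ^ 2 + p2 s ^ 2 + q1 s ^ 2 + q2 s ^ 2)); [real_eq; ring|] end end.
rewrite F11, F12, HN; unfold y, y'.
transitivity (x * x' * (G / 4) + v1 * w1); [ring|].
unfold x, x'; rewrite <- Hg2; real_eq; field; lra.
Qed.

(** * Winding numbers *)

Definition Cinf3 (c : R -> R3) : Prop :=
  Cinf (fun s => fst (fst (c s))) /\ Cinf (fun s => snd (fst (c s))) /\ Cinf (fun s => snd (c s)).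

Lemma Cinf3_velocity c : Cinf3 c -> Cinf3 (velocity c).
Proof.
intros [H1 [H2 H3]]; repeat split.
- replace (fun s => fst (fst (velocity c s))) with (Derive (fun s => fst (fst (c s))));
    [now apply Cinf_Derive|apply functional_extensionality; intros s; now rewrite velocity_components].
- replace (fun s => snd (fst (velocity c s))) with (Derive (fun s => snd (fst (c s))));
    [now apply Cinf_Derive|apply functional_extensionality; intros s; now rewrite velocity_components].
- replace (fun s => snd (velocity c s)) with (Derive (fun s => snd (c s)));
    [now apply Cinf_Derive|apply functional_extensionality; intros s; now rewrite velocity_components].
Qed.

Lemma Cinf3_scal3 k c : Cinf3 c -> Cinf3 (fun s => scal3 k (c s)).
Proof.
intros [H1 [H2 H3]]; repeat split.
- replace (fun s => fst (fst (scal3 k (c s)))) with (fun s => k * fst (fst (c s)));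
    [apply (Cinf_mult (fun _ => k)); trivial; apply Cinf_const|].
  apply functional_extensionality; intros s; now destruct (c s) as [[? ?] ?].
- replace (fun s => snd (fst (scal3 k (c s)))) with (fun s => k * snd (fst (c s)));
    [apply (Cinf_mult (fun _ => k)); trivial; apply Cinf_const|].
  apply functional_extensionality; intros s; now destruct (c s) as [[? ?] ?].
- replace (fun s => snd (scal3 k (c s))) with (fun s => k * snd (c s));
    [apply (Cinf_mult (fun _ => k)); trivial; apply Cinf_const|].
  apply functional_extensionality; intros s; now destruct (c s) as [[? ?] ?].
Qed.

Lemma dot3_split (u v : R3) : dot3 u v =
  fst (fst u) * fst (fst v) + snd (fst u) * snd (fst v) + snd u * snd v.
Proof. now destruct u as [[? ?] ?], v as [[? ?] ?]. Qed.

Lemma Cinf_dot3 h u : Cinf3 h -> Cinf (fun s => dot3 (h s) u).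
Proof.
intros [H1 [H2 H3]].
replace (fun s => dot3 (h s) u) with
  (fun s => fst (fst (h s)) * fst (fst u) + snd (fst (h s)) * snd (fst u) + snd (h s) * snd u).
- apply (Cinf_plus (fun s => fst (fst (h s)) * fst (fst u) + snd (fst (h s)) * snd (fst u))
    (fun s => snd (h s) * snd u)).
  + apply (Cinf_plus (fun s => fst (fst (h s)) * fst (fst u)) (fun s => snd (fst (h s)) * snd (fst u)));
     (apply (Cinf_mult _ (fun _ => _)); [trivial|apply Cinf_const]).
  + apply (Cinf_mult _ (fun _ => _)); [trivial|apply Cinf_const].
- apply functional_extensionality; intros s; now rewrite dot3_split.
Qed.

Lemma Derive_dot3 h u s : Cinf3 h -> Derive (fun s => dot3 (h s) u) s = dot3 (velocity h s) u.
Proof.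
intros [H1 [H2 H3]]; rewrite velocity_components, dot3_split; cbn [fst snd].
apply is_derive_unique.
apply (is_derive_Rext (fun s => fst (fst (h s)) * fst (fst u) + snd (fst (h s)) * snd (fst u) + snd (h s) * snd u)).
{ intros t; now rewrite dot3_split. }
eapply is_derive_value.
- exact (is_derive_Rplus _ _ _ _ _ (is_derive_Rplus _ _ _ _ _
    (is_derive_Rmult _ _ _ _ _ (Cinf_is_derive _ H1 s) (is_derive_Rconst (fst (fst u)) s))
    (is_derive_Rmult _ _ _ _ _ (Cinf_is_derive _ H2 s) (is_derive_Rconst (snd (fst u)) s)))
    (is_derive_Rmult _ _ _ _ _ (Cinf_is_derive _ H3 s) (is_derive_Rconst (snd u) s))).
- real_eq; ring.
Qed.

Lemma gram_cross u1 u2 : dot3 (cross3 u2 u1) (cross3 u2 u1) =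
  dot3 u1 u1 * dot3 u2 u2 - dot3 u1 u2 ^ 2.
Proof. destruct u1 as [[? ?] ?], u2 as [[? ?] ?]; unfold dot3, cross3; ring. Qed.

(** As p = u2 x u1, the frame (u1, u2, p) is negatively oriented, which causes the minus sign in
    front of the triple product in coordinates. *)
Lemma orthonormal_frame u1 u2 : dot3 u1 u1 = 1 -> dot3 u2 u2 = 1 -> dot3 u1 u2 = 0 ->
  let p := cross3 u2 u1 in
  dot3 p p = 1 /\ dot3 p u1 = 0 /\ dot3 p u2 = 0 /\
  (forall v, dot3 v v = dot3 v u1 ^ 2 + dot3 v u2 ^ 2 + dot3 v p ^ 2) /\
  forall v w z, det3 v w z = - det3 (dot3 v u1, dot3 v u2, dot3 v p)
    (dot3 w u1, dot3 w u2, dot3 w p) (dot3 z u1, dot3 z u2, dot3 z p).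
Proof.
intros H1 H2 H3 p.
assert (Hp : dot3 p p = 1) by (unfold p; rewrite gram_cross, H1, H2, H3; ring).
split; [trivial|split; [|split; [|split]]].
- unfold p; destruct u1 as [[? ?] ?], u2 as [[? ?] ?]; unfold dot3, cross3; ring.
- unfold p; destruct u1 as [[? ?] ?], u2 as [[? ?] ?]; unfold dot3, cross3; ring.
- intros v.
  assert (E : dot3 v p ^ 2 = dot3 v v * (dot3 u1 u1 * dot3 u2 u2 - dot3 u1 u2 ^ 2)
    - dot3 v u1 ^ 2 * dot3 u2 u2 - dot3 v u2 ^ 2 * dot3 u1 u1 + 2 * dot3 v u1 * dot3 v u2 * dot3 u1 u2).
  { unfold p; destruct u1 as [[? ?] ?], u2 as [[? ?] ?], v as [[? ?] ?]; unfold dot3, cross3; ring. }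
  rewrite H1, H2, H3 in E; lra.
- intros v w z.
  assert (E : det3 (dot3 v u1, dot3 v u2, dot3 v p)
    (dot3 w u1, dot3 w u2, dot3 w p) (dot3 z u1, dot3 z u2, dot3 z p) = det3 u1 u2 p * det3 v w z).
  { generalize p; intros [[? ?] ?]; destruct u1 as [[? ?] ?], u2 as [[? ?] ?], v as [[? ?] ?],
      w as [[? ?] ?], z as [[? ?] ?]; unfold det3, dot3, cross3; ring. }
  assert (E2 : det3 u1 u2 p = - dot3 p p).
  { unfold p; destruct u1 as [[? ?] ?], u2 as [[? ?] ?]; unfold det3, dot3, cross3; ring. }
  rewrite E, E2, Hp; ring.
Qed.

(** The left-hand side is the angular velocity of the tangent of the projected plane curve. On the
    right stand the triple product for the spherical curvature and the correction by the conformal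
    factor, which is [theta_form] in coordinates. The formulas for a, b and d are those of
    [profileA], [profileC] and [profileB]. *)
Lemma stereographic_curvature x y x1 y1 x2 y2 Q : 0 < x1 ^ 2 + y1 ^ 2 -> Q = x ^ 2 + y ^ 2 + 1 ->
  let Q1 := 2 * (x * x1 + y * y1) in
  let Q2 := 2 * (x1 ^ 2 + x * x2 + y1 ^ 2 + y * y2) in
  let a := 2 * x / Q in let d := (Q - 2) / Q in let b := 2 * y / Q in
  let a1 := 2 * (x1 * Q - x * Q1) / Q ^ 2 in
  let d1 := 2 * Q1 / Q ^ 2 in
  let b1 := 2 * (y1 * Q - y * Q1) / Q ^ 2 in
  let a2 := 2 * (x2 * Q - x * Q2) / Q ^ 2 - 4 * (x1 * Q - x * Q1) * Q1 / Q ^ 3 in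
  let d2 := 2 * Q2 / Q ^ 2 - 4 * Q1 ^ 2 / Q ^ 3 in
  let b2 := 2 * (y2 * Q - y * Q2) / Q ^ 2 - 4 * (y1 * Q - y * Q1) * Q1 / Q ^ 3 in
  (x1 * y2 - y1 * x2) / (x1 ^ 2 + y1 ^ 2) =
    - det3 (a, b, d) (a1, b1, d1) (a2, b2, d2) / (a1 ^ 2 + b1 ^ 2 + d1 ^ 2)
      + (a * b1 - b * a1) / (1 - d).
Proof.
intros HS HQ; cbv zeta.
assert (HQ0 : x ^ 2 + y ^ 2 + 1 <> 0) by nra.
subst Q; set (Q := x ^ 2 + y ^ 2 + 1) in *.
match goal with |- _ = _ / ?E + _ =>
  replace E with (4 * (x1 ^ 2 + y1 ^ 2) / Q ^ 2) by (unfold Q; field; trivial) end.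
unfold det3, dot3, cross3, Q; field; repeat split; try lra; trivial.
Qed.

Lemma sph_unit_curve G c : 0 < G -> sph_arclength G c ->
  let h := fun s => scal3 (sqrt G) (c s) in
  Cinf3 h /\ (forall s, dot3 (h s) (h s) = 1) /\
  (forall s, dot3 (velocity h s) (velocity h s) = G) /\
  (forall s, sph_curvature G c s = / G * det3 (h s) (velocity h s) (velocity (velocity h) s)).
Proof.
intros HG [[H1 [H2 H3]] Hs] h.
assert (Hg : 0 < sqrt G) by now apply sqrt_lt_R0.
assert (Hg2 : sqrt G * sqrt G = G) by (apply sqrt_sqrt; lra).
assert (Hc : Cinf3 c) by (repeat split; now apply smooth_curve_Cinf).
assert (V : forall s, velocity h s = scal3 (sqrt G) (velocity c s)) by (intros; apply velocity_scal3).
split; [now apply Cinf3_scal3|split; [|split]]; intros s.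
- unfold h; rewrite dot3_scal3, Hg2, (proj1 (Hs s)); field; lra.
- rewrite V, dot3_scal3, Hg2.
  destruct (Hs s) as [_ E]; unfold sph_speed in E.
  assert (Hn : 0 <= dot3 (velocity c s) (velocity c s)).
  { destruct (velocity c s) as [[x y] z]; unfold dot3; nra. }
  rewrite <- (sqrt_sqrt _ Hn), E; ring.
- rewrite (velocity_ext _ _ s V), velocity_scal3, V; unfold h, sph_curvature.
  rewrite !det3_scal3.
  replace (velocity c s) with (scal3 1 (velocity c s)) at 1
    by (destruct (velocity c s) as [[? ?] ?]; unfold scal3; f_equal; [f_equal|]; ring).
  replace (velocity (velocity c) s) with (scal3 1 (velocity (velocity c) s)) at 1
    by (destruct (velocity (velocity c) s) as [[? ?] ?]; unfold scal3; f_equal; [f_equal|]; ring).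
  rewrite det3_scal3.
  transitivity (sqrt G * (sqrt G * sqrt G) / G * det3 (c s) (velocity c s) (velocity (velocity c) s));
    [rewrite Hg2; field; lra|field; lra].
Qed.

(** By the intermediate value theorem d cannot leave the interval between - pi/2 and pi/2, because
    the cosine vanishes at the ends; inside it the sine vanishes only at 0. *)
Lemma angle_lift_unique (d : R -> R) : (forall s, continuous d s) -> d 0 = 0 ->
  (forall s, sin (d s) = 0 /\ 0 < cos (d s)) -> forall s, d s = 0.
Proof.
intros Hc H0 Hd s.
assert (Hcon : continuity d) by (intros x; apply continuity_pt_filterlim, Hc).
pose proof PI_RGT_0 as Hpi.
assert (Hno : forall y, cos y = 0 -> ~ (Rmin (d 0) (d s) <= y <= Rmax (d 0) (d s))).
{ intros y Hy H; destruct (IVT_gen d 0 s y Hcon H) as [t [_ Ht]].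
  destruct (Hd t) as [_ Hpos]; rewrite Ht, Hy in Hpos; lra. }
rewrite H0 in Hno.
assert (Hup : d s < PI / 2).
{ apply Rnot_le_lt; intros H; apply (Hno (PI / 2)); [apply cos_PI2|].
  rewrite Rmin_left, Rmax_right by lra; lra. }
assert (Hlo : - (PI / 2) < d s).
{ apply Rnot_le_lt; intros H; apply (Hno (- (PI / 2))); [rewrite cos_neg; apply cos_PI2|].
  rewrite Rmin_right, Rmax_left by lra; lra. }
destruct (Hd s) as [Hs _].
destruct (Rtotal_order (d s) 0) as [H|[H|H]]; trivial.
- assert (0 < sin (- d s)) by (apply sin_gt_0; lra); rewrite sin_neg in *; lra.
- assert (0 < sin (d s)) by (apply sin_gt_0; lra); lra.
Qed.

Lemma winding_number_curvature G L c m : 0 < G -> sph_arclength G c -> winding_number G L c m ->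
  exists P, dot3 P P = 1 /\ (forall s, scal3 (sqrt G) (c s) <> P) /\
    ((forall s, continuous (theta_form P (fun s => scal3 (sqrt G) (c s))) s) ->
     RInt (sph_curvature G c) 0 L =
       2 * PI * IZR m - RInt (theta_form P (fun s => scal3 (sqrt G) (c s))) 0 L).
Proof.
intros HG Hc [u1 [u2 [ang Hw]]]; cbv zeta in Hw.
destruct Hw as [U1 [U2 [U12 [Hne [Hang [Hpol Hm]]]]]].
destruct (orthonormal_frame u1 u2 U1 U2 U12) as [Hp [Hp1 [Hp2 [Hsum Hdet]]]].
set (P := cross3 u2 u1) in *.
exists P; split; [trivial|split; [trivial|]]; intros Hth.
set (h := fun s => scal3 (sqrt G) (c s)) in *.
assert (Hcurve : Cinf3 h /\ (forall s, dot3 (h s) (h s) = 1) /\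
  (forall s, dot3 (velocity h s) (velocity h s) = G) /\
  (forall s, sph_curvature G c s = / G * det3 (h s) (velocity h s) (velocity (velocity h) s)))
  by exact (sph_unit_curve G c HG Hc).
destruct Hcurve as [HC [Hn [Hsp Hk]]].
set (X := fun s => dot3 (h s) u1 / (1 - dot3 (h s) P)).
set (Y := fun s => dot3 (h s) u2 / (1 - dot3 (h s) P)).
assert (Hlt : forall s, 0 < 1 - dot3 (h s) P).
{ intros s; pose proof (dot3_lt_1 (h s) P (Hn s) Hp (Hne s)); lra. }
assert (Hquot : forall u, Cinf (fun s => dot3 (h s) u / (1 - dot3 (h s) P))).
{ intros u; unfold Rdiv; apply (Cinf_mult (fun s => dot3 (h s) u)); [now apply Cinf_dot3|].
  apply (Cinf_inv (fun s => 1 - dot3 (h s) P)).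
  - intros s; specialize (Hlt s); lra.
  - apply (Cinf_minus (fun _ => 1)); [apply Cinf_const|now apply Cinf_dot3]. }
assert (HX : Cinf X) by apply Hquot; assert (HY : Cinf Y) by apply Hquot.
assert (HQ : forall s, X s ^ 2 + Y s ^ 2 + 1 = 2 / (1 - dot3 (h s) P)).
{ intros s; specialize (Hlt s); pose proof (Hsum (h s)) as E; rewrite Hn in E; unfold X, Y.
  transitivity ((dot3 (h s) u1 ^ 2 + dot3 (h s) u2 ^ 2 + (1 - dot3 (h s) P) ^ 2) / (1 - dot3 (h s) P) ^ 2);
    [field; lra|].
  replace (dot3 (h s) u1 ^ 2 + dot3 (h s) u2 ^ 2) with (1 - dot3 (h s) P ^ 2) by lra; field; lra. }
(* Inverse stereographic projection recovers the curve from its projection by the formulas used for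
   the profile of a torus of revolution, so the derivatives computed there are available. *)
assert (EA : (fun s => dot3 (h s) u1) = profileA X Y).
{ apply functional_extensionality; intros s; unfold profileA; rewrite HQ; unfold X.
  specialize (Hlt s); field; lra. }
assert (EB : (fun s => dot3 (h s) u2) = profileC X Y).
{ apply functional_extensionality; intros s; unfold profileC; rewrite HQ; unfold Y.
  specialize (Hlt s); field; lra. }
assert (ED : (fun s => dot3 (h s) P) = profileB X Y).
{ apply functional_extensionality; intros s; unfold profileB; rewrite HQ.
  specialize (Hlt s); field; lra. }
set (W := fun s => (Derive X s, Derive Y s) : C).
set (W1 := fun s => (Derive (Derive X) s, Derive (Derive Y) s) : C).
assert (HW : forall s, cderiv W s (W1 s)).
{ intros s; split; [exact (Cinf_is_derive _ (Cinf_Derive _ HX) s)|exact (Cinf_is_derive _ (Cinf_Derive _ HY) s)]. }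
assert (HW1 : forall s, exists d, cderiv W1 s d).
{ intros s; exists (Derive (Derive (Derive X)) s, Derive (Derive (Derive Y)) s); split;
   [exact (Cinf_is_derive _ (Cinf_Derive _ (Cinf_Derive _ HX)) s)
   |exact (Cinf_is_derive _ (Cinf_Derive _ (Cinf_Derive _ HY)) s)]. }
assert (Hpol' : forall s, exists r, 0 < r /\ Derive X s = r * cos (ang s) /\ Derive Y s = r * sin (ang s)) by exact Hpol.
assert (Hpos : forall s, 0 < Derive X s ^ 2 + Derive Y s ^ 2).
{ intros s; destruct (Hpol' s) as [r [Hr [-> ->]]].
  replace ((r * cos (ang s)) ^ 2 + (r * sin (ang s)) ^ 2) with (r ^ 2 * (cos (ang s) ^ 2 + sin (ang s) ^ 2)) by ring.
  rewrite sin2_cos2_pow, Rmult_1_r; now apply pow_lt. }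
assert (HW0 : forall s, W s <> RtoC 0).
{ intros s E; pose proof (Hpos s) as H; unfold W, RtoC in E; injection E as E1 E2.
  rewrite E1, E2 in H; simpl in H; lra. }
set (phi := fun s => (W1 s * / W s)%C).
set (th := theta_form P h) in *.
assert (Hphi : forall s, Im (phi s) = sph_curvature G c s + th s).
{ intros s.
  destruct (Derive_profile X Y (Cinf_ex_derive _ HX) (Cinf_ex_derive _ HY)) as [DA [DB DC]].
  destruct (Derive2_profile X Y HX HY s) as [DA2 [DB2 DC2]].
  apply is_derive_unique in DA2; apply is_derive_unique in DB2; apply is_derive_unique in DC2.
  pose proof (stereographic_curvature (X s) (Y s) (Derive X s) (Derive Y s)
    (Derive (Derive X) s) (Derive (Derive Y) s) _ (Hpos s) eq_refl) as E; cbv zeta in E.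
  rewrite <- DA2, <- DB2, <- DC2 in E.
  assert (V1 : forall u s, dot3 (velocity h s) u = Derive (fun s => dot3 (h s) u) s)
    by (intros; symmetry; now apply Derive_dot3).
  assert (V2 : forall u, dot3 (velocity (velocity h) s) u = Derive (Derive (fun s => dot3 (h s) u)) s).
  { intros u; rewrite <- Derive_dot3 by now apply Cinf3_velocity.
    apply Derive_ext; intros t; apply V1. }
  assert (EAs : dot3 (h s) u1 = profileA X Y s) by exact (f_equal (fun f => f s) EA).
  assert (EBs : dot3 (h s) u2 = profileC X Y s) by exact (f_equal (fun f => f s) EB).
  assert (EDs : dot3 (h s) P = profileB X Y s) by exact (f_equal (fun f => f s) ED).
  assert (Ek : sph_curvature G c s = - det3 (profileA X Y s, profileC X Y s, profileB X Y s)
     (Derive (profileA X Y) s, Derive (profileC X Y) s, Derive (profileB X Y) s)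
     (Derive (Derive (profileA X Y)) s, Derive (Derive (profileC X Y)) s, Derive (Derive (profileB X Y)) s)
     / (Derive (profileA X Y) s ^ 2 + Derive (profileC X Y) s ^ 2 + Derive (profileB X Y) s ^ 2)).
  { rewrite Hk, Hdet, !V1, !V2, EA, EB, ED.
    rewrite <- (Hsp s), Hsum, !V1, EA, EB, ED.
    rewrite EAs, EBs, EDs; unfold Rdiv; ring. }
  assert (Et : th s = (profileA X Y s * Derive (profileC X Y) s - profileC X Y s * Derive (profileA X Y) s)
    / (1 - profileB X Y s)).
  { unfold th, theta_form; rewrite Hdet, Hp, Hp1, Hp2, !V1, EA, EB, ED.
    rewrite EAs, EBs, EDs; unfold det3, dot3, cross3, Rdiv; ring. }
  rewrite Ek, Et.
  replace (Im (phi s)) with ((Derive X s * Derive (Derive Y) s - Derive Y s * Derive (Derive X) s)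
    / (Derive X s ^ 2 + Derive Y s ^ 2)).
  - rewrite E, DA, DB, DC; reflexivity.
  - pose proof (Hpos s); unfold phi, W, W1, Cinv; components; field; lra. }
assert (Hphid : forall s, exists d, cderiv phi s d).
{ intros s; destruct (HW1 s) as [d Hd]; eexists; unfold phi; apply cderiv_mult; [exact Hd|].
  apply (cderiv_inv W); [apply HW0|apply HW]. }
destruct (cderiv_primitive phi) as [Phi HPhi].
{ intros s; destruct (Hphid s) as [d Hd]; apply (cderiv_continuous _ _ _ Hd). }
{ intros s; destruct (Hphid s) as [d Hd]; apply (cderiv_continuous _ _ _ Hd). }
assert (Hg : forall s, cderiv W s (phi s * W s)%C).
{ intros s; eapply cderiv_value; [apply HW|]; unfold phi; field; apply HW0. }
pose proof (cderiv_logarithmic W phi Phi Hg HPhi 0) as Hlog.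
(* The angle function of the definition is merely continuous and cannot be differentiated. It is
   identified with the imaginary part of the smooth [Phi], since the two differ by an angle with
   vanishing sine and positive cosine. *)
assert (Hangle : forall s, ang s - ang 0 - Im (Phi s - Phi 0)%C = 0).
{ apply angle_lift_unique.
  - intros s; apply (continuous_minus (fun s => ang s - ang 0) (fun s => Im (Phi s - Phi 0)%C)).
    + apply (continuous_minus ang (fun _ => ang 0)); [apply Hang|apply continuous_const].
    + apply (continuous_minus (fun s => Im (Phi s)) (fun _ => Im (Phi 0))); [|apply continuous_const].
      apply (cderiv_continuous _ _ _ (HPhi s)).
  - components; ring.
  - intros s; specialize (Hlog s).
    destruct (Hpol' s) as [r [Hr [E1 E2]]]; destruct (Hpol' 0) as [r0 [Hr0 [E3 E4]]].
    unfold W in Hlog; rewrite E1, E2, E3, E4 in Hlog.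
    generalize dependent (Phi s - Phi 0)%C; intros d Hlog; unfold Cexp, Cmult in Hlog; cbn [fst snd] in Hlog.
    injection Hlog as F1 F2.
    set (rho := r0 * exp (Re d)); assert (Hrho : 0 < rho) by (apply Rmult_lt_0_compat; [trivial|apply exp_pos]).
    assert (G1 : r * cos (ang s) = rho * cos (ang 0 + Im d)) by (rewrite F1, cos_plus; unfold rho; ring).
    assert (G2 : r * sin (ang s) = rho * sin (ang 0 + Im d)) by (rewrite F2, sin_plus; unfold rho; ring).
    replace (ang s - ang 0 - Im d) with (ang s - (ang 0 + Im d)) by ring.
    rewrite sin_minus, cos_minus; set (q := ang 0 + Im d) in *.
    split.
    + apply (Rmult_eq_reg_l r); [|lra].
      transitivity ((r * sin (ang s)) * cos q - (r * cos (ang s)) * sin q); [ring|].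
      rewrite G1, G2; ring.
    + apply (Rmult_lt_reg_l r); trivial; rewrite Rmult_0_r.
      replace (r * (cos (ang s) * cos q + sin (ang s) * sin q))
        with ((r * cos (ang s)) * cos q + (r * sin (ang s)) * sin q) by ring.
      rewrite G1, G2.
      replace (rho * cos q * cos q + rho * sin q * sin q) with (rho * (cos q ^ 2 + sin q ^ 2)) by ring.
      rewrite sin2_cos2_pow; lra. }
assert (HTe : exists T : R -> R, (forall s, is_derive T s (th s)) /\ T 0 = 0 /\ T L = RInt th 0 L).
{ exists (fun t => RInt th 0 t); split; [now apply is_derive_primitive|].
  split; [apply (RInt_point (V := R_CompleteNormedModule))|trivial]. }
destruct HTe as [T [HT [HT0 HTL]]]; rewrite <- HTL.
rewrite (RInt_antiderivative (fun s => Im (Phi s) - T s)).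
- pose proof (Hangle L) as E; rewrite Hm in E; revert E.
  destruct (Phi L) as [a b], (Phi 0) as [a' b']; components; intros E; rewrite HT0; real_eq; lra.
- intros s; eapply is_derive_value.
  + apply is_derive_Rminus; [exact (proj2 (HPhi s))|exact (HT s)].
  + rewrite Hphi; real_eq; ring.
- intros s; apply Cinf_continuous, sph_curvature_Cinf, Hc.
Qed.

(** * Enclosed areas *)

(** Products of two smooth functions are not closed under directional derivatives, but their finite
    sums are. This is the invariant for the iterated derivatives in [smooth]. *)
Inductive sum_of_products : (R2 -> R) -> Prop :=
| sop_mult f g : smooth f -> smooth g -> sum_of_products (fun p => f p * g p)
| sop_plus f g : sum_of_products f -> sum_of_products g -> sum_of_products (fun p => f p + g p).

Lemma line_0 (p v : R2) : plus p (scal 0 v) = p.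
Proof.
transitivity (plus p zero); [f_equal; exact (scal_zero_l v)|apply plus_zero_r].
Qed.

Lemma is_derive_dirD (f : R2 -> R) p v : smooth f ->
  is_derive (fun h : R => f (plus p (scal h v))) 0 (dirD v f p).
Proof. intros H; apply Derive_correct, smooth_ex_derive, H. Qed.

Lemma sop_derivable f : sum_of_products f -> forall p v,
  ex_derive (fun h : R => f (plus p (scal h v))) 0 /\ continuous f p.
Proof.
intros H; induction H as [f g Hf Hg|f g Hf IHf Hg IHg]; intros p v; split.
- apply (ex_derive_mult (fun h : R => f (plus p (scal h v))) (fun h : R => g (plus p (scal h v))));
   now apply smooth_ex_derive.
- apply (continuous_mult f g); now apply smooth_continuous.
- apply (ex_derive_plus (fun h : R => f (plus p (scal h v))) (fun h : R => g (plus p (scal h v))));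
   [apply IHf|apply IHg].
- apply (continuous_plus f g); [apply (IHf p v)|apply (IHg p v)].
Qed.

Lemma sop_dirD f v : sum_of_products f -> sum_of_products (dirD v f).
Proof.
intros H; induction H as [f g Hf Hg|f g Hf IHf Hg IHg].
- replace (dirD v (fun p => f p * g p)) with (fun p => dirD v f p * g p + f p * dirD v g p).
  + apply sop_plus; apply sop_mult; trivial; now apply smooth_dirD.
  + apply functional_extensionality; intros p; symmetry; unfold dirD at 1.
    rewrite (Derive_mult (fun h : R => f (plus p (scal h v))) (fun h : R => g (plus p (scal h v))))
      by now apply smooth_ex_derive.
    rewrite line_0; reflexivity.
- replace (dirD v (fun p => f p + g p)) with (fun p => dirD v f p + dirD v g p).
  + now apply sop_plus.
  + apply functional_extensionality; intros p; symmetry.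
    apply (Derive_plus (fun h : R => f (plus p (scal h v))) (fun h : R => g (plus p (scal h v))));
     now apply sop_derivable.
Qed.

Lemma sop_smooth f : sum_of_products f -> smooth f.
Proof.
intros H vs; cbv zeta.
assert (Hk : sum_of_products (fold_right dirD f vs)).
{ induction vs as [|v vs IH]; [exact H|]; cbn [fold_right]; now apply sop_dirD. }
intros p; split; [apply (sop_derivable _ Hk p e1)|].
intros v; apply (sop_derivable _ Hk p v).
Qed.

Lemma smooth_mult (f g : R2 -> R) : smooth f -> smooth g -> smooth (fun p => f p * g p).
Proof. intros Hf Hg; apply sop_smooth; now constructor. Qed.

Lemma smooth_const (c : R) : smooth (V := R2) (fun _ => c).
Proof.
pose proof (smooth_ridge (fun _ => c) (fun _ => 0) 0 0 0 0 (Cinf_const c) (Cinf_const 0)) as H.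
replace (fun _ : R2 => c) with (fun _ : R2 => c + 0); [exact H|].
apply functional_extensionality; intros _; ring.
Qed.

Lemma smooth_plus (f g : R2 -> R) : smooth f -> smooth g -> smooth (fun p => f p + g p).
Proof.
intros Hf Hg.
replace (fun p => f p + g p) with (fun p => f p * 1 + g p * 1)
  by (apply functional_extensionality; intros; ring).
apply sop_smooth, (sop_plus (fun p => f p * 1) (fun p => g p * 1));
 apply (sop_mult _ (fun _ => 1)); trivial; apply smooth_const.
Qed.

Lemma smooth_scal (c : R) (f : R2 -> R) : smooth f -> smooth (fun p => c * f p).
Proof. intros H; apply (smooth_mult (fun _ => c)); trivial; apply smooth_const. Qed.

Lemma smooth_minus (f g : R2 -> R) : smooth f -> smooth g -> smooth (fun p => f p - g p).
Proof.
intros Hf Hg; replace (fun p => f p - g p) with (fun p => f p + (-1) * g p)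
  by (apply functional_extensionality; intros; ring).
apply (smooth_plus f (fun p => (-1) * g p)); trivial; now apply smooth_scal.
Qed.

Lemma smoothR3_D3 (h : R2 -> R3) v : smoothR3 h -> smoothR3 (D3 v h).
Proof. intros [H1 [H2 H3]]; split; [|split]; now apply smooth_dirD. Qed.

Lemma smoothR3_scal3 k (h : R2 -> R3) : smoothR3 h -> smoothR3 (fun p => scal3 k (h p)).
Proof.
intros [H1 [H2 H3]]; split; [|split].
- replace (fun p => fst (fst (scal3 k (h p)))) with (fun p => k * fst (fst (h p)));
   [now apply smooth_scal|apply functional_extensionality; intros p; now destruct (h p) as [[? ?] ?]].
- replace (fun p => snd (fst (scal3 k (h p)))) with (fun p => k * snd (fst (h p)));
   [now apply smooth_scal|apply functional_extensionality; intros p; now destruct (h p) as [[? ?] ?]].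
- replace (fun p => snd (scal3 k (h p))) with (fun p => k * snd (h p));
   [now apply smooth_scal|apply functional_extensionality; intros p; now destruct (h p) as [[? ?] ?]].
Qed.

Lemma smoothR3_const (v : R3) : smoothR3 (V := R2) (fun _ => v).
Proof. split; [|split]; apply smooth_const. Qed.

Lemma det3_split (u v w : R3) : det3 u v w =
  fst (fst u) * (snd (fst v) * snd w - snd v * snd (fst w))
  + snd (fst u) * (snd v * fst (fst w) - fst (fst v) * snd w)
  + snd u * (fst (fst v) * snd (fst w) - snd (fst v) * fst (fst w)).
Proof. now destruct u as [[? ?] ?], v as [[? ?] ?], w as [[? ?] ?]. Qed.

Lemma smooth_det3 (a b c : R2 -> R3) : smoothR3 a -> smoothR3 b -> smoothR3 c ->
  smooth (fun p => det3 (a p) (b p) (c p)).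
Proof.
intros [A1 [A2 A3]] [B1 [B2 B3]] [C1 [C2 C3]].
assert (M : forall f g h k l : R2 -> R, smooth f -> smooth g -> smooth h -> smooth k -> smooth l ->
  smooth (fun p => f p * (g p * h p - k p * l p))).
{ intros f g h k l Hf Hg Hh Hk Hl; apply (smooth_mult f (fun p => g p * h p - k p * l p)); trivial.
  apply (smooth_minus (fun p => g p * h p) (fun p => k p * l p)); now apply smooth_mult. }
replace (fun p => det3 (a p) (b p) (c p)) with (fun p =>
  fst (fst (a p)) * (snd (fst (b p)) * snd (c p) - snd (b p) * snd (fst (c p)))
  + snd (fst (a p)) * (snd (b p) * fst (fst (c p)) - fst (fst (b p)) * snd (c p))
  + snd (a p) * (fst (fst (b p)) * snd (fst (c p)) - snd (fst (b p)) * fst (fst (c p))))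
  by (apply functional_extensionality; intros; now rewrite det3_split).
exact (smooth_plus _ _ (smooth_plus _ _ (M _ _ _ _ _ A1 B2 C3 B3 C2) (M _ _ _ _ _ A2 B3 C1 B1 C3))
  (M _ _ _ _ _ A3 B1 C2 B2 C1)).
Qed.

Lemma smooth_dot3 (a b : R2 -> R3) : smoothR3 a -> smoothR3 b -> smooth (fun p => dot3 (a p) (b p)).
Proof.
intros [A1 [A2 A3]] [B1 [B2 B3]].
replace (fun p => dot3 (a p) (b p)) with (fun p => fst (fst (a p)) * fst (fst (b p))
  + snd (fst (a p)) * snd (fst (b p)) + snd (a p) * snd (b p))
  by (apply functional_extensionality; intros; now rewrite dot3_split).
exact (smooth_plus _ _ (smooth_plus _ _ (smooth_mult _ _ A1 B1) (smooth_mult _ _ A2 B2)) (smooth_mult _ _ A3 B3)).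
Qed.

Lemma dirD_det3 (a b c : R2 -> R3) v p : smoothR3 a -> smoothR3 b -> smoothR3 c ->
  dirD v (fun p => det3 (a p) (b p) (c p)) p =
  det3 (D3 v a p) (b p) (c p) + det3 (a p) (D3 v b p) (c p) + det3 (a p) (b p) (D3 v c p).
Proof.
intros [A1 [A2 A3]] [B1 [B2 B3]] [C1 [C2 C3]]; unfold dirD at 1.
apply is_derive_unique.
apply (is_derive_Rext (fun h => let q := plus p (scal h v) in
  fst (fst (a q)) * (snd (fst (b q)) * snd (c q) - snd (b q) * snd (fst (c q)))
  + snd (fst (a q)) * (snd (b q) * fst (fst (c q)) - fst (fst (b q)) * snd (c q))
  + snd (a q) * (fst (fst (b q)) * snd (fst (c q)) - snd (fst (b q)) * fst (fst (c q))))).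
{ intros h; now rewrite det3_split. }
assert (K := fun f (H : smooth f) => is_derive_dirD f p v H).
pose proof (K _ A1) as a1; pose proof (K _ A2) as a2; pose proof (K _ A3) as a3.
pose proof (K _ B1) as b1; pose proof (K _ B2) as b2; pose proof (K _ B3) as b3.
pose proof (K _ C1) as c1; pose proof (K _ C2) as c2; pose proof (K _ C3) as c3.
cbv beta in a1, a2, a3, b1, b2, b3, c1, c2, c3.
assert (M : forall (f g h k l : R -> R) (f' g' h' k' l' : R), is_derive f 0 f' -> is_derive g 0 g' ->
  is_derive h 0 h' -> is_derive k 0 k' -> is_derive l 0 l' ->
  is_derive (fun t => f t * (g t * h t - k t * l t)) 0
   (f' * (g 0 * h 0 - k 0 * l 0) + f 0 * (g' * h 0 + g 0 * h' - (k' * l 0 + k 0 * l')))).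
{ intros f g h k l f' g' h' k' l' Hf Hg Hh Hk Hl.
  exact (is_derive_Rmult _ _ _ _ _ Hf (is_derive_Rminus _ _ _ _ _
    (is_derive_Rmult _ _ _ _ _ Hg Hh) (is_derive_Rmult _ _ _ _ _ Hk Hl))). }
eapply is_derive_value.
- exact (is_derive_Rplus _ _ _ _ _ (is_derive_Rplus _ _ _ _ _
    (M _ _ _ _ _ _ _ _ _ _ a1 b2 c3 b3 c2) (M _ _ _ _ _ _ _ _ _ _ a2 b3 c1 b1 c3))
    (M _ _ _ _ _ _ _ _ _ _ a3 b1 c2 b2 c1)).
- cbv beta; rewrite line_0, !det3_split; unfold D3; cbn [fst snd]; real_eq; ring.
Qed.

Lemma D3_const (u : R3) v (p : R2) : D3 v (fun _ => u) p = (0, 0, 0).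
Proof. unfold D3, dirD; now rewrite !Derive_const. Qed.

Lemma dirD_dot3 (a : R2 -> R3) u v p : smoothR3 a ->
  dirD v (fun p => dot3 (a p) u) p = dot3 (D3 v a p) u.
Proof.
intros [A1 [A2 A3]]; unfold dirD at 1; apply is_derive_unique.
apply (is_derive_Rext (fun h => let q := plus p (scal h v) in
  fst (fst (a q)) * fst (fst u) + snd (fst (a q)) * snd (fst u) + snd (a q) * snd u)).
{ intros h; now rewrite dot3_split. }
eapply is_derive_value.
- exact (is_derive_Rplus _ _ _ _ _ (is_derive_Rplus _ _ _ _ _
    (is_derive_Rmult _ _ _ _ _ (is_derive_dirD _ p v A1) (is_derive_Rconst (fst (fst u)) 0))
    (is_derive_Rmult _ _ _ _ _ (is_derive_dirD _ p v A2) (is_derive_Rconst (snd (fst u)) 0)))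
    (is_derive_Rmult _ _ _ _ _ (is_derive_dirD _ p v A3) (is_derive_Rconst (snd u) 0))).
- rewrite dot3_split; unfold D3; cbn [fst snd]; real_eq; ring.
Qed.

Lemma smooth_continuity_2d (f : R2 -> R) x y : smooth f -> continuity_2d_pt (fun u v => f (u, v)) x y.
Proof.
intros H; apply continuity_2d_pt_filterlim.
pose proof (smooth_continuous f (x, y) H) as Hc; unfold continuous in Hc.
replace (fun z : R * R => f (fst z, snd z)) with f; [exact Hc|].
apply functional_extensionality; now intros [u v].
Qed.

Lemma dirD_comm (f : R2 -> R) p : smooth f -> dirD e1 (dirD e2 f) p = dirD e2 (dirD e1 f) p.
Proof.
destruct p as [x y]; intros H; rewrite dirD_e1, dirD_e2.
rewrite (Derive_ext (fun u => dirD e2 f (u, y)) (fun u => Derive (fun v => f (u, v)) y))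
  by (intros; apply dirD_e2).
rewrite (Derive_ext (fun u => dirD e1 f (x, u)) (fun u => Derive (fun v => f (v, u)) x))
  by (intros; apply dirD_e1).
apply (Schwarz (fun u v => f (u, v)) x y).
- exists (mkposreal 1 Rlt_0_1); intros u v _ _; repeat split.
  + now apply smooth_ex_derive_e1.
  + now apply smooth_ex_derive_e2.
  + apply (ex_derive_ext (fun z => dirD e2 f (z, v))); [intros; apply dirD_e2|].
    apply smooth_ex_derive_e1; now apply smooth_dirD.
  + apply (ex_derive_ext (fun z => dirD e1 f (u, z))); [intros; apply dirD_e1|].
    apply smooth_ex_derive_e2; now apply smooth_dirD.
- apply (continuity_2d_pt_ext (fun u v => dirD e1 (dirD e2 f) (u, v))).
  + intros u v; rewrite dirD_e1; apply Derive_ext; intros; apply dirD_e2.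
  + apply (smooth_continuity_2d (dirD e1 (dirD e2 f))); do 2 apply smooth_dirD; trivial.
- apply (continuity_2d_pt_ext (fun u v => dirD e2 (dirD e1 f) (u, v))).
  + intros u v; rewrite dirD_e2; apply Derive_ext; intros; apply dirD_e1.
  + apply (smooth_continuity_2d (dirD e2 (dirD e1 f))); do 2 apply smooth_dirD; trivial.
Qed.

(* Here a and b are the first derivatives of h, and w is the mixed second one. *)
Lemma stokes_algebra (P h a b w : R3) : dot3 P P = 1 -> dot3 h h = 1 -> dot3 h a = 0 -> dot3 h b = 0 ->
  let D := 1 - dot3 h P in
  ((- det3 P a b - det3 P h w) * D - (- det3 P h b) * (- dot3 a P))
  - ((- det3 P b a - det3 P h w) * D - (- det3 P h a) * (- dot3 b P)) =
  det3 h a b * D ^ 2.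
Proof.
intros HP Hh Ha Hb D.
(* The linear relation among the four vectors P, a, b, h of space, given by Cramer's rule, paired
   with h. *)
assert (F1 : det3 P a b * dot3 h h = det3 h a b * dot3 h P
  + dot3 h a * det3 P h b - dot3 h b * det3 P h a).
{ destruct P as [[? ?] ?], h as [[? ?] ?], a as [[? ?] ?], b as [[? ?] ?]; unfold det3, dot3, cross3; ring. }
assert (F2 : (det3 P h b * dot3 a P - det3 P h a * dot3 b P) * dot3 h h =
  - det3 h a b * (dot3 P P * dot3 h h - dot3 h P ^ 2)
  + dot3 h b * det3 P h (cross3 P (cross3 h a)) - dot3 h a * det3 P h (cross3 P (cross3 h b))).
{ destruct P as [[? ?] ?], h as [[? ?] ?], a as [[? ?] ?], b as [[? ?] ?]; unfold det3, dot3, cross3; ring. }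
assert (F3 : det3 P b a = - det3 P a b).
{ destruct P as [[? ?] ?], a as [[? ?] ?], b as [[? ?] ?]; unfold det3, dot3, cross3; ring. }
rewrite HP, Hh, Ha, Hb in *; rewrite F3; unfold D.
set (lam := det3 h a b) in *; set (x := dot3 h P) in *.
transitivity (- 2 * (det3 P a b * 1) * (1 - x) - (det3 P h b * dot3 a P - det3 P h a * dot3 b P) * 1); [ring|].
rewrite F1, F2; ring.
Qed.

Lemma smooth_line_e2 (f : R2 -> R) (t s : R) : smooth f ->
  is_derive (fun u => f (t, u)) s (dirD e2 f (t, s)) /\ continuous (fun u => f (t, u)) s.
Proof.
intros H; pose proof (smooth_ex_derive_e2 f t s H) as E; split.
- rewrite dirD_e2; now apply Derive_correct.
- now apply continuous_ex_derive.
Qed.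

Lemma continuity_2d_reparam (f : R -> R -> R) (phi : R -> R) x y :
  continuity_2d_pt f (phi x) y -> continuity_pt phi x ->
  continuity_2d_pt (fun u v => f (phi u) v) x y.
Proof.
intros Hf Hphi eps; destruct (Hf eps) as [d Hd].
destruct (proj1 (continuity_pt_locally phi x) Hphi d) as [d' Hd'].
assert (Hm : 0 < Rmin d d') by (apply Rmin_glb_lt; [apply d|apply d']).
exists (mkposreal _ Hm); intros u v Hu Hv; simpl in Hu, Hv.
apply Hd; [|eapply Rlt_le_trans; [exact Hv|apply Rmin_l]].
apply Hd'; eapply Rlt_le_trans; [exact Hu|apply Rmin_r].
Qed.

Lemma ex_RInt_continuous_R (f : R -> R) a b : (forall s, continuous f s) -> ex_RInt f a b.
Proof. intros H; apply (ex_RInt_continuous (V := R_CompleteNormedModule)); intros; apply H. Qed.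

Lemma RInt_smooth_continuous (f : R2 -> R) L t : smooth f ->
  continuous (fun t => RInt (fun s => f (t, s)) 0 L) t.
Proof.
intros H; apply continuous_ex_derive; eexists.
apply (is_derive_RInt_param (fun t s => f (t, s)) 0 L t).
- apply filter_forall; intros u s _; now apply smooth_ex_derive_e1.
- intros s _; apply (continuity_2d_pt_ext (fun u v => dirD e1 f (u, v))); [intros; apply dirD_e1|].
  apply (smooth_continuity_2d (dirD e1 f)); now apply smooth_dirD.
- apply filter_forall; intros u; apply ex_RInt_continuous_R; intros s; now apply smooth_line_e2.
Qed.

Lemma D3_components (h : R2 -> R3) v p : D3 v h p =
  (dirD v (fun q => fst (fst (h q))) p, dirD v (fun q => snd (fst (h q))) p, dirD v (fun q => snd (h q)) p).
Proof. reflexivity. Qed.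

Lemma D3_e2_velocity (h : R2 -> R3) (t s : R) : D3 e2 h (t, s) = velocity (fun u => h (t, u)) s.
Proof. now rewrite D3_components, velocity_components, !dirD_e2. Qed.

Lemma D3_e1_velocity (h : R2 -> R3) (t s : R) : D3 e1 h (t, s) = velocity (fun u => h (u, s)) t.
Proof. now rewrite D3_components, velocity_components, !dirD_e1. Qed.

Lemma D3_scal3 k (h : R2 -> R3) v p : D3 v (fun q => scal3 k (h q)) p = scal3 k (D3 v h p).
Proof.
rewrite !D3_components; unfold scal3, dirD.
f_equal; [f_equal|]; rewrite <- Derive_scal; apply Derive_ext; intros u; now destruct (h _) as [[? ?] ?].
Qed.

Lemma D3_comm (h : R2 -> R3) p : smoothR3 h -> D3 e1 (D3 e2 h) p = D3 e2 (D3 e1 h) p.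
Proof.
intros [H1 [H2 H3]]; rewrite !D3_components.
f_equal; [f_equal|]; now apply dirD_comm.
Qed.

(** The hypothesis is local because a contraction is known to lie on the sphere only for parameters
    between 0 and 1. *)
Lemma velocity_constant_norm (c : R -> R3) s : ex_derive (fun t => fst (fst (c t))) s /\
    ex_derive (fun t => snd (fst (c t))) s /\ ex_derive (fun t => snd (c t)) s ->
  (exists d, 0 < d /\ forall t, Rabs (t - s) < d -> dot3 (c t) (c t) = 1) ->
  dot3 (c s) (velocity c s) = 0.
Proof.
intros [H1 [H2 H3]] [d [Hd H]].
apply Derive_correct in H1; apply Derive_correct in H2; apply Derive_correct in H3.
pose proof (is_derive_Rplus _ _ _ _ _ (is_derive_Rplus _ _ _ _ _
  (is_derive_Rmult _ _ _ _ _ H1 H1) (is_derive_Rmult _ _ _ _ _ H2 H2)) (is_derive_Rmult _ _ _ _ _ H3 H3)) as D.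
cbv beta in D.
assert (D0 : is_derive (fun _ : R => 1) s
  (Derive (fun t => fst (fst (c t))) s * fst (fst (c s)) + fst (fst (c s)) * Derive (fun t => fst (fst (c t))) s
   + (Derive (fun t => snd (fst (c t))) s * snd (fst (c s)) + snd (fst (c s)) * Derive (fun t => snd (fst (c t))) s)
   + (Derive (fun t => snd (c t)) s * snd (c s) + snd (c s) * Derive (fun t => snd (c t)) s))).
{ refine (is_derive_ext_loc _ _ _ _ _ D); exists (mkposreal d Hd); intros t Ht.
  specialize (H t Ht); rewrite dot3_split in H; exact H. }
pose proof (is_derive_unique _ _ _ D0) as E1.
pose proof (is_derive_unique _ _ _ (is_derive_Rconst 1 s)) as E2.
assert (E : 0 = Derive (fun t => fst (fst (c t))) s * fst (fst (c s)) + fst (fst (c s)) * Derive (fun t => fst (fst (c t))) s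
   + (Derive (fun t => snd (fst (c t))) s * snd (fst (c s)) + snd (fst (c s)) * Derive (fun t => snd (fst (c t))) s)
   + (Derive (fun t => snd (c t)) s * snd (c s) + snd (c s) * Derive (fun t => snd (c t)) s))
  by (transitivity (Derive (fun _ : R => 1) s); [symmetry; exact E2|exact E1]).
rewrite velocity_components, dot3_split; cbn [fst snd]; lra.
Qed.

(** * Stokes' theorem for the contraction of a closed curve *)

Definition stokes_form (P : R3) (h : R2 -> R3) (q : R2) : R :=
  - det3 P (h q) (D3 e2 h q) / (1 - dot3 (h q) P).

(** The derivative of [stokes_form] along [e1] by the quotient rule. An explicit formula makes its
    joint continuity evident, as differentiation under the integral requires. *)
Definition stokes_deriv (P : R3) (h : R2 -> R3) (q : R2) : R :=
  ((- det3 P (D3 e1 h q) (D3 e2 h q) - det3 P (h q) (D3 e1 (D3 e2 h) q)) * (1 - dot3 (h q) P)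
   - (- det3 P (h q) (D3 e2 h q)) * (- dot3 (D3 e1 h q) P)) / (1 - dot3 (h q) P) ^ 2.

Lemma det3_zero_l (v w : R3) : det3 (0, 0, 0) v w = 0.
Proof. destruct v as [[? ?] ?], w as [[? ?] ?]; unfold det3, dot3, cross3; ring. Qed.

Lemma is_derive_det3_quotient (P : R3) (h k : R2 -> R3) v p : smoothR3 h -> smoothR3 k ->
  1 - dot3 (h p) P <> 0 ->
  is_derive (fun u : R => - det3 P (h (plus p (scal u v))) (k (plus p (scal u v)))
      / (1 - dot3 (h (plus p (scal u v))) P)) 0
    (((- det3 P (D3 v h p) (k p) - det3 P (h p) (D3 v k p)) * (1 - dot3 (h p) P)
      - (- det3 P (h p) (k p)) * (- dot3 (D3 v h p) P)) / (1 - dot3 (h p) P) ^ 2).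
Proof.
intros Hh Hk H0.
assert (S1 : smooth (fun q => det3 P (h q) (k q))) by exact (smooth_det3 _ _ _ (smoothR3_const P) Hh Hk).
assert (S2 : smooth (fun q => dot3 (h q) P)) by exact (smooth_dot3 _ _ Hh (smoothR3_const P)).
pose proof (is_derive_dirD _ p v S1) as D1.
pose proof (dirD_det3 (fun _ => P) h k v p (smoothR3_const P) Hh Hk) as E1; cbv beta in E1.
rewrite D3_const, det3_zero_l in E1; rewrite E1 in D1.
pose proof (is_derive_dirD _ p v S2) as D2; rewrite dirD_dot3 in D2 by trivial.
assert (Hi : is_derive (fun u : R => / (1 - dot3 (h (plus p (scal u v))) P)) 0
  (- (0 - dot3 (D3 v h p) P) / (1 - dot3 (h p) P) ^ 2)).
{ pose proof (is_derive_Rminus _ _ _ _ _ (is_derive_Rconst 1 0) D2) as D3.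
  pose proof (is_derive_inv _ _ _ D3) as Hi; cbv beta in Hi; rewrite line_0 in Hi; now apply Hi. }
assert (D1' : is_derive (fun u : R => - det3 P (h (plus p (scal u v))) (k (plus p (scal u v)))) 0
  (- (0 + det3 P (D3 v h p) (k p) + det3 P (h p) (D3 v k p)))).
{ exact (is_derive_opp _ _ _ D1). }
eapply is_derive_value.
- exact (is_derive_Rmult _ _ _ _ _ D1' Hi).
- cbv beta; rewrite line_0; real_eq; field; exact H0.
Qed.

Lemma is_derive_line (f : R2 -> R) (p v : R2) (g : R -> R) (s d : R) :
  (forall u : R, g (s + u) = f (plus p (scal u v))) ->
  is_derive (fun u : R => f (plus p (scal u v))) 0 d -> is_derive g s d.
Proof.
intros H Hd.
apply (is_derive_Rext (fun t => f (plus p (scal (t - s) v)))).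
{ intros t; rewrite <- H; f_equal; ring. }
replace d with (scal 1 d) by (unfold scal; simpl; unfold mult; simpl; real_eq; ring).
apply (is_derive_comp (fun u : R => f (plus p (scal u v))) (fun t => t - s) s d 1).
- replace (s - s) with 0 by ring; exact Hd.
- eapply is_derive_value; [exact (is_derive_Rminus _ _ _ _ _ (is_derive_Rid s) (is_derive_Rconst s s))|ring].
Qed.

Lemma line_e1 (t s u : R) : plus ((t, s) : R2) (scal u e1) = (t + u, s).
Proof.
unfold plus, scal, e1; simpl; unfold prod_plus, prod_scal, plus, scal; simpl; unfold mult; simpl.
refine (f_equal2 pair _ _); real_eq; ring.
Qed.

Lemma line_e2 (t s u : R) : plus ((t, s) : R2) (scal u e2) = (t, s + u).
Proof.
unfold plus, scal, e2; simpl; unfold prod_plus, prod_scal, plus, scal; simpl; unfold mult; simpl.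
refine (f_equal2 pair _ _); real_eq; ring.
Qed.

Lemma stokes_form_e1 P h (t s : R) : smoothR3 h -> 1 - dot3 (h (t, s)) P <> 0 ->
  is_derive (fun u => stokes_form P h (u, s)) t (stokes_deriv P h (t, s)).
Proof.
intros Hh H0.
apply (is_derive_line (stokes_form P h) (t, s) e1); [intros u; now rewrite line_e1|].
exact (is_derive_det3_quotient P h (D3 e2 h) e1 (t, s) Hh (smoothR3_D3 _ _ Hh) H0).
Qed.

Lemma stokes_deriv_continuity P h (t s : R) : smoothR3 h -> 1 - dot3 (h (t, s)) P <> 0 ->
  continuity_2d_pt (fun u v => stokes_deriv P h (u, v)) t s.
Proof.
intros Hh H0; unfold stokes_deriv.
assert (S : forall f : R2 -> R, smooth f -> continuity_2d_pt (fun u v => f (u, v)) t s)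
  by (intros; now apply smooth_continuity_2d).
pose proof (smoothR3_const P) as HP; pose proof (smoothR3_D3 h e1 Hh) as H1.
pose proof (smoothR3_D3 h e2 Hh) as H2; pose proof (smoothR3_D3 _ e1 H2) as H12.
assert (HD : smooth (fun q => 1 - dot3 (h q) P)).
{ apply (smooth_minus (fun _ => 1)); [apply smooth_const|now apply smooth_dot3]. }
assert (HN : smooth (fun q => (- det3 P (D3 e1 h q) (D3 e2 h q) - det3 P (h q) (D3 e1 (D3 e2 h) q)) * (1 - dot3 (h q) P)
   - (- det3 P (h q) (D3 e2 h q)) * (- dot3 (D3 e1 h q) P))).
{ replace (fun q => (- det3 P (D3 e1 h q) (D3 e2 h q) - det3 P (h q) (D3 e1 (D3 e2 h) q)) * (1 - dot3 (h q) P)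
    - (- det3 P (h q) (D3 e2 h q)) * (- dot3 (D3 e1 h q) P))
   with (fun q => ((-1) * det3 P (D3 e1 h q) (D3 e2 h q) - det3 P (h q) (D3 e1 (D3 e2 h) q)) * (1 - dot3 (h q) P)
    - det3 P (h q) (D3 e2 h q) * dot3 (D3 e1 h q) P)
   by (apply functional_extensionality; intros; ring).
  apply (smooth_minus (fun q => ((-1) * det3 P (D3 e1 h q) (D3 e2 h q) - det3 P (h q) (D3 e1 (D3 e2 h) q)) * (1 - dot3 (h q) P))
    (fun q => det3 P (h q) (D3 e2 h q) * dot3 (D3 e1 h q) P)).
  - apply (smooth_mult (fun q => (-1) * det3 P (D3 e1 h q) (D3 e2 h q) - det3 P (h q) (D3 e1 (D3 e2 h) q))); trivial.
    apply (smooth_minus (fun q => (-1) * det3 P (D3 e1 h q) (D3 e2 h q))).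
    + apply (smooth_scal (-1)); now apply (smooth_det3 (fun _ => P)).
    + now apply (smooth_det3 (fun _ => P)).
  - apply (smooth_mult (fun q => det3 P (h q) (D3 e2 h q))).
    + now apply (smooth_det3 (fun _ => P)).
    + now apply (smooth_dot3 (D3 e1 h) (fun _ => P)). }
unfold Rdiv; apply continuity_2d_pt_mult; [exact (S _ HN)|].
apply (continuity_2d_pt_inv (fun u v => (1 - dot3 (h (u, v)) P) ^ 2)).
- pose proof (smooth_mult _ _ HD HD) as HDD; pose proof (S _ HDD) as E.
  apply continuity_2d_pt_ext with (2 := E); intros u v; real_eq; ring.
- now apply pow_nonzero.
Qed.

Lemma continuity_2d_line (f : R -> R -> R) t s : continuity_2d_pt f t s -> continuous (fun v => f t v) s.
Proof.
intros H; apply continuity_pt_filterlim, continuity_pt_locally; intros eps.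
destruct (H eps) as [d Hd]; exists d; intros v Hv; apply Hd; [|exact Hv].
rewrite Rminus_diag, Rabs_R0; apply d.
Qed.

(** The pulled-back area form is the derivative in t of the ds-component of its primitive minus the
    derivative in s of the dt-component [M]. The latter is periodic in s and integrates to zero. The
    bounds on t are strict since orthogonality of the t-derivative to the sphere needs a two-sided
    neighbourhood. *)
Lemma stokes_strip P h L (t : R) : smoothR3 h -> dot3 P P = 1 -> 0 < t < 1 ->
  (forall u s : R, 0 <= u <= 1 -> dot3 (h (u, s)) (h (u, s)) = 1 /\ h (u, s) <> P /\ h (u, s + L) = h (u, s)) ->
  RInt (fun s => stokes_deriv P h (t, s)) 0 L =
  RInt (fun s => det3 (h (t, s)) (D3 e1 h (t, s)) (D3 e2 h (t, s))) 0 L.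
Proof.
intros Hh HP Ht H.
assert (HD : forall s : R, 1 - dot3 (h (t, s)) P <> 0).
{ intros s; destruct (H t s ltac:(lra)) as [Hn [Hne _]].
  apply Rgt_not_eq, Rlt_0_minus; exact (dot3_lt_1 _ _ Hn HP Hne). }
pose proof (smoothR3_D3 h e1 Hh) as H1; pose proof (smoothR3_D3 h e2 Hh) as H2.
assert (Hcomp : forall s : R, (ex_derive (fun u => fst (fst (h (t, u)))) s /\
   ex_derive (fun u => snd (fst (h (t, u)))) s /\ ex_derive (fun u => snd (h (t, u))) s) /\
   (ex_derive (fun u => fst (fst (h (u, s)))) t /\
   ex_derive (fun u => snd (fst (h (u, s)))) t /\ ex_derive (fun u => snd (h (u, s))) t)).
{ intros s; destruct Hh as [A1 [A2 A3]]; repeat split.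
  - exact (smooth_ex_derive_e2 _ t s A1).
  - exact (smooth_ex_derive_e2 _ t s A2).
  - exact (smooth_ex_derive_e2 _ t s A3).
  - exact (smooth_ex_derive_e1 _ t s A1).
  - exact (smooth_ex_derive_e1 _ t s A2).
  - exact (smooth_ex_derive_e1 _ t s A3). }
assert (Ha : forall s : R, dot3 (h (t, s)) (D3 e1 h (t, s)) = 0).
{ intros s; rewrite D3_e1_velocity; apply (velocity_constant_norm (fun u => h (u, s)) t).
  - apply Hcomp.
  - exists (Rmin t (1 - t)); split; [apply Rmin_glb_lt; lra|]; intros u Hu.
    pose proof (Rmin_l t (1 - t)); pose proof (Rmin_r t (1 - t)).
    apply Rabs_lt_between in Hu; apply H; lra. }
assert (Hb : forall s : R, dot3 (h (t, s)) (D3 e2 h (t, s)) = 0).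
{ intros s; rewrite D3_e2_velocity; apply (velocity_constant_norm (fun u => h (t, u)) s).
  - apply Hcomp.
  - exists 1; split; [lra|]; intros u _; apply H; lra. }
set (dM := fun s : R => ((- det3 P (D3 e2 h (t, s)) (D3 e1 h (t, s)) - det3 P (h (t, s)) (D3 e2 (D3 e1 h) (t, s)))
   * (1 - dot3 (h (t, s)) P)
   - (- det3 P (h (t, s)) (D3 e1 h (t, s))) * (- dot3 (D3 e2 h (t, s)) P)) / (1 - dot3 (h (t, s)) P) ^ 2).
set (M := fun s : R => - det3 P (h (t, s)) (D3 e1 h (t, s)) / (1 - dot3 (h (t, s)) P)).
assert (HM : forall s : R, is_derive M s (dM s)).
{ intros s; apply (is_derive_line (fun q => - det3 P (h q) (D3 e1 h q) / (1 - dot3 (h q) P)) (t, s) e2).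
  - intros u; now rewrite line_e2.
  - exact (is_derive_det3_quotient P h (D3 e1 h) e2 (t, s) Hh H1 (HD s)). }
assert (Halg : forall s : R, stokes_deriv P h (t, s) - dM s = det3 (h (t, s)) (D3 e1 h (t, s)) (D3 e2 h (t, s))).
{ intros s; specialize (HD s).
  pose proof (stokes_algebra P (h (t, s)) (D3 e1 h (t, s)) (D3 e2 h (t, s)) (D3 e1 (D3 e2 h) (t, s))
    HP (proj1 (H t s ltac:(lra))) (Ha s) (Hb s)) as E; cbv zeta in E.
  unfold stokes_deriv, dM; rewrite <- (D3_comm h (t, s) Hh).
  unfold Rdiv; rewrite <- Rmult_minus_distr_r, E; field; exact HD. }
assert (Rsh : forall a b c : R, a - b = c -> a - c = b) by (intros; lra).
assert (Rsh2 : forall a b c : R, a - b = c -> a = b + c) by (intros; lra).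
assert (Hc1 : forall s : R, continuous (fun s => stokes_deriv P h (t, s)) s).
{ intros s; apply (continuity_2d_line (fun u v => stokes_deriv P h (u, v))).
  now apply stokes_deriv_continuity. }
assert (Hc2 : forall s : R, continuous (fun s => det3 (h (t, s)) (D3 e1 h (t, s)) (D3 e2 h (t, s))) s).
{ intros s; apply (smooth_line_e2 (fun q => det3 (h q) (D3 e1 h q) (D3 e2 h q))); now apply smooth_det3. }
assert (Hc3 : forall s : R, continuous dM s).
{ intros s; apply (continuous_ext (fun s => stokes_deriv P h (t, s) -
    det3 (h (t, s)) (D3 e1 h (t, s)) (D3 e2 h (t, s)))).
  - intros u; exact (Rsh _ _ _ (Halg u)).
  - apply (continuous_minus (fun s => stokes_deriv P h (t, s))); [apply Hc1|apply Hc2]. }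
assert (EL : M L = M 0).
{ assert (E0 : forall u : R, 0 <= u <= 1 -> h (u, L) = h (u, 0)).
  { intros u Hu; destruct (H u 0 Hu) as [_ [_ E]]; rewrite Rplus_0_l in E; exact E. }
  assert (E1 : D3 e1 h (t, L) = D3 e1 h (t, 0)).
  { rewrite !D3_e1_velocity, !velocity_components.
    assert (Hloc : locally t (fun u : R => h (u, L) = h (u, 0))).
    { assert (Hm : 0 < Rmin t (1 - t)) by (apply Rmin_glb_lt; lra).
      exists (mkposreal _ Hm); intros u Hu; apply E0.
      assert (Hu' : Rabs (u - t) < Rmin t (1 - t)) by exact Hu.
      pose proof (Rmin_l t (1 - t)); pose proof (Rmin_r t (1 - t)).
      apply Rabs_lt_between in Hu'; lra. }
    f_equal; [f_equal|]; apply Derive_ext_loc; (eapply filter_imp; [|exact Hloc]);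
     intros u Eu; cbv beta; now rewrite Eu. }
  unfold M; rewrite E1, (E0 t) by lra; reflexivity. }
transitivity (RInt (fun s => dM s + det3 (h (t, s)) (D3 e1 h (t, s)) (D3 e2 h (t, s))) 0 L).
{ apply RInt_ext; intros s _; exact (Rsh2 _ _ _ (Halg s)). }
rewrite (RInt_plus (V := R_CompleteNormedModule) dM) by now apply ex_RInt_continuous_R.
rewrite (RInt_antiderivative M dM 0 L HM Hc3), EL; unfold plus; simpl; real_eq; ring.
Qed.

(** Maps the whole line into the interval from 0 to 1 and is stationary wherever it attains 0 or 1.
    After this substitution the integrals over the curves are differentiable for all real t. *)
Definition ease (t : R) : R := (1 - cos (PI * t)) / 2.
Definition ease' (t : R) : R := PI / 2 * sin (PI * t).

Lemma is_derive_ease t : is_derive ease t (ease' t).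
Proof. unfold ease, ease'; auto_derive; trivial; real_eq; field. Qed.

Lemma continuous_ease' t : continuous ease' t.
Proof. apply continuous_ex_derive; unfold ease'; auto_derive; trivial. Qed.

Lemma ease_range t : 0 <= ease t <= 1.
Proof. unfold ease; pose proof (COS_bound (PI * t)); lra. Qed.

Lemma ease_interior t : ease' t = 0 \/ 0 < ease t < 1.
Proof.
unfold ease', ease; pose proof (COS_bound (PI * t)) as [H1 H2].
pose proof (sin2_cos2 (PI * t)) as E; unfold Rsqr in E.
destruct (Req_dec (sin (PI * t)) 0) as [H|H]; [left; rewrite H; ring|right].
assert (0 < sin (PI * t) * sin (PI * t)) by nra.
split; nra.
Qed.

Lemma ease_0 : ease 0 = 0.
Proof. unfold ease; rewrite Rmult_0_r, cos_0; field. Qed.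

Lemma ease_1 : ease 1 = 1.
Proof. unfold ease; rewrite Rmult_1_r, cos_PI; field. Qed.

(* The integral of the form over the curve at time ease t is differentiated in
   t; the vanishing of ease' at 0 and 1 makes the behaviour of F outside of the
   strip 0 <= t <= 1 irrelevant. *)
Lemma stokes_disc P (h : R2 -> R3) L : smoothR3 h -> dot3 P P = 1 ->
  (forall u s : R, 0 <= u <= 1 -> dot3 (h (u, s)) (h (u, s)) = 1 /\ h (u, s) <> P /\ h (u, s + L) = h (u, s)) ->
  RInt (fun t => RInt (fun s => det3 (h (t, s)) (D3 e1 h (t, s)) (D3 e2 h (t, s))) 0 L) 0 1 =
  RInt (fun s => stokes_form P h (1, s)) 0 L - RInt (fun s => stokes_form P h (0, s)) 0 L.
Proof.
intros Hh HP H.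
set (a := fun t : R => RInt (fun s => det3 (h (t, s)) (D3 e1 h (t, s)) (D3 e2 h (t, s))) 0 L).
assert (HD : forall t s : R, 1 - dot3 (h (ease t, s)) P <> 0).
{ intros t s; destruct (H (ease t) s (ease_range t)) as [Hn [Hne _]].
  apply Rgt_not_eq, Rlt_0_minus; exact (dot3_lt_1 _ _ Hn HP Hne). }
assert (Ha : forall t, continuous a t).
{ intros t; apply (RInt_smooth_continuous (fun q => det3 (h q) (D3 e1 h q) (D3 e2 h q))).
  apply smooth_det3; trivial; now apply smoothR3_D3. }
set (I := fun t => RInt (fun s => stokes_form P h (ease t, s)) 0 L).
assert (Hc1 : forall t s : R, continuous (fun s => stokes_deriv P h (ease t, s)) s).
{ intros t s; apply (continuity_2d_line (fun u v => stokes_deriv P h (u, v))).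
  now apply stokes_deriv_continuity. }
assert (Hf : forall t s : R, is_derive (fun u => stokes_form P h (ease u, s)) t
  (ease' t * stokes_deriv P h (ease t, s))).
{ intros t s; apply (is_derive_comp (fun u => stokes_form P h (u, s)) ease t
    (stokes_deriv P h (ease t, s)) (ease' t)); [now apply stokes_form_e1|apply is_derive_ease]. }
assert (Hsc : forall t s : R, continuous (fun s => stokes_form P h (ease t, s)) s).
{ intros t s; destruct Hh as [A1 [A2 A3]].
  assert (Hh' : smoothR3 h) by (split; [|split]; trivial).
  unfold stokes_form, Rdiv.
  apply (continuous_mult (fun s => - det3 P (h (ease t, s)) (D3 e2 h (ease t, s)))
    (fun s => / (1 - dot3 (h (ease t, s)) P))).
  - apply (continuous_opp (fun s => det3 P (h (ease t, s)) (D3 e2 h (ease t, s)))).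
    apply (smooth_line_e2 (fun q => det3 P (h q) (D3 e2 h q))).
    apply (smooth_det3 (fun _ => P)); trivial; [apply smoothR3_const|now apply smoothR3_D3].
  - apply continuous_ex_derive; apply (ex_derive_inv (fun s => 1 - dot3 (h (ease t, s)) P));
      [|apply HD].
    assert (S : smooth (fun q => 1 - dot3 (h q) P)).
    { apply (smooth_minus (fun _ => 1)); [apply smooth_const|].
      apply (smooth_dot3 h (fun _ => P)); trivial; apply smoothR3_const. }
    exact (smooth_ex_derive_e2 _ (ease t) s S). }
assert (HI : forall t, is_derive I t (ease' t * a (ease t))).
{ intros t; apply is_derive_value with
    (RInt (fun s => Derive (fun u => stokes_form P h (ease u, s)) t) 0 L).
  - apply (is_derive_RInt_param (fun t s => stokes_form P h (ease t, s)) 0 L t).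
    + apply filter_forall; intros u s _; eexists; apply Hf.
    + intros s _.
      apply (continuity_2d_pt_ext (fun u v => ease' u * stokes_deriv P h (ease u, v))).
      { intros u v; symmetry; apply is_derive_unique, Hf. }
      apply continuity_2d_pt_mult.
      * apply continuity_1d_2d_pt_comp; [|apply continuity_2d_pt_id1].
        apply continuity_pt_filterlim, continuous_ease'.
      * apply (continuity_2d_reparam (fun u v => stokes_deriv P h (u, v)) ease).
        -- now apply stokes_deriv_continuity.
        -- apply continuity_pt_filterlim, continuous_ex_derive; eexists; apply is_derive_ease.
    + apply filter_forall; intros u; apply ex_RInt_continuous_R; intros s; apply Hsc.
  - transitivity (RInt (fun s => ease' t * stokes_deriv P h (ease t, s)) 0 L).
    { apply RInt_ext; intros s _; apply is_derive_unique, Hf. }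
    rewrite (RInt_scal (V := R_CompleteNormedModule) (fun s => stokes_deriv P h (ease t, s)))
      by (apply ex_RInt_continuous_R; intros; apply Hc1).
    destruct (ease_interior t) as [E|Hin].
    + rewrite E; unfold scal; simpl; unfold mult; simpl; real_eq; ring.
    + rewrite (stokes_strip P h L (ease t) Hh HP Hin H); reflexivity. }
assert (Hcomp : RInt (fun t => scal (ease' t) (a (ease t))) 0 1 = RInt a (ease 0) (ease 1)).
{ apply (RInt_comp (V := R_CompleteNormedModule) a ease ease' 0 1).
  - intros t _; apply Ha.
  - intros t _; split; [apply is_derive_ease|apply continuous_ease']. }
rewrite ease_0, ease_1 in Hcomp; rewrite <- Hcomp.
transitivity (I 1 - I 0); [|unfold I; rewrite ease_0, ease_1; reflexivity].
apply (RInt_antiderivative I (fun t => ease' t * a (ease t)) 0 1 HI).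
intros t; apply (continuous_mult ease' (fun t => a (ease t))); [apply continuous_ease'|].
apply (continuous_comp ease a); [|apply Ha].
apply continuous_ex_derive; eexists; apply is_derive_ease.
Qed.

(** Scaling by sqrt G leads to the unit sphere and multiplies areas by G. The contraction starts at
    a constant curve, on which the form vanishes, so Stokes' theorem leaves only the integral over
    the given curve. *)
Lemma enclosed_area_theta G L c A : 0 < G -> enclosed_area G L c A ->
  exists P, dot3 P P = 1 /\ (forall s, scal3 (sqrt G) (c s) <> P) /\
    G * A = RInt (theta_form P (fun s => scal3 (sqrt G) (c s))) 0 L.
Proof.
intros HG [p [F [HF [Hp [H HA]]]]].
assert (Hg : 0 < sqrt G) by now apply sqrt_lt_R0.
assert (Hg2 : sqrt G * sqrt G = G) by (apply sqrt_sqrt; lra).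
set (P := scal3 (sqrt G) p); set (h := fun q : R2 => scal3 (sqrt G) (F q)).
assert (HP : dot3 P P = 1) by (unfold P; rewrite dot3_scal3, Hg2, Hp; field; lra).
assert (Hh : smoothR3 h) by now apply smoothR3_scal3.
assert (Hinj : forall u v, scal3 (sqrt G) u = scal3 (sqrt G) v -> u = v).
{ intros [[x y] z] [[x' y'] z'] E; unfold scal3 in E; injection E as E1 E2 E3.
  f_equal; [f_equal|]; apply (Rmult_eq_reg_l (sqrt G)); lra. }
assert (HH : forall u s : R, 0 <= u <= 1 ->
  dot3 (h (u, s)) (h (u, s)) = 1 /\ h (u, s) <> P /\ h (u, s + L) = h (u, s)).
{ intros u s Hu; destruct (H u s Hu) as [E1 [E2 [E3 _]]]; unfold h; split; [|split].
  - rewrite dot3_scal3, Hg2; transitivity (G * / G); [apply f_equal; exact E1|field; lra].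
  - intros E; apply E2, Hinj, E.
  - exact (f_equal (scal3 (sqrt G)) E3). }
exists P; split; [trivial|split].
{ intros s E; destruct (HH 1 s ltac:(lra)) as [_ [Hne _]]; apply Hne; rewrite <- E.
  destruct (H 1 s ltac:(lra)) as [_ [_ [_ [_ E1]]]]; exact (f_equal (scal3 (sqrt G)) E1). }
pose proof (stokes_disc P h L Hh HP HH) as HS.
assert (E0 : RInt (fun s => stokes_form P h (0, s)) 0 L = 0).
{ transitivity (RInt (fun _ : R => 0) 0 L); [|rewrite RInt_const_R; real_eq; ring].
  apply RInt_ext; intros s _.
  assert (Z : D3 e2 h (0, s) = (0, 0, 0)).
  { rewrite D3_e2_velocity, (velocity_ext _ (fun _ => h (0, 0))).
    - rewrite velocity_components, !Derive_const; reflexivity.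
    - intros u; destruct (H 0 u ltac:(lra)) as [_ [_ [_ [E _]]]]; exact (f_equal (scal3 (sqrt G)) E). }
  unfold stokes_form; rewrite Z.
  destruct P as [[? ?] ?], (h (0, s)) as [[? ?] ?]; unfold det3, dot3, cross3, Rdiv; real_eq; ring. }
assert (E1 : RInt (fun s => stokes_form P h (1, s)) 0 L =
  RInt (theta_form P (fun s => scal3 (sqrt G) (c s))) 0 L).
{ assert (Ec : forall u : R, h (1, u) = scal3 (sqrt G) (c u)).
  { intros u; destruct (H 1 u ltac:(lra)) as [_ [_ [_ [_ E]]]]; exact (f_equal (scal3 (sqrt G)) E). }
  apply RInt_ext; intros s _; unfold stokes_form, theta_form.
  rewrite D3_e2_velocity, (velocity_ext _ _ s Ec), Ec; reflexivity. }
rewrite E0, E1, Rminus_0_r in HS; rewrite <- HS, HA.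
transitivity (scal G (RInt (fun t => RInt (fun s =>
  det3 (scal3 (sqrt G) (F (t, s))) (D3 e1 F (t, s)) (D3 e2 F (t, s))) 0 L) 0 1)); [reflexivity|].
assert (Hsm : smooth (fun q => det3 (scal3 (sqrt G) (F q)) (D3 e1 F q) (D3 e2 F q))).
{ apply smooth_det3; [exact Hh| |]; now apply smoothR3_D3. }
rewrite <- (RInt_scal (V := R_CompleteNormedModule)).
2:{ apply ex_RInt_continuous_R; intros t.
  apply (RInt_smooth_continuous (fun q => det3 (scal3 (sqrt G) (F q)) (D3 e1 F q) (D3 e2 F q)) L t Hsm). }
apply RInt_ext; intros t _; rewrite <- (RInt_scal (V := R_CompleteNormedModule)).
2:{ apply ex_RInt_continuous_R; intros s; apply (smooth_line_e2 _ t s Hsm). }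
apply RInt_ext; intros s _; unfold h; rewrite !D3_scal3, !det3_scal3.
generalize (F (t, s)) (D3 e1 F (t, s)) (D3 e2 F (t, s)); intros u v w.
assert (X : det3 (scal3 (sqrt G) u) v w = sqrt G * det3 u v w).
{ destruct u as [[? ?] ?], v as [[? ?] ?], w as [[? ?] ?]; unfold det3, scal3, dot3, cross3; ring. }
transitivity (G * (sqrt G * det3 u v w)); [rewrite <- X; reflexivity|].
rewrite Hg2; real_eq; ring.
Qed.

(** Gauss-Bonnet modulo 4 pi is not assumed but results here from the definitions of area and
    winding number: both are expressed by the integral of alpha along the closed lift, which is then
    eliminated. *)
Lemma hopf_case G mu lam nu a b w1 w3 rho x0 n c l :
  (0 < n)%nat ->
  let L := 2 * INR n * w1 in
  let N := RtoC (INR n) in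
  let pi := RtoC PI in
  let eta1 := wzeta a b (RtoC w1) in
  0 < G ->
  sph_arclength G c ->
  (forall s, c (s + L) = c s) ->
  elastic_data G mu lam nu a b w1 w3 rho x0 (sph_curvature G c) ->
  hopf_lift G c l ->
  (forall s, l (s + L) = l s) ->
  RInt (sph_speed c) 0 L = L /\
  RtoC (willmore L (2 * PI) (hopf_torus l)) =
    (RtoC (/ sqrt G) *
     (RtoC 16 * N * eta1 * pi
      - RtoC 8 * N * RtoC w1 * RtoC (parE G mu) * pi))%C /\
  forall (A : R) (m : Z),
    enclosed_area G L c A ->
    winding_number G L c m ->
    conformal_class L (2 * PI) (hopf_torus l)
      (RtoC (2 * PI)) (RtoC (G * A / 2) + Ci * RtoC (sqrt G * L / 2))%C /\
    exists k : Z,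
      RtoC (G * A / 2) =
        (RtoC (IZR m) * pi - RtoC 4 * Ci * N * eta1 * x0
         - RtoC 2 * N * RtoC w1 *
             (RtoC (sph_curvature G c 0 / 2) - RtoC 2 * Ci * wzeta a b x0)
         + RtoC (2 * PI * IZR k))%C.
Proof.
intros Hn L N pi eta1 HG Hc Hper Hed Hl Hlper.
assert (HL : 0 < L) by (eapply half_period_pos; [apply (ed_omega1 _ _ _ _ _ _ _ _ _ _ _ Hed)|trivial]).
assert (Hg : 0 < sqrt G) by now apply sqrt_lt_R0.
assert (Hg2 : sqrt G * sqrt G = G) by (apply sqrt_sqrt; lra).
pose proof (sph_curvature_Cinf G c Hc) as Hk.
destruct (unit_lift_exists G c l Hc Hl) as [p1 [p2 [q1 [q2 [Hu ->]]]]].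
split; [|split].
- rewrite (RInt_ext _ (fun _ => 1)); [rewrite RInt_const_R; real_eq; ring|].
  intros s _; apply Hc.
- rewrite (willmore_hopf G c p1 p2 q1 q2 L HG Hc Hu), RtoC_mult, RtoC_plus; unfold L.
  rewrite (elastic_energy _ _ _ _ _ _ _ _ _ _ _ _ Hed (Cinf_ex_derive _ Hk)).
  + unfold N, pi, eta1, parE; generalize (wzeta a b (RtoC w1)); intros [u v].
    components; f_equal; field; lra.
  + rewrite <- (sph_curvature_periodic G c L 0 Hper); f_equal; unfold L; ring.
- intros A m HA Hm.
  destruct (enclosed_area_theta G L c A HG HA) as [P [HP [HPne EA]]].
  destruct (holonomy_theta G c p1 p2 q1 q2 L P HG Hu Hlper HP HPne) as [_ [k1 Ek1]].
  destruct (winding_number_curvature G L c m HG Hc Hm) as [Q [HQ [HQne EQ]]].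
  (* The point [Q] belonging to the winding number may differ from the point [P] belonging to the
     area, so the holonomy is evaluated for each of them. *)
  destruct (holonomy_theta G c p1 p2 q1 q2 L Q HG Hu Hlper HQ HQne) as [HQc [k2 Ek2]].
  specialize (EQ HQc).
  assert (EA2 : G * A / 2 = 2 * PI * IZR k1 - RInt (hopf_alpha p1 p2 q1 q2) 0 L).
  { rewrite EA, Ek1; field. }
  split; [now apply (conformal_class_hopf G c p1 p2 q1 q2 L A k1)|].
  destruct (elastic_total_curvature _ _ _ _ _ _ _ _ _ _ _ n Hed (Cinf_ex_derive _ Hk)) as [k3 Ek3].
  fold L in Ek3; rewrite EQ, Ek2 in Ek3.
  (* [k1] and [k2] are the winding numbers of the determinants for [P] and [Q], and [k3] comes from
     the ambiguity of the logarithm of sigma. *)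
  exists (k1 - k2 - k3)%Z; fold N eta1 in Ek3.
  replace (RtoC (G * A / 2)) with
    (RtoC (PI * IZR m) - RtoC ((2 * PI * IZR m - (4 * PI * IZR k2 - 2 * RInt (hopf_alpha p1 p2 q1 q2) 0 L)) / 2)
      + RtoC (2 * PI * (IZR k1 - IZR k2)))%C.
  + rewrite Ek3, !minus_IZR; unfold pi.
    replace (RtoC (2 * PI * (IZR k1 - IZR k2 - IZR k3)))
      with (RtoC (2 * PI * (IZR k1 - IZR k2)) - RtoC (2 * PI * IZR k3))%C
      by (rewrite <- RtoC_minus; f_equal; ring).
    rewrite RtoC_mult; ring.
  + rewrite <- RtoC_minus, <- RtoC_plus, EA2; f_equal; field.
Qed.

Theorem theorem5
  (G mu lam nu : R) (a b : C) (w1 w3 : R) (rho x0 : C) (n : nat) :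
  (0 < n)%nat ->
  let L := 2 * INR n * w1 in
  let N := RtoC (INR n) in
  let pi := RtoC PI in
  let eta1 := wzeta a b (RtoC w1) in
  (forall x y : R -> R,
     G < 0 -> lam = 0 ->
     RtoC ((mu + G) / 6) = wp a b (Ci * RtoC w3)%C ->
     hyp_arclength G x y ->
     (forall s, x (s + L) = x s /\ y (s + L) = y s) ->
     elastic_data G mu lam nu a b w1 w3 rho x0 (hyp_curvature G x y) ->
     hyp_profile x y (gammaE a b rho x0) ->
     constrained_willmore L (2 * PI) (revolution_torus x y) ->
     RInt (hyp_speed G x y) 0 L = L /\
     conformal_class L (2 * PI) (revolution_torus x y)
       (RtoC (2 * PI)) (Ci * RtoC (sqrt (- G) * L))%C /\
     RtoC (willmore L (2 * PI) (revolution_torus x y)) =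
       (RtoC (/ sqrt (- G)) *
        (RtoC 8 * N * eta1 * pi
         - RtoC 4 * N * RtoC w1 * wp a b (Ci * RtoC w3) * pi))%C)
  /\
  (forall (c : R -> R3) (l : R -> R4),
     0 < G ->
     sph_arclength G c ->
     (forall s, c (s + L) = c s) ->
     elastic_data G mu lam nu a b w1 w3 rho x0 (sph_curvature G c) ->
     sph_profile G c (gammaE a b rho x0) ->
     hopf_lift G c l ->
     (forall s, l (s + L) = l s) ->
     constrained_willmore L (2 * PI) (hopf_torus l) ->
     RInt (sph_speed c) 0 L = L /\
     RtoC (willmore L (2 * PI) (hopf_torus l)) =
       (RtoC (/ sqrt G) *
        (RtoC 16 * N * eta1 * pi
         - RtoC 8 * N * RtoC w1 * RtoC (parE G mu) * pi))%C /\
     forall (A : R) (m : Z),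
       enclosed_area G L c A ->
       winding_number G L c m ->
       conformal_class L (2 * PI) (hopf_torus l)
         (RtoC (2 * PI)) (RtoC (G * A / 2) + Ci * RtoC (sqrt G * L / 2))%C /\
       exists k : Z,
         RtoC (G * A / 2) =
           (RtoC (IZR m) * pi - RtoC 4 * Ci * N * eta1 * x0
            - RtoC 2 * N * RtoC w1 *
                (RtoC (sph_curvature G c 0 / 2) - RtoC 2 * Ci * wzeta a b x0)
            + RtoC (2 * PI * IZR k))%C).
Proof.
intros Hn L N pi eta1; split.
- intros x y HG _ Hwp Harc Hper Hed _ _; eapply revolution_case; eassumption.
- intros c l HG Hc Hper Hed _ Hl Hlper _; eapply hopf_case; eassumption.
Qed.
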